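(* Let $a\in\mathbb{R}$, let $n\geq 1$ be an integer, $1\leq q<\infty$, $\beta>0$, and let $\gamma$ satisfy $$0<\gamma<\min\bigl(n,\,2-(n-2)\beta\bigr).$$ Assume that $q\geq\beta+1$. Then the integral equation $$u(t)=e^{t\Delta}u_0+a\int_0^t e^{(t-\tau)\Delta}\bigl(|\cdot|^{-\gamma}|u(\tau)|^{\beta}u(\tau)\bigr)\,d\tau \qquad (\ast)$$ is locally well-posed in $\dot K_q^{\frac{n-\gamma}{\beta+1}-\frac nq,\,1}$. More precisely, for every $u_0\in\dot K_q^{\frac{n-\gamma}{\beta+1}-\frac nq,\,1}$ there exist $T>0$ and a unique solution $u\in C\bigl([0,T],\dot K_q^{\frac{n-\gamma}{\beta+1}-\frac nq,\,1}\bigr)$ of $(\ast)$. Moreover, the solution can be extended to a maximal interval $[0,T_{\max})$, where either $T_{\max}=\infty$, or $T_{\max}<\infty$ and $$\lim_{t\to T_{\max}}\|u(t)\|_{\dot K_q^{\frac{n-\gamma}{\beta+1}-\frac nq,\,1}}=\infty.$$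
   Context: For $k\in\mathbb{Z}$ let $B_k=B(0,2^k)\subset\mathbb{R}^n$, $R_k=B_k\setminus B_{k-1}$, and let $\chi_k$ be the characteristic function of $R_k$. For $\alpha\in\mathbb{R}$ and $1\leq p,q\leq\infty$, the homogeneous Herz space $\dot K_p^{\alpha,q}$ is the set of all $f\in L^p_{\mathrm{loc}}(\mathbb{R}^n\setminus\{0\})$ with $$\|f\|_{\dot K_p^{\alpha,q}}=\Bigl(\sum_{k=-\infty}^{\infty}2^{k\alpha q}\|f\chi_k\|_{L^p(\mathbb{R}^n)}^q\Bigr)^{1/q}<\infty,$$ with the usual modifications when $p=\infty$ and/or $q=\infty$. Here $e^{t\Delta}$ denotes the heat semigroup on $\mathbb{R}^n$ (convolution with the Gaussian heat kernel). Equation $(\ast)$ is the mild formulation of the Hardy--Hénon equation $\partial_t u=\Delta u+a|x|^{-\gamma}|u|^{\beta}u$, $u(0)=u_0$; a solution is a function $u$ satisfying $(\ast)$ on the relevant time interval. *)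

(* Defs.v *)
From HB Require Import structures.
From mathcomp Require Import all_boot all_order all_algebra.
From mathcomp Require Import all_classical all_reals all_analysis.

Set Implicit Arguments.
Unset Strict Implicit.
Unset Printing Implicit Defensive.

Import Order.TTheory GRing.Theory Num.Theory.
Import numFieldNormedType.Exports.

Local Open Scope classical_set_scope.
Local Open Scope ring_scope.

(* R^n is 'rV[R]_n with the product (= Borel) sigma-algebra, generated by the
   coordinates as the library does for n.-tuple. *)
Definition measure_rV_display : measure_display -> measure_display.
Proof. exact. Qed.

Section measurable_rV.
Context {d} {T : sigmaRingType d}.
Variable n : nat.

Let coors : 'I_n -> 'rV[T]_n -> T := fun i x => x ord0 i.

Let rV_set0 : g_sigma_preimage coors set0.
Proof. exact: sigma_algebra0. Qed.

Let rV_setC A : g_sigma_preimage coors A -> g_sigma_preimage coors (~` A).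
Proof. exact: sigma_algebraC. Qed.

Let rV_bigcup (F : _^nat) : (forall i, g_sigma_preimage coors (F i)) ->
  g_sigma_preimage coors (\bigcup_i (F i)).
Proof. exact: sigma_algebra_bigcup. Qed.

HB.instance Definition _ := @isMeasurable.Build (measure_rV_display d)
  'rV[T]_n (g_sigma_preimage coors) rV_set0 rV_setC rV_bigcup.

End measurable_rV.

Lemma measurable_rV_coord d (T : sigmaRingType d) n (i : 'I_n) :
  measurable_fun [set: 'rV[T]_n] (fun x : 'rV[T]_n => x ord0 i).
Proof.
move=> _ Y mY; rewrite setTI; apply: sub_sigma_algebra => /=.
rewrite -bigcup_seq/=; exists i => /=; first by rewrite mem_index_enum.
by exists Y => //; rewrite setTI.
Qed.

Lemma measurable_fun_rV d1 d2 (T1 : measurableType d1) (T2 : measurableType d2)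
    n (f : T1 -> 'rV[T2]_n) :
  (forall i, measurable_fun [set: T1] (fun x => f x ord0 i)) ->
  measurable_fun [set: T1] f.
Proof.
move=> mf _ A mA; rewrite setTI.
have sB : sigma_algebra setT [set B : set 'rV[T2]_n | measurable (f @^-1` B)].
  split=> [|B mB|F mF] /=.
  - by rewrite preimage_set0.
  - by rewrite setTD preimage_setC; exact: measurableC.
  - by rewrite preimage_bigcup; exact: bigcupT_measurable.
apply: (mA [set B | measurable (f @^-1` B)]); split => // B.
rewrite -bigcup_seq/= => -[i _ [C mC <-]] /=.
by rewrite setTI; have := mf i measurableT _ mC; rewrite setTI.
Qed.

Section lebesgue_measure_rV.
Context {R : realType}.
Local Open Scope ereal_scope.

Definition rV_cons n (p : R * 'rV[R]_n) : 'rV[R]_n.+1 :=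
  row_mx (p.1)%:M p.2 : 'rV[R]_(1 + n).

Definition rV_uncons n (x : 'rV[R]_n.+1) : R * 'rV[R]_n :=
  (x ord0 ord0, rsubmx (x : 'rV[R]_(1 + n))).

Lemma rV_consE0 n (p : R * 'rV[R]_n) : rV_cons p ord0 ord0 = p.1.
Proof.
have <- : lshift n (ord0 : 'I_1) = ord0 by exact/val_inj.
by rewrite [LHS]row_mxEl mxE eqxx mulr1n.
Qed.

Lemma rV_consES n (p : R * 'rV[R]_n) (i : 'I_n) :
  rV_cons p ord0 (lift ord0 i) = p.2 ord0 i.
Proof.
have -> : lift ord0 i = rshift 1 i by exact/val_inj.
by rewrite [LHS]row_mxEr.
Qed.

Lemma rV_consK n : cancel (@rV_cons n) (@rV_uncons n).
Proof.
move=> [r x]; rewrite /rV_uncons rV_consE0; congr (_, _).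
by rewrite /rV_cons row_mxKr.
Qed.

Lemma rV_unconsK n : cancel (@rV_uncons n) (@rV_cons n).
Proof.
move=> x; apply/rowP => i; case: (unliftP ord0 i) => [j|] ->.
  rewrite [LHS]rV_consES /= mxE; congr (x _ _); exact/val_inj.
by rewrite [LHS]rV_consE0.
Qed.

Lemma measurable_rV_cons n : measurable_fun setT (@rV_cons n).
Proof.
apply: measurable_fun_rV => i; case: (unliftP ord0 i) => [j|] ->.
  under eq_fun do rewrite rV_consES.
  exact: (measurableT_comp (measurable_rV_coord j) measurable_snd).
by under eq_fun do rewrite rV_consE0; exact: measurable_fst.
Qed.

Lemma measurable_rV_uncons n : measurable_fun setT (@rV_uncons n).
Proof.
apply/measurable_fun_pairP; split; first exact: (measurable_rV_coord ord0).
apply: measurable_fun_rV => i.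
rewrite (_ : (fun x => _) = fun x : 'rV[R]_n.+1 => x ord0 (rshift 1 i)).
  exact: (measurable_rV_coord (rshift 1 i : 'I_n.+1)).
by apply/funext => x /=; rewrite mxE.
Qed.

Section product_step.
Variables (n : nat) (mu : {sigma_finite_measure set 'rV[R]_n -> \bar R}).

Definition rV_product : set 'rV[R]_n.+1 -> \bar R :=
  pushforward (lebesgue_measure \x mu) (@rV_cons n).

Let rV_product0 : rV_product set0 = 0.
Proof. by rewrite /rV_product /pushforward preimage_set0 measure0. Qed.

Let rV_product_ge0 A : 0 <= rV_product A.
Proof. exact: (@measure_ge0 _ _ _ (lebesgue_measure \x mu)). Qed.

Let rV_product_sigma_additive : semi_sigma_additive rV_product.
Proof.
have mcons B : measurable B -> measurable (@rV_cons n @^-1` B).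
  by move=> mB; rewrite -[X in measurable X]setTI; exact: measurable_rV_cons.
move=> F mF tF mUF; rewrite /rV_product /pushforward preimage_bigcup.
apply: measure_semi_sigma_additive => [k||]; first exact: mcons.
  apply/trivIsetP => /= i j _ _ ij; rewrite -preimage_setI.
  by move/trivIsetP : tF => /(_ _ _ _ _ ij) ->//; rewrite preimage_set0.
by rewrite -preimage_bigcup; exact: mcons.
Qed.

HB.instance Definition _ := isMeasure.Build _ _ _ rV_product
  rV_product0 rV_product_ge0 rV_product_sigma_additive.

Let rV_product_sigma_finite : sigma_finite setT rV_product.
Proof.
have /sigma_finiteP[F [TF ndF Foo]] := sigma_finiteT (@lebesgue_measure R).
have /sigma_finiteP[G [TG ndG Goo]] := sigma_finiteT mu.
exists (fun k => @rV_uncons n @^-1` (F k `*` G k)).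
  apply/seteqP; split => // x _; rewrite -preimage_bigcup /=.
  have : [set: R] (rV_uncons x).1 by [].
  rewrite TF => -[i _ Fi]; have : [set: 'rV[R]_n] (rV_uncons x).2 by [].
  rewrite TG => -[j _ Gj]; exists (maxn i j) => //; split => /=.
  - by move: Fi; exact/subsetPset/ndF/leq_maxl.
  - by move: Gj; exact/subsetPset/ndG/leq_maxr.
move=> k; have [mF Fk] := Foo k; have [mG Gk] := Goo k; split.
  rewrite -[X in measurable X]setTI; apply: measurable_rV_uncons => //.
  exact: measurableX.
rewrite /rV_product /pushforward -comp_preimage.
rewrite (_ : _ \o _ = id) ?preimage_id; last first.
  by apply/funext => p /=; rewrite rV_consK.
by rewrite product_measure1E// lte_mul_pinfty// ge0_fin_numE.
Qed.

HB.instance Definition _ := Measure_isSigmaFinite.Build _ _ _ rV_product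
  rV_product_sigma_finite.

End product_step.

Fixpoint lebesgue_rV n : {sigma_finite_measure set 'rV[R]_n -> \bar R} :=
  match n with
  | 0%N => \d_(0%R : 'rV[R]_0)
  | m.+1 => rV_product (lebesgue_rV m)
  end.

Lemma lebesgue_rV_box n (A : 'I_n -> set R) : (forall i, measurable (A i)) ->
  lebesgue_rV n [set x : 'rV[R]_n | forall i, A i (x ord0 i)] =
  \prod_(i < n) lebesgue_measure (A i).
Proof.
elim: n A => [|n IH] A mA.
  by rewrite big_ord0 [LHS]diracE mem_set// => -[].
have mB : measurable [set x : 'rV[R]_n | forall i, A (lift ord0 i) (x ord0 i)].
  rewrite (_ : mkset _ = \bigcap_(i in [set: 'I_n])
      ((fun x : 'rV[R]_n => x ord0 i) @^-1` A (lift ord0 i))); last first.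
    by apply/seteqP; split=> x h i; [move=> _; exact: h|exact: (h i I)].
  apply: fin_bigcap_measurable => // i _.
  by rewrite -[X in measurable X]setTI; exact: measurable_rV_coord.
rewrite big_ord_recl -(IH (fun i => A (lift ord0 i)))//.
transitivity ((@lebesgue_measure R \x lebesgue_rV n) (A ord0 `*`
    [set x : 'rV[R]_n | forall i, A (lift ord0 i) (x ord0 i)])); last first.
  by rewrite product_measure1E//; exact: mA.
rewrite /= /rV_product /pushforward; congr (_ _).
apply/seteqP; split => [p h|p [h0 hS] i] /=.
  split=> [|i]; first by have := h ord0; rewrite rV_consE0.
  by have := h (lift ord0 i); rewrite rV_consES.
by case: (unliftP ord0 i) => [j|] ->; rewrite ?rV_consES ?rV_consE0.
Qed.

End lebesgue_measure_rV.

Section herz_space.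
Context {R : realType} {n : nat}.
Implicit Types (f : 'rV[R]_n -> R) (p q : \bar R) (alpha : R).

(* The library norm on 'rV[R]_n is the sup norm. *)
Definition eucl_norm (x : 'rV[R]_n) : R :=
  Num.sqrt (\sum_(i < n) x ord0 i ^+ 2).

Definition dyadic_ball (k : int) : set 'rV[R]_n :=
  [set x | eucl_norm x < 2 ^ k].

Definition dyadic_annulus (k : int) : set 'rV[R]_n :=
  dyadic_ball k `\` dyadic_ball (k - 1).

Definition Lnorm_on (A : set 'rV[R]_n) p f : \bar R :=
  'N[lebesgue_rV n]_p [EFin \o (f \* \1_A)].

Definition Lp_loc_away0 p f : Prop :=
  measurable_fun [set: 'rV[R]_n] f /\
  forall K : set 'rV[R]_n, compact K -> K `<=` ~` [set 0] ->
    (Lnorm_on K p f < +oo)%E.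

(* The value at q = -oo is junk. *)
Definition herz_norm alpha p q f : \bar R :=
  match q with
  | r%:E => ((\esum_(k in [set: int]) ((2 `^ (k%:~R * alpha * r))%:E *
                Lnorm_on (dyadic_annulus k) p f `^ r)) `^ r^-1)%E
  | +oo%E => ereal_sup [set ((2 `^ (k%:~R * alpha))%:E *
                Lnorm_on (dyadic_annulus k) p f)%E | k in [set: int]]
  | -oo%E => 0%E
  end.

(* Elements are Borel representatives; equality in the space is equality almost
   everywhere. *)
Definition herz alpha p q : set ('rV[R]_n -> R) :=
  [set f | Lp_loc_away0 p f /\ (herz_norm alpha p q f < +oo)%E].

(* u \in C(I, herz alpha p q) *)
Definition herz_continuous alpha p q (I : set R) (u : R -> 'rV[R]_n -> R) :=
  (forall t, I t -> herz alpha p q (u t)) /\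
  forall t, I t ->
    herz_norm alpha p q (u s \- u t) @[s --> within I (nbhs t)] --> 0%E.

End herz_space.

Section hardy_henon.
Context {R : realType} {n : nat}.
Implicit Types (f : 'rV[R]_n -> R) (u : R -> 'rV[R]_n -> R).

Definition heat_kernel (t : R) (x : 'rV[R]_n) : R :=
  (4 * pi * t) `^ (- (n%:R / 2)) * expR (- (eucl_norm x ^+ 2 / (4 * t))).

Definition heat (t : R) f (x : 'rV[R]_n) : R :=
  if t == 0 then f x
  else \int[lebesgue_rV n]_y (heat_kernel t (x - y) * f y).

(* The integral defining [heat t f x] converges absolutely. *)
Definition heat_defined (t : R) f (x : 'rV[R]_n) : Prop :=
  t != 0 ->
  (lebesgue_rV n).-integrable setT (fun y => (heat_kernel t (x - y) * f y)%:E).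

Definition hardy_henon_source (gamma beta : R) f (x : 'rV[R]_n) : R :=
  eucl_norm x `^ (- gamma) * `|f x| `^ beta * f x.

(* The integral equation at (t, x); the library integral is total, so absolute
   convergence of each integral involved is part of the equation. *)
Definition mild_at (a gamma beta : R) (u0 : 'rV[R]_n -> R) u
    (t : R) (x : 'rV[R]_n) : Prop :=
  let F tau := hardy_henon_source gamma beta (u tau) in
  [/\ heat_defined t u0 x,
      forall tau, 0 <= tau < t -> heat_defined (t - tau) (F tau) x,
      (@lebesgue_measure R).-integrable `[0, t]
        (fun tau => (heat (t - tau) (F tau) x)%:E) &
      u t x = heat t u0 x +
        a * \int[@lebesgue_measure R]_(tau in `[0, t])
              heat (t - tau) (F tau) x].

Definition mild_solution (a gamma beta : R) (alpha : R) (p q : \bar R)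
    (u0 : 'rV[R]_n -> R) (I : set R) u : Prop :=
  herz_continuous alpha p q I u /\
  forall t, I t ->
    {ae lebesgue_rV n, forall x, mild_at a gamma beta u0 u t x}.

End hardy_henon.

(* Main.v *)
(* Put p = q/(beta+1), al = (n-gamma)/(beta+1) - n/q and al' = n(1-1/p), so that
   al' = (beta+1)al + gamma. Hoelder's inequality on each annulus, together with
   l^1 in l^oo, makes u |-> |x|^-gamma |u|^beta u locally Lipschitz from
   K_q^(al,1) to K_p^(al',1); since al' + n/p = n, the latter is contained in
   L^1. Because 0 < al + n/q < n, splitting the data into annuli gives, from
   heat kernel bounds with geometric decay in the distance |k - j| of the
   annuli, that e^(tD) is bounded on K_q^(al,1) uniformly in t and maps
   K_p^(al',1) to K_q^(al,1) with norm at most C t^(-th),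
   th = (n - (n-gamma)/(beta+1))/2, and the assumption on gamma says exactly
   that th < 1. By Minkowski's inequality the Duhamel term is then Lipschitz
   with a constant that is small for short times, so Picard iteration converges
   on a time interval whose length depends only on the norm of the data. Strong
   continuity of the semigroup follows from the uniform bound and the density of
   simple functions supported away from 0 and infinity. Restarting the equation
   at a positive time propagates uniqueness, glues solutions, and shows that the
   norm tends to infinity at a finite maximal time. *)
Require Import Defs.
From HB Require Import structures.
From mathcomp Require Import all_boot all_order all_algebra.
From mathcomp Require Import all_classical all_reals all_analysis.
From mathcomp Require Import measurable_realfun ring lra zify.

Set Implicit Arguments.
Unset Strict Implicit.
Unset Printing Implicit Defensive.

Import Order.TTheory GRing.Theory Num.Theory.
Import numFieldNormedType.Exports.

Local Open Scope classical_set_scope.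
Local Open Scope ring_scope.

(** * The heat kernel *)

(** The value al' + n/p = n is an endpoint: at that homogeneity the annulus estimate behind the
    boundedness on K_q^(al,1) has no decay left in |k - j|. The smoothing estimate therefore
    measures decay from the output annulus to the scale sqrt(t), where the kernel bound changes from
    t^(-n/2) to |x|^(-n), and uses that the source is in L^1. For neighbouring annuli beyond that
    scale it interpolates between sup and L^p bounds, and gamma > 0 supplies the missing power of t.
    Since the nonlinearity is controlled from the solution space itself, the fixed point argument
    runs in that space alone, which gives uniqueness among all continuous solutions. Elements are
    functions, and a solution picks one representative per time, with no joint measurability. This
    is harmless: the heat kernel at positive times does not see null sets, and continuity in time
    restores the joint measurability of the Duhamel integrand. Estimates are made for nonnegative
    extended-valued functions, where Tonelli's theorem applies freely; convergence of integrals is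
    then read off from almost everywhere finiteness. *)

Section lebesgue_rV_invariance.
Context {R : realType}.
Local Open Scope ereal_scope.
Notation leb := (@lebesgue_measure R).

(** The reflected measure agrees with Lebesgue measure on each interval ]a, b], whose preimage [c -
    b, c - a[ has the same length. Reflections come before translations because convolution kernels
    involve x - y, and two reflections compose to a translation. *)
Lemma ge0_integral_lebesgue_reflect (c : R) (f : R -> \bar R) :
  measurable_fun [set: R] f -> (forall x, 0 <= f x) ->
  \int[leb]_x f (c - x)%R = \int[leb]_x f x.
Proof.
move=> mf f0.
pose phi : measurableTypeR R -> measurableTypeR R := (fun x : R => c - x)%R.
have mphi : measurable_fun setT phi by apply: measurable_funB.
transitivity (\int[pushforward leb phi]_x f x); last first.
  apply: eq_measure_integral => A mA _; apply/esym.
  apply: lebesgue_measure_unique => // X [[a b] _ <-].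
  rewrite /= /pushforward.
  rewrite (_ : _ @^-1` _ = [set` `[(c - b)%R, (c - a)%R[]); last first.
    rewrite /phi; apply/seteqP; split=> x /=; rewrite !in_itv/= => /andP[h1 h2];
    apply/andP; split; lra.
  rewrite !lebesgue_measure_itv/= !lte_fin.
  have -> : (c - b < c - a = (a < b))%R by rewrite ltrD2l ltrN2.
  by case: ifP => // _; rewrite -!EFinB; congr EFin; lra.
by rewrite ge0_integral_pushforward.
Qed.

Lemma ge0_integral_rVS n (f : 'rV[R]_n.+1 -> \bar R) :
  measurable_fun [set: 'rV[R]_n.+1] f -> (forall x, 0 <= f x) ->
  \int[lebesgue_rV n.+1]_x f x =
  \int[leb]_r \int[lebesgue_rV n]_x f (rV_cons (r, x)).
Proof.
move=> mf f0.
pose phi : (measurableTypeR R * 'rV[R]_n)%type -> 'rV[R]_n.+1 := @rV_cons R n.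
have mc : measurable_fun setT phi by exact: measurable_rV_cons.
transitivity (\int[leb \x lebesgue_rV n]_z (f \o phi) z).
  by rewrite -(ge0_integral_pushforward mc (leb \x lebesgue_rV n) (D := setT)).
have mfc := measurableT_comp mf mc.
by rewrite fubini_tonelli1 => // z; exact: f0.
Qed.

Lemma rV_sub_cons n (c : 'rV[R]_n.+1) (r : R) (x : 'rV[R]_n) :
  (c - rV_cons (r, x) =
   rV_cons ((rV_uncons c).1 - r, (rV_uncons c).2 - x))%R.
Proof.
apply/rowP => i; rewrite [LHS]mxE [X in (_ + X)%R]mxE.
rewrite -[in LHS](rV_unconsK c).
case: (unliftP ord0 i) => [j|] ->; last by rewrite !rV_consE0.
by rewrite !rV_consES !mxE.
Qed.

Lemma measurable_rV_sub d (T : measurableType d) n (f g : T -> 'rV[R]_n) :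
  measurable_fun setT f -> measurable_fun setT g ->
  measurable_fun setT (fun x => f x - g x)%R.
Proof.
move=> mf mg; apply: measurable_fun_rV => i.
rewrite (_ : (fun x => _) = (fun x => f x ord0 i - g x ord0 i)%R); last first.
  by apply/funext => x; rewrite !mxE.
apply: measurable_funB.
- exact: measurableT_comp (measurable_rV_coord i) mf.
- exact: measurableT_comp (measurable_rV_coord i) mg.
Qed.

(** Induction on the dimension: Tonelli's theorem splits off the first coordinate, which is
    reflected on the line, while the remaining ones are reflected inside the inner integral. *)
Lemma ge0_integral_rV_reflect n (c : 'rV[R]_n) (f : 'rV[R]_n -> \bar R) :
  measurable_fun [set: 'rV[R]_n] f -> (forall x, 0 <= f x) ->
  \int[lebesgue_rV n]_x f (c - x)%R = \int[lebesgue_rV n]_x f x.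
Proof.
elim: n c f => [|n IH] c f mf f0.
  by apply: eq_integral => x _; congr f; apply/rowP => -[].
have mcr (r : R) : measurable_fun setT (fun x : 'rV[R]_n => rV_cons (r, x)).
  exact: measurableT_comp (measurable_rV_cons (R := R) (n := n)) _.
have mfc : measurable_fun setT (fun x : 'rV[R]_n.+1 => f (c - x)%R).
  by apply: measurableT_comp => //; exact: measurable_rV_sub.
transitivity (\int[leb]_r \int[lebesgue_rV n]_x f (c - rV_cons (r, x))%R).
  by apply: (ge0_integral_rVS mfc) => x; exact: f0.
transitivity (\int[leb]_r \int[lebesgue_rV n]_x f (rV_cons (r, x))); last first.
  by apply/esym; exact: ge0_integral_rVS.
under eq_integral => r _.
  under eq_integral do rewrite rV_sub_cons.
  rewrite (IH _ (fun x => f (rV_cons ((rV_uncons c).1 - r, x)%R)))//; last first.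
    exact: measurableT_comp mf (mcr _).
  over.
rewrite (@ge0_integral_lebesgue_reflect _
  (fun r => \int[lebesgue_rV n]_x f (rV_cons (r, x))))//.
  pose g (z : measurableTypeR R * 'rV[R]_n) := f (rV_cons z).
  apply: (@measurable_fun_fubini_tonelli_F _ _ _ _ _ (lebesgue_rV n) g) => //.
    exact: measurableT_comp mf (measurable_rV_cons (R := R) (n := n)).
  by move=> z; exact: f0.
by move=> r; exact: integral_ge0.
Qed.

Lemma ge0_integral_rV_shift n (c : 'rV[R]_n) (f : 'rV[R]_n -> \bar R) :
  measurable_fun [set: 'rV[R]_n] f -> (forall x, 0 <= f x) ->
  \int[lebesgue_rV n]_x f (x - c)%R = \int[lebesgue_rV n]_x f x.
Proof.
move=> mf f0; rewrite -(ge0_integral_rV_reflect 0 (f := fun x => f (x - c)%R))//.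
  rewrite -[RHS](ge0_integral_rV_reflect (- c))//.
  by apply: eq_integral => x _; rewrite sub0r addrC.
by apply: measurableT_comp => //; exact: measurable_rV_sub.
Qed.

End lebesgue_rV_invariance.

Section euclidean_norm.
Context {R : realType} {n : nat}.
Implicit Types x y : 'rV[R]_n.

Lemma eucl_norm_ge0 x : 0 <= eucl_norm x.
Proof. exact: sqrtr_ge0. Qed.

Lemma sqr_eucl_norm x : eucl_norm x ^+ 2 = \sum_(i < n) x ord0 i ^+ 2.
Proof. by rewrite sqr_sqrtr// sumr_ge0// => i _; exact: sqr_ge0. Qed.

Lemma eucl_normN x : eucl_norm (- x) = eucl_norm x.
Proof. by congr Num.sqrt; apply: eq_bigr => i _; rewrite mxE sqrrN. Qed.

Lemma eucl_norm_coord x i : `|x ord0 i| <= eucl_norm x.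
Proof.
rewrite -(@ler_pXn2r _ 2)// ?nnegrE ?eucl_norm_ge0//.
rewrite sqr_eucl_norm (bigD1 i)//= real_normK ?num_real// lerDl.
by apply: sumr_ge0 => j _; exact: sqr_ge0.
Qed.

(** With a = |x| and b = |y|, expand the sum of the squares (b x_i - a y_i)^2 and divide by 2ab; the
    degenerate cases a = 0 and b = 0 are treated apart. *)
Lemma cauchy_schwarz_rV x y :
  \sum_(i < n) x ord0 i * y ord0 i <= eucl_norm x * eucl_norm y.
Proof.
have x0 := eucl_norm_ge0 x; have y0 := eucl_norm_ge0 y.
have [xE|xN0] := eqVneq (eucl_norm x) 0.
  rewrite xE mul0r big1// => i _.
  have := eucl_norm_coord x i; rewrite xE normr_le0 => /eqP ->.
  by rewrite mul0r.
have [yE|yN0] := eqVneq (eucl_norm y) 0.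
  rewrite yE mulr0 big1// => i _.
  have := eucl_norm_coord y i; rewrite yE normr_le0 => /eqP ->.
  by rewrite mulr0.
have xgt0 : 0 < eucl_norm x by rewrite lt_def xN0.
have ygt0 : 0 < eucl_norm y by rewrite lt_def yN0.
set S := \sum_(i < n) _; set a := eucl_norm x; set b := eucl_norm y.
have : 0 <= \sum_(i < n) (b * x ord0 i - a * y ord0 i) ^+ 2.
  by apply: sumr_ge0 => i _; exact: sqr_ge0.
rewrite (_ : \sum_(i < n) _ = b ^+ 2 * a ^+ 2 + a ^+ 2 * b ^+ 2 - 2 * a * b * S).
  move=> h; rewrite -(@ler_pM2l _ (2 * a * b)) ?mulr_gt0//.
  by rewrite -subr_ge0; lra.
rewrite [in LHS]/a [in LHS]/b.
have -> : b ^+ 2 * a ^+ 2 + a ^+ 2 * b ^+ 2 =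
    b ^+ 2 * (\sum_(i < n) x ord0 i ^+ 2) + a ^+ 2 * (\sum_(i < n) y ord0 i ^+ 2).
  by rewrite -!sqr_eucl_norm.
rewrite /S !mulr_sumr -big_split/= -sumrB.
by apply: eq_bigr => i _; rewrite -/a -/b; ring.
Qed.

Lemma ler_eucl_normD x y : eucl_norm (x + y) <= eucl_norm x + eucl_norm y.
Proof.
rewrite -(@ler_pXn2r _ 2)// ?nnegrE ?addr_ge0 ?eucl_norm_ge0//.
rewrite sqrrD !sqr_eucl_norm.
rewrite (_ : \sum_(i < n) (x + y) ord0 i ^+ 2 = \sum_(i < n) x ord0 i ^+ 2 +
    (\sum_(i < n) x ord0 i * y ord0 i) *+ 2 + \sum_(i < n) y ord0 i ^+ 2).
  by rewrite lerD2r lerD2l lerMn2r cauchy_schwarz_rV.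
rewrite -sumrMnl -!big_split/=; apply: eq_bigr => i _.
by rewrite mxE sqrrD.
Qed.

Lemma ler_eucl_normB x y : eucl_norm x - eucl_norm y <= eucl_norm (x - y).
Proof. by rewrite lerBlDr -{1}(subrK y x); exact: ler_eucl_normD. Qed.

Lemma eucl_normBC x y : eucl_norm (x - y) = eucl_norm (y - x).
Proof. by rewrite -eucl_normN opprB. Qed.

Lemma eucl_norm0_eq0 x : eucl_norm x = 0 -> x = 0.
Proof.
move=> xE; apply/rowP => i; apply/eqP; rewrite mxE -normr_le0 -xE.
exact: eucl_norm_coord.
Qed.

Lemma eucl_norm0 : eucl_norm (0 : 'rV[R]_n) = 0.
Proof.
by rewrite /eucl_norm big1 ?sqrtr0// => i _; rewrite mxE expr0n.
Qed.

Lemma measurable_eucl_norm : measurable_fun [set: 'rV[R]_n] (@eucl_norm R n).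
Proof.
apply: (@measurableT_comp _ _ _ _ _ _ (@Num.sqrt R)).
  by apply: continuous_measurable_fun => x; exact: sqrt_continuous.
apply: measurable_sum => i; apply: measurable_funX.
exact: measurable_rV_coord.
Qed.

Lemma eucl_norm_lt_measurable (r : R) :
  measurable [set x : 'rV[R]_n | eucl_norm x < r].
Proof.
rewrite (_ : mkset _ = setT `&` (@eucl_norm R n @^-1` `]-oo, r[)).
  exact: measurable_eucl_norm.
by apply/seteqP; split=> x /=; rewrite in_itv/= => // -[].
Qed.

End euclidean_norm.

(** * Powers of two, dyadic annuli and their volume *)

Section dyadic.
Context {R : realType}.

Lemma pow2_gt0 (a : R) : 0 < 2 `^ a.
Proof. by rewrite powR_gt0. Qed.

Lemma pow2D (a b : R) : 2 `^ (a + b) = 2 `^ a * 2 `^ b.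
Proof. by rewrite powRD// pnatr_eq0 implybT. Qed.

Lemma pow2_le (a b : R) : (2 `^ a <= 2 `^ b) = (a <= b).
Proof.
apply/idP/idP => [|ab]; last by apply: ler_powR => //; rewrite ler1n.
apply: contraTT; rewrite -!ltNge => ba; rewrite /powR pnatr_eq0/=.
by rewrite ltr_expR ltr_pM2r// ln_gt0// ltr1n.
Qed.

Lemma pow2_lt (a b : R) : (2 `^ a < 2 `^ b) = (a < b).
Proof. by rewrite !ltNge pow2_le. Qed.

Lemma pow2_exprz (k : int) : 2 ^ k = 2 `^ k%:~R :> R.
Proof. by rewrite powR_intmul. Qed.

Lemma dyadic_bracket (r : R) : 0 < r ->
  exists k : int, 2 `^ (k%:~R - 1) <= r < 2 `^ k%:~R.
Proof.
move=> r0; pose a := ln r / ln 2.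
have ln2 : 0 < ln 2 :> R by rewrite ln_gt0// ltr1n.
have rE : r = 2 `^ a.
  by rewrite /powR pnatr_eq0/= /a mulfVK ?gt_eqF// lnK// posrE.
exists (Num.floor a + 1); rewrite rE pow2_le pow2_lt intrD addrK.
by have := floor_itv a; rewrite intrD.
Qed.

Context {n : nat}.
Implicit Types (x : 'rV[R]_n) (k : int).

(** Passing from integer to real exponents turns all later comparisons of powers of two into linear
    inequalities between exponents. *)
Lemma dyadic_annulusE k x : dyadic_annulus k x <->
  2 `^ (k%:~R - 1) <= eucl_norm x < 2 `^ k%:~R.
Proof.
rewrite /dyadic_annulus /dyadic_ball /= !pow2_exprz intrB.
split=> [[-> /negP]|/andP[h1 ->]]; first by rewrite -leNgt => ->.
by split => //; apply/negP; rewrite -leNgt.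
Qed.

Lemma measurable_dyadic_annulus k : measurable (@dyadic_annulus R n k).
Proof. by apply: measurableD; exact: eucl_norm_lt_measurable. Qed.

Lemma trivIset_dyadic_annulus : trivIset setT (@dyadic_annulus R n).
Proof.
apply/trivIsetP => i j _ _; wlog ij : i j / (i < j)%R.
  by move=> h; rewrite neq_lt => /orP[] ij; [|rewrite setIC]; apply: h => //;
    rewrite lt_eqF.
move=> _; apply/seteqP; split => // x [/dyadic_annulusE /andP[_ h1]].
move=> /dyadic_annulusE /andP[h2 _]; have := le_lt_trans h2 h1.
rewrite pow2_lt ltrBlDr -[1]/(1%:~R) -intrD ltr_int ltzD1.
by rewrite leNgt ij.
Qed.

Lemma bigcup_dyadic_annulus :
  \bigcup_k (@dyadic_annulus R n k) = [set x | x != 0].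
Proof.
apply/seteqP; split=> [x [k _ /dyadic_annulusE /andP[h _]]|x /= x0] /=.
  apply: contraTneq h => ->; rewrite eucl_norm0 -ltNge; exact: pow2_gt0.
have : 0 < eucl_norm x.
  rewrite lt_def eucl_norm_ge0 andbT; apply: contra x0 => /eqP.
  by move/eucl_norm0_eq0 ->.
by move=> /dyadic_bracket[k hk]; exists k => //; exact/dyadic_annulusE.
Qed.

(** The annulus lies in the cube of half-side 2^k, whose volume comes from the product structure;
    only the order of magnitude matters. *)
Lemma lebesgue_dyadic_annulus_le k :
  (lebesgue_rV n (@dyadic_annulus R n k) <= (2 `^ (n%:R * (k%:~R + 1)))%:E)%E.
Proof.
pose A (i : 'I_n) : set R := `]- (2 `^ k%:~R), (2 `^ k%:~R)[%classic.
have mA i : measurable (A i) by exact: measurable_itv.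
apply: (@le_trans _ _ (lebesgue_rV n [set x | forall i, A i (x ord0 i)])).
  apply: le_measure; rewrite ?inE.
  - exact: measurable_dyadic_annulus.
  - rewrite [X in measurable X](_ : _ = \bigcap_(i in [set: 'I_n])
      ((fun x : 'rV[R]_n => x ord0 i) @^-1` A i)); last first.
      by apply/seteqP; split=> x h i; [move=> _; exact: h|exact: (h i I)].
    apply: fin_bigcap_measurable => // i _.
    by rewrite -[X in measurable X]setTI; exact: measurable_rV_coord.
  - move=> x /dyadic_annulusE /andP[_ xk] i; rewrite /A /= in_itv/= -ltr_norml.
    exact: le_lt_trans (eucl_norm_coord x i) xk.
rewrite lebesgue_rV_box//.
rewrite (eq_bigr (fun=> (2 `^ (k%:~R + 1))%:E)); last first.
  move=> i _; rewrite lebesgue_measure_itv/= lte_fin -EFinB.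
  by rewrite gtrN ?pow2_gt0// pow2D powRr1//; congr EFin; ring.
by rewrite prodEFin lee_fin prodr_const card_ord mulrC powRrM powR_mulrn// powR_ge0.
Qed.

Lemma lebesgue_rV_set1 x : (0 < n)%N -> lebesgue_rV n [set x] = 0%E.
Proof.
move=> n0; rewrite (_ : [set x] = [set y | forall i, [set x ord0 i] (y ord0 i)]) /=.
  rewrite (@lebesgue_rV_box _ _ (fun i => [set x ord0 i]))//.
  by rewrite (bigD1 (Ordinal n0))//= lebesgue_measure_set1 mul0e.
by apply/seteqP; split=> [y /= ->//|y /= h]; apply/rowP.
Qed.

End dyadic.

(** * Gaussian bounds, total mass and semigroup law *)

Section heat_kernel_theory.
Context {R : realType}.
Notation leb := (@lebesgue_measure R).

Section fixed_dimension.
Context {n : nat}.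
Implicit Types (s t : R) (x y z : 'rV[R]_n).

Lemma heat_kernel_ge0 t x : 0 <= heat_kernel t x.
Proof. by rewrite mulr_ge0// ?powR_ge0// expR_ge0. Qed.

Lemma heat_kernel_gt0 t x : 0 < t -> 0 < heat_kernel t x.
Proof.
by move=> t0; rewrite /heat_kernel mulr_gt0 ?expR_gt0// powR_gt0// !mulr_gt0 ?pi_gt0.
Qed.

Lemma heat_kernelN t x : heat_kernel t (- x) = heat_kernel t x.
Proof. by rewrite /heat_kernel eucl_normN. Qed.

Lemma heat_kernelBC t x y : heat_kernel t (x - y) = heat_kernel t (y - x).
Proof. by rewrite -heat_kernelN opprB. Qed.

Lemma measurable_heat_kernel t :
  measurable_fun [set: 'rV[R]_n] (@heat_kernel R n t).
Proof.
apply: measurable_funM => //; apply: measurableT_comp => //.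
apply: measurableT_comp => //; apply: measurable_funM => //.
by apply: measurable_funX; exact: measurable_eucl_norm.
Qed.

Let powR_4pi_le t : 0 < t ->
  (4 * pi * t) `^ (- (n%:R / 2)) <= t `^ (- (n%:R / 2)).
Proof.
move=> t0; rewrite !powRN lef_pV2 ?posrE ?powR_gt0 ?mulr_gt0 ?pi_gt0//.
have pit : t <= 4 * pi * t.
  by rewrite ler_peMl ?ltW//; have := @pi_ge2 R; lra.
apply: ge0_ler_powR => //; rewrite ?nnegrE ?ltW//.
exact: lt_le_trans t0 pit.
Qed.

Lemma heat_kernel_le t x : 0 < t -> heat_kernel t x <= (4 * pi * t) `^ (- (n%:R / 2)).
Proof.
move=> t0; rewrite ler_piMr ?powR_ge0// -expR0 ler_expR oppr_le0.
by rewrite mulr_ge0 ?sqr_ge0// invr_ge0 mulr_ge0// ltW.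
Qed.

Lemma heat_kernel_le_pow t x : 0 < t ->
  heat_kernel t x <= t `^ (- (n%:R / 2)).
Proof.
move=> t0; apply: le_trans (heat_kernel_le _ t0) _.
exact: powR_4pi_le.
Qed.

(** In terms of v = |x| / sqrt(t) this says that v^n exp(-v^2/4) is bounded. With m = n + 1, v <= 4m
    (1 + v^2/(4m)) <= 4m exp(v^2/(4m)), and the n-th power costs at most exp(v^2/4). The bound does
    not depend on t, which makes the estimates between distant annuli uniform in time. *)
Lemma heat_kernel_le_norm t x : 0 < t ->
  eucl_norm x ^+ n * heat_kernel t x <= (4 * n.+1%:R) ^+ n.
Proof.
move=> t0; pose v := eucl_norm x / Num.sqrt t.
have st0 : 0 < Num.sqrt t by rewrite sqrtr_gt0.
have v0 : 0 <= v by rewrite divr_ge0 ?eucl_norm_ge0// ltW.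
have h1 : eucl_norm x ^+ n * t `^ (- (n%:R / 2)) = v ^+ n.
  rewrite powRN mulrC [n%:R / 2]mulrC powRrM powR12_sqrt ?ltW//.
  by rewrite powR_mulrn ?sqrtr_ge0// expr_div_n mulrC.
have h2 : heat_kernel t x <= t `^ (- (n%:R / 2)) * expR (- (v ^+ 2 / 4)).
  rewrite /heat_kernel.
  have -> : eucl_norm x ^+ 2 / (4 * t) = v ^+ 2 / 4.
    have sq : Num.sqrt t ^+ 2 = t by rewrite sqr_sqrtr// ltW.
    by rewrite /v expr_div_n sq; field; rewrite gt_eqF.
  rewrite ler_wpM2r ?expR_ge0//.
  exact: powR_4pi_le.
apply: le_trans (ler_wpM2l _ h2) _; first by rewrite exprn_ge0 ?eucl_norm_ge0.
rewrite mulrA h1 expRN ler_pdivrMr ?expR_gt0//.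
have h3 : v <= 4 * n.+1%:R * (1 + v ^+ 2 / 4 / n.+1%:R).
  rewrite mulrDr mulr1 (_ : 4 * _ * _ = v ^+ 2); last by field.
  have : 1 <= n.+1%:R :> R by rewrite ler1n.
  by nra.
have h4 : 4 * n.+1%:R * (1 + v ^+ 2 / 4 / n.+1%:R) <=
    4 * n.+1%:R * expR (v ^+ 2 / 4 / n.+1%:R).
  by rewrite ler_wpM2l ?mulr_ge0// expR_ge1Dx.
have h5 : v ^+ n <= (4 * n.+1%:R * expR (v ^+ 2 / 4 / n.+1%:R)) ^+ n.
  apply: lerXn2r; rewrite ?nnegrE//; last exact: le_trans h3 h4.
apply: le_trans h5 _; rewrite exprMn ler_wpM2l ?exprn_ge0 ?mulr_ge0//.
rewrite -expRM_natl ler_expR.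
have n0 : 0 < n.+1%:R :> R by rewrite ltr0n.
rewrite mulrA ler_pdivrMr// mulrC ler_wpM2l ?ler_nat//.
by rewrite divr_ge0 ?sqr_ge0.
Qed.

(* Away from the origin the heat kernel is an exponentially small multiple of
   the kernel at twice the time. *)
Lemma heat_kernel_tail t x (r : R) : 0 < t -> 0 <= r -> r <= eucl_norm x ->
  heat_kernel t x <=
  2 `^ (n%:R / 2) * expR (- (r ^+ 2 / (8 * t))) * heat_kernel (2 * t) x.
Proof.
move=> t0 r0 rx; rewrite /heat_kernel.
have -> : (4 * pi * (2 * t)) `^ (- (n%:R / 2)) =
    2 `^ (- (n%:R / 2)) * (4 * pi * t) `^ (- (n%:R / 2)).
  by rewrite -powRM ?mulr_ge0 ?pi_ge0// ?ltW//; congr (_ `^ _); ring.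
set c := (4 * pi * t) `^ _.
have E2 : 2 `^ (n%:R / 2) * 2 `^ (- (n%:R / 2)) = 1 :> R.
  by rewrite -pow2D subrr powRr0.
rewrite (_ : _ * _ * (_ * _ * _) = 2 `^ (n%:R / 2) * 2 `^ (- (n%:R / 2)) * (c *
  (expR (- (r ^+ 2 / (8 * t))) * expR (- (eucl_norm x ^+ 2 / (4 * (2 * t)))))));
  last by ring.
rewrite E2 mul1r ler_wpM2l ?powR_ge0//.
rewrite -expRD ler_expR (_ : 4 * (2 * t) = 8 * t); last by ring.
rewrite -opprD lerN2 -mulrDl.
rewrite ler_pdivrMr ?mulr_gt0//.
rewrite (_ : _ / (4 * t) * (8 * t) = eucl_norm x ^+ 2 * 2); last by field; rewrite gt_eqF.
by rewrite mulr2n mulrDr mulr1 lerD2r lerXn2r ?nnegrE ?eucl_norm_ge0.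
Qed.

End fixed_dimension.

Lemma heat_kernel_cons n (t r : R) (x : 'rV[R]_n) : 0 < t ->
  heat_kernel t (rV_cons (r, x)) =
  normal_pdf 0 (Num.sqrt (2 * t)) r * heat_kernel t x.
Proof.
move=> t0; have s0 : Num.sqrt (2 * t) != 0 by rewrite gt_eqF// sqrtr_gt0 mulr_gt0.
rewrite normal_pdfE// /normal_peak /normal_fun /heat_kernel subr0.
rewrite (@sqr_eucl_norm _ _ (rV_cons (r, x))) sqr_sqrtr; last first.
  by rewrite mulr_ge0// ltW.
rewrite big_ord_recl rV_consE0 /=.
under eq_bigr do rewrite rV_consES.
rewrite -(@sqr_eucl_norm _ _ x) mulrACA -expRD; congr (_ * expR _).
  rewrite [n.+1%:R](_ : _ = 1 + n%:R); last by rewrite -natr1 addrC.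
  have -> : - ((1 + n%:R) / 2) = - (2^-1) + - (n%:R / 2) :> R by field.
  rewrite powRD; last first.
    have -> : 4 * pi * t != 0 by rewrite gt_eqF// !mulr_gt0 ?pi_gt0.
    by rewrite implybT.
  congr (_ * _).
  rewrite powRN powR12_sqrt ?mulr_ge0 ?pi_ge0 ?ltW//.
  by congr ((Num.sqrt _)^-1); rewrite -mulr_natr; ring.
by rewrite -mulr_natr; field; rewrite gt_eqF.
Qed.

(** Induction on the dimension: each new coordinate contributes a centred normal density of variance
    2t. In dimension 0 the measure is a Dirac mass and the kernel equals 1. *)
Lemma integral_heat_kernel n (t : R) : 0 < t ->
  (\int[lebesgue_rV n]_x (heat_kernel t x)%:E = 1)%E.
Proof.
move=> t0; elim: n => [|n IH].
  rewrite integral_dirac//=; last exact: measurableT_comp (measurable_heat_kernel _).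
  rewrite diracT mul1e /heat_kernel mul0r oppr0 powRr0 mul1r.
  by rewrite eucl_norm0 expr0n mul0r oppr0 expR0.
have s0 : Num.sqrt (2 * t) != 0 by rewrite gt_eqF// sqrtr_gt0 mulr_gt0.
transitivity (\int[leb]_r \int[lebesgue_rV n]_x
    (heat_kernel t (rV_cons (r, x)))%:E)%E.
  apply: (@ge0_integral_rVS _ _ (fun x => (heat_kernel t x)%:E)).
    exact: measurableT_comp (measurable_heat_kernel _).
  by move=> x; rewrite lee_fin heat_kernel_ge0.
rewrite -(integral_normal_pdf 0 (Num.sqrt (2 * t))).
apply: eq_integral => r _.
under eq_integral do rewrite heat_kernel_cons// EFinM.
rewrite ge0_integralZl//; last 3 first.
- exact: measurableT_comp (measurable_heat_kernel _).
- by move=> x _; rewrite lee_fin heat_kernel_ge0.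
- by rewrite lee_fin normal_pdf_ge0.
by rewrite IH mule1.
Qed.

Context {n : nat}.
Implicit Types (s t : R) (x y z : 'rV[R]_n).

Lemma integral_heat_kernel_sub t x : 0 < t ->
  (\int[lebesgue_rV n]_y (heat_kernel t (x - y))%:E = 1)%E.
Proof.
move=> t0; rewrite -(integral_heat_kernel n t0).
apply: (@ge0_integral_rV_reflect _ _ x (fun y => (heat_kernel t y)%:E)).
  exact: measurableT_comp (measurable_heat_kernel _).
by move=> y; rewrite lee_fin heat_kernel_ge0.
Qed.

Lemma heat_kernel_completing_square s t x y : 0 < s -> 0 < t ->
  heat_kernel s (x - y) * heat_kernel t y =
  heat_kernel (s + t) x *
  heat_kernel (s * t / (s + t)) (y - (t / (s + t)) *: x).
Proof.
move=> s0 t0; have st0 : 0 < s + t by exact: addr_gt0.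
rewrite /heat_kernel mulrACA [RHS]mulrACA -!expRD; congr (_ * expR _).
  have p0 := @pi_gt0 R.
  rewrite -!powRM ?mulr_ge0 ?ltW ?divr_gt0 ?mulr_gt0 ?invr_gt0//.
  by congr (_ `^ _); field; rewrite gt_eqF.
rewrite !sqr_eucl_norm -!mulNr -!sumrN.
rewrite !mulr_suml -!big_split/=; apply: eq_bigr => i _.
rewrite !mxE; field.
by rewrite !gt_eqF.
Qed.

(** After a translation by z, completing the square factors the product into the kernel at time s +
    t, free of y, and a translated kernel of total mass 1. *)
Lemma heat_kernel_semigroup s t x z : 0 < s -> 0 < t ->
  (\int[lebesgue_rV n]_y (heat_kernel s (x - y) * heat_kernel t (y - z))%:E =
   (heat_kernel (s + t) (x - z))%:E)%E.
Proof.
move=> s0 t0; have st0 : 0 < s + t by exact: addr_gt0.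
have mk u w : measurable_fun setT (fun y : 'rV[R]_n => heat_kernel u (y - w)).
  by apply: measurableT_comp (measurable_heat_kernel _) _; exact: measurable_rV_sub.
transitivity (\int[lebesgue_rV n]_y
    ((heat_kernel s ((x - z) - y) * heat_kernel t y)%:E))%E.
  rewrite -[RHS](@ge0_integral_rV_shift _ _ z); last 2 first.
  - apply/measurable_EFinP; apply: measurable_funM; last exact: measurable_heat_kernel.
    apply: measurableT_comp (measurable_heat_kernel _) _.
    exact: measurable_rV_sub.
  - by move=> y; rewrite lee_fin mulr_ge0 ?heat_kernel_ge0.
  by apply: eq_integral => y _; rewrite opprB addrA subrK.
under eq_integral do rewrite heat_kernel_completing_square// EFinM.
rewrite ge0_integralZl//; last 3 first.
- by apply/measurable_EFinP; exact: mk.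
- by move=> y _; rewrite lee_fin heat_kernel_ge0.
- by rewrite lee_fin heat_kernel_ge0.
rewrite (@ge0_integral_rV_shift _ _ _ (fun y => (heat_kernel _ y)%:E)); last 2 first.
- exact: measurableT_comp (measurable_heat_kernel _).
- by move=> y; rewrite lee_fin heat_kernel_ge0.
by rewrite integral_heat_kernel ?mule1// divr_gt0// mulr_gt0.
Qed.

End heat_kernel_theory.

(** * Minkowski's integral inequality *)

Section extended_lemmas.
Context {R : realType}.
Local Open Scope ereal_scope.

Lemma lee_poweR (r : R) (x y : \bar R) : (0 <= r)%R -> 0 <= x -> x <= y ->
  x `^ r <= y `^ r.
Proof.
move=> r0 x0 xy; apply: gt0_ler_poweR => //; rewrite in_itv/= leey andbT//.
exact: le_trans xy.
Qed.

Lemma poweRK (r : R) (x : \bar R) : (r != 0)%R -> 0 <= x -> (x `^ r) `^ r^-1 = x.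
Proof. by move=> r0 x0; rewrite -poweRrM mulfV// poweRe1. Qed.

Lemma poweRVK (r : R) (x : \bar R) : (r != 0)%R -> 0 <= x -> (x `^ r^-1) `^ r = x.
Proof. by move=> r0 x0; rewrite -poweRrM mulVf// poweRe1. Qed.

End extended_lemmas.

Section Lp_seminorm.
Context d (T : measurableType d) (R : realType).
Variable mu : {measure set T -> \bar R}.
Local Open Scope ereal_scope.
Implicit Types (p q : R) (f g phi : T -> \bar R).

Definition eLp p g : \bar R := (\int[mu]_x (g x `^ p)) `^ p^-1.

Lemma measurable_fun_poweR p g : measurable_fun setT g ->
  measurable_fun setT (fun x => g x `^ p).
Proof. by move=> mg; exact: (measurableT_comp (measurable_poweR p) mg). Qed.

Lemma eLp_ge0 p g : 0 <= eLp p g.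
Proof. exact: poweR_ge0. Qed.

Lemma poweR_eLp p g : (p != 0)%R -> eLp p g `^ p = \int[mu]_x (g x `^ p).
Proof.
by move=> p0; rewrite /eLp poweRVK// integral_ge0// => x _; exact: poweR_ge0.
Qed.

Lemma eLp1 g : (forall x, 0 <= g x) -> eLp 1 g = \int[mu]_x g x.
Proof.
move=> g0; rewrite /eLp invr1 poweRe1; last first.
  by apply: integral_ge0 => x _; exact: poweR_ge0.
by apply: eq_integral => x _; rewrite poweRe1.
Qed.

Lemma LnormE p g : 'N[mu]_p%:E[g] = eLp p (abse \o g).
Proof. by rewrite unlock. Qed.

Lemma eLpE p g : (forall x, 0 <= g x) -> eLp p g = 'N[mu]_p%:E[g].
Proof.
move=> g0; rewrite LnormE; congr eLp.
by apply/funext => x /=; rewrite gee0_abs.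
Qed.

Lemma eLp_le p f g : (0 < p)%R -> measurable_fun setT f -> measurable_fun setT g ->
  (forall x, 0 <= f x) -> (\forall x \ae mu, f x <= g x) ->
  (forall x, 0 <= g x) -> eLp p f <= eLp p g.
Proof.
move=> p0 mf mg f0 fg g0; apply: lee_poweR; first by rewrite invr_ge0 ltW.
  by apply: integral_ge0 => x _; exact: poweR_ge0.
apply: ae_ge0_le_integral => //.
- by move=> x _; exact: poweR_ge0.
- exact: measurable_fun_poweR.
- by move=> x _; exact: poweR_ge0.
- exact: measurable_fun_poweR.
by apply: filterS fg => x fg _; apply: lee_poweR => //; exact: ltW.
Qed.

Lemma eLp_ae_eq p f g : (0 < p)%R -> measurable_fun setT f -> measurable_fun setT g ->
  (forall x, 0 <= f x) -> (forall x, 0 <= g x) ->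
  (\forall x \ae mu, f x = g x) -> eLp p f = eLp p g.
Proof.
move=> p0 mf mg f0 g0 fg; apply/eqP; rewrite eq_le.
by apply/andP; split; apply: eLp_le => //; apply: filterS fg => x ->.
Qed.

Lemma eLp_eq0 p g : (0 < p)%R -> measurable_fun setT g -> (forall x, 0 <= g x) ->
  eLp p g = 0 -> \forall x \ae mu, g x = 0.
Proof.
move=> p0 mg g0; rewrite eLpE// => h.
have := Lnorm_eq0_eq0 mg (p := p%:E) _ h; rewrite lte_fin => /(_ p0).
by apply: filterS => x /(_ I).
Qed.

Lemma eLp_lty_ae p g : (0 < p)%R -> measurable_fun setT g ->
  (forall x, 0 <= g x) -> eLp p g < +oo -> \forall x \ae mu, g x < +oo.
Proof.
move=> p0 mg g0; rewrite /eLp => h.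
have ig : mu.-integrable setT (fun x => g x `^ p).
  apply/integrableP; split; first exact: measurable_fun_poweR.
  rewrite (eq_integral (fun x => g x `^ p)).
    by apply: lty_poweRy h; rewrite invr_eq0 gt_eqF.
  by move=> x _; rewrite gee0_abs// poweR_ge0.
have := integrable_ae measurableT ig.
apply: filterS => x /(_ I); have := g0 x; case: (g x) => //= [r _ _|_].
  exact: ltry.
by rewrite gt_eqF.
Qed.

Lemma eLpZ p (k : \bar R) g : (0 < p)%R -> measurable_fun setT g ->
  (forall x, 0 <= g x) -> 0 <= k -> eLp p (fun x => k * g x) = k * eLp p g.
Proof.
move=> p0 mg g0 k0; rewrite /eLp.
under eq_integral do rewrite poweRM//.
rewrite ge0_integralZl//; last 3 first.
- exact: measurable_fun_poweR.
- by move=> x _; exact: poweR_ge0.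
- exact: poweR_ge0.
rewrite poweRM ?poweR_ge0//; last first.
  by apply: integral_ge0 => x _; exact: poweR_ge0.
by rewrite poweRK// gt_eqF.
Qed.

Let fine_ae p g : (0 < p)%R -> measurable_fun setT g ->
  (forall x, 0 <= g x) -> eLp p g < +oo -> \forall x \ae mu, g x = (fine (g x))%:E.
Proof.
move=> p0 mg g0 h; have := eLp_lty_ae p0 mg g0 h.
by apply: filterS => x gx; rewrite fineK// ge0_fin_numE.
Qed.

Let mfine g : measurable_fun setT g -> measurable_fun setT (fine \o g).
Proof. by move=> mg; apply: measurableT_comp => //; exact: fine_measurable. Qed.

Let eLp_fine p g : (0 < p)%R -> measurable_fun setT g ->
  (forall x, 0 <= g x) -> eLp p g < +oo ->
  eLp p (abse \o (EFin \o (fine \o g))) = eLp p g.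
Proof.
move=> p0 mg g0 h; apply: eLp_ae_eq => //.
- apply: measurableT_comp => //; apply: measurableT_comp => //; exact: mfine.
- by move=> x; exact: abse_ge0.
- by apply: filterS (fine_ae p0 mg g0 h) => x gx; rewrite -[LHS]/(`|(fine (g x))%:E|) -gx gee0_abs.
Qed.

(** Reduction to the inequality for real functions. A vanishing norm makes the integrand vanish
    almost everywhere, and an infinite norm against a positive one leaves nothing to prove;
    otherwise both functions are finite almost everywhere and may be replaced by their real
    parts. *)
Lemma ge0_hoelder p q f g : (0 < p)%R -> (0 < q)%R -> (p^-1 + q^-1 = 1)%R ->
  measurable_fun setT f -> measurable_fun setT g ->
  (forall x, 0 <= f x) -> (forall x, 0 <= g x) ->
  \int[mu]_x (f x * g x) <= eLp p f * eLp q g.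
Proof.
move=> p0 q0 pq mf mg f0 g0.
have mfg : measurable_fun setT (fun x => f x * g x) by exact: emeasurable_funM.
have fg0 x : 0 <= f x * g x by exact: mule_ge0.
have zero (h : T -> \bar R) : measurable_fun setT h ->
    (\forall x \ae mu, h x = 0) -> \int[mu]_x h x = 0.
  move=> mh h0; rewrite (ae_eq_integral (cst 0)) ?integral0//.
  by apply: filterS h0 => x ->.
have [fE|fN] := eqVneq (eLp p f) 0.
  rewrite zero ?mule_ge0 ?eLp_ge0//.
  by apply: filterS (eLp_eq0 p0 mf f0 fE) => x ->; rewrite mul0e.
have [gE|gN] := eqVneq (eLp q g) 0.
  rewrite zero ?mule_ge0 ?eLp_ge0//.
  by apply: filterS (eLp_eq0 q0 mg g0 gE) => x ->; rewrite mule0.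
have fgt0 : 0 < eLp p f by rewrite lt_def fN eLp_ge0.
have ggt0 : 0 < eLp q g by rewrite lt_def gN eLp_ge0.
have [fy|fy] := eqVneq (eLp p f) +oo; first by rewrite fy gt0_mulye ?leey.
have [gy|gy] := eqVneq (eLp q g) +oo; first by rewrite gy gt0_muley ?leey.
have fE : \forall x \ae mu, f x = (fine (f x))%:E.
  by apply: fine_ae p0 _ _ _ => //; rewrite ltey.
have gE : \forall x \ae mu, g x = (fine (g x))%:E.
  by apply: fine_ae q0 _ _ _ => //; rewrite ltey.
have := hoelder mu (mfine mf) (mfine mg) p0 q0 pq.
rewrite !LnormE (@eLp1 (abse \o _)) => [|x]; last exact: abse_ge0.
rewrite eLp_fine ?ltey// eLp_fine ?ltey//.
apply: le_trans; apply: ae_ge0_le_integral => //.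
- by move=> x _; exact: abse_ge0.
- apply: measurableT_comp => //; apply/measurable_EFinP.
  by apply: measurable_funM; exact: mfine.
apply: filterS2 fE gE => x fx gx _ /=.
by rewrite fx gx -EFinM /= lee_fin ler_norm.
Qed.

Lemma eLpD p f g : (1 <= p)%R -> measurable_fun setT f -> measurable_fun setT g ->
  (forall x, 0 <= f x) -> (forall x, 0 <= g x) ->
  eLp p (fun x => f x + g x) <= eLp p f + eLp p g.
Proof.
move=> p1 mf mg f0 g0; have p0 : (0 < p)%R by exact: lt_le_trans p1.
have [fy|fy] := eqVneq (eLp p f) +oo.
  by rewrite fy addye ?leey// gt_eqF// (lt_le_trans _ (eLp_ge0 _ _)).
have [gy|gy] := eqVneq (eLp p g) +oo.
  by rewrite gy addey ?leey// gt_eqF// (lt_le_trans _ (eLp_ge0 _ _)).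
have fE : \forall x \ae mu, f x = (fine (f x))%:E.
  by apply: fine_ae p0 _ _ _ => //; rewrite ltey.
have gE : \forall x \ae mu, g x = (fine (g x))%:E.
  by apply: fine_ae p0 _ _ _ => //; rewrite ltey.
have := minkowski_EFin mu (mfine mf) (mfine mg) p1.
rewrite !LnormE eLp_fine ?ltey// eLp_fine ?ltey//.
rewrite -(@eLp_ae_eq p (fun x => f x + g x))//.
- exact: emeasurable_funD.
- apply: measurableT_comp => //; apply/measurable_EFinP.
  by apply: measurable_funD; exact: mfine.
- by move=> x; exact: adde_ge0.
- by move=> x; exact: abse_ge0.
apply: filterS2 fE gE => x fx gx.
by rewrite -[RHS]/(`|(fine (f x))%:E + (fine (g x))%:E|) -fx -gx gee0_abs// adde_ge0.
Qed.

(** Hoelder's inequality for the splitting of f phi into f phi^(1/p) and phi^(1/q), with q conjugate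
    to p. The total mass of [phi] is arbitrary, hence the power p - 1 of it on the right. *)
Lemma ge0_jensen p f phi : (1 <= p)%R ->
  measurable_fun setT f -> measurable_fun setT phi ->
  (forall x, 0 <= f x) -> (forall x, 0 <= phi x) ->
  (\int[mu]_x (f x * phi x)) `^ p <=
  (\int[mu]_x phi x) `^ (p - 1) * \int[mu]_x (f x `^ p * phi x).
Proof.
move=> p1 mf mphi f0 phi0; have p0 : (0 < p)%R by exact: lt_le_trans p1.
move: p1; rewrite le_eqVlt => /predU1P[<-|p1].
  rewrite subrr poweRe0 mul1e poweRe1; last by apply: integral_ge0 => x _; exact: mule_ge0.
  by under [leRHS]eq_integral do rewrite poweRe1//.
pose q := (p / (p - 1))%R.
have pB0 : (0 < p - 1)%R by rewrite subr_gt0.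
have q0 : (0 < q)%R by rewrite divr_gt0.
have pq : (p^-1 + q^-1 = 1)%R by rewrite /q; field; rewrite !gt_eqF.
have split_phi x : f x * phi x = (f x * phi x `^ p^-1) * phi x `^ q^-1.
  rewrite -muleA -poweRD; first by rewrite pq poweRe1.
  by rewrite /poweRD_def pq oner_eq0.
under eq_integral do rewrite split_phi.
have mu0 g : 0 <= \int[mu]_x (g x `^ p) by apply: integral_ge0 => x _; exact: poweR_ge0.
apply: (@le_trans _ _ ((eLp p (fun x => f x * phi x `^ p^-1) *
    eLp q (fun x => phi x `^ q^-1)) `^ p)).
  apply: lee_poweR; first exact: ltW.
    by apply: integral_ge0 => x _; rewrite !mule_ge0// poweR_ge0.
  apply: ge0_hoelder => // [||x|x]; rewrite ?mule_ge0 ?poweR_ge0//.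
  - by apply: emeasurable_funM => //; exact: measurable_fun_poweR.
  - exact: measurable_fun_poweR.
rewrite poweRM ?eLp_ge0// poweR_eLp ?gt_eqF// /eLp -poweRrM muleC.
rewrite (_ : (q^-1 * p = p - 1)%R); last by rewrite /q; field; rewrite !gt_eqF.
apply: lee_pmul; rewrite ?poweR_ge0//.
- under eq_integral do rewrite poweRVK ?gt_eqF//.
  exact: lexx.
- under eq_integral do rewrite poweRM ?poweR_ge0// poweRVK ?gt_eqF//.
  exact: lexx.
Qed.

End Lp_seminorm.

Section minkowski_integral.
Context d1 d2 (T1 : measurableType d1) (T2 : measurableType d2) (R : realType).
Variables (m1 : {sigma_finite_measure set T1 -> \bar R}).
Variables (m2 : {sigma_finite_measure set T2 -> \bar R}).
Local Open Scope ereal_scope.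

Lemma measurable_fun_eLp p (F : T1 * T2 -> \bar R) :
  measurable_fun setT F -> (forall z, 0 <= F z) ->
  measurable_fun setT (fun t => eLp m1 p (fun x => F (x, t))).
Proof.
move=> mF F0; apply: measurable_fun_poweR.
apply: (measurable_fun_fubini_tonelli_G (m1 := m1) (fun z => F z `^ p)).
  exact: measurable_fun_poweR.
by move=> z; exact: poweR_ge0.
Qed.

(* For psi > 0, Jensen's inequality for the weight psi bounds
   (int F dt)^p by (int psi)^(p-1) int F^p psi^(1-p) dt; the choice
   psi(t) = |F(., t)|_p + e w(t) turns the right-hand side, integrated in x,
   into at most (int psi)^p. *)
Lemma minkowski_integral p (w : T2 -> R) (F : T1 * T2 -> \bar R) :
  (1 <= p)%R -> measurable_fun setT w -> (forall t, 0 < w t)%R ->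
  \int[m2]_t (w t)%:E <= 1 ->
  measurable_fun setT F -> (forall z, 0 <= F z) ->
  eLp m1 p (fun x => \int[m2]_t F (x, t)) <=
  \int[m2]_t eLp m1 p (fun x => F (x, t)).
Proof.
move=> p1 mw w0 w1 mF F0; have p0 : (0 < p)%R by exact: lt_le_trans p1.
set phi := fun t => eLp m1 p (fun x => F (x, t)).
have mphi : measurable_fun setT phi by exact: measurable_fun_eLp.
have phi0 t : 0 <= phi t by exact: eLp_ge0.
have iphi0 : 0 <= \int[m2]_t phi t by exact: integral_ge0.
have [phiy|phiy] := eqVneq (\int[m2]_t phi t) +oo; first by rewrite phiy leey.
have phiae : \forall t \ae m2, phi t < +oo.
  by apply: (@eLp_lty_ae _ _ _ m2 1) => //; rewrite eLp1// ltey.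
apply/lee_addgt0Pr => e e0.
(* The term [e * w t] keeps [psi] positive, so that one may divide by it, and adds at most [e] to
   the integral of [phi]. *)
pose psi t : R := (fine (phi t) + e * w t)%R.
have psi0 t : (0 < psi t)%R by rewrite ltr_wpDl ?mulr_gt0// fine_ge0.
have mpsi : measurable_fun setT psi.
  apply: measurable_funD; last exact: measurable_funM.
  by apply: measurableT_comp => //; exact: fine_measurable.
pose I := \int[m2]_t (psi t)%:E.
have I0 : 0 <= I by apply: integral_ge0 => t _; rewrite lee_fin ltW.
have ifine : \int[m2]_t (fine (phi t))%:E = \int[m2]_t phi t.
  apply: ae_eq_integral => //.
    by apply/measurable_EFinP; apply: measurableT_comp => //; exact: fine_measurable.
  by apply: filterS phiae => t ht _; rewrite fineK// ge0_fin_numE.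
have IE : I <= \int[m2]_t phi t + e%:E.
  rewrite /I; under eq_integral do rewrite EFinD EFinM.
  rewrite ge0_integralD//; last 4 first.
  - by move=> t _; rewrite lee_fin fine_ge0.
  - by apply/measurable_EFinP; apply: measurableT_comp => //; exact: fine_measurable.
  - by move=> t _; rewrite mule_ge0// lee_fin ltW.
  - by apply: measurable_funeM; exact/measurable_EFinP.
  rewrite ifine leeD2l// ge0_integralZl//; last 3 first.
  - exact/measurable_EFinP.
  - by move=> t _; rewrite lee_fin ltW.
  - by rewrite lee_fin ltW.
  by rewrite -[leRHS]mule1 lee_wpmul2l// lee_fin ltW.
apply: le_trans IE; rewrite /eLp.
have mFx x : measurable_fun setT (fun t => F (x, t)) by exact: measurableT_comp.
have miFx : measurable_fun setT (fun x => \int[m2]_t F (x, t)).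
  exact: (measurable_fun_fubini_tonelli_F (m2 := m2) F).
pose G (z : T1 * T2) := (F z * ((psi z.2)^-1)%:E) `^ p * (psi z.2)%:E.
have mpsi2 : measurable_fun setT (fun z : T1 * T2 => (psi z.2)%:E).
  by apply/measurable_EFinP; exact: (measurableT_comp mpsi measurable_snd).
have mG : measurable_fun setT G.
  apply: emeasurable_funM => //; apply: measurable_fun_poweR.
  apply: emeasurable_funM => //; apply/measurable_EFinP.
  have mi : measurable_fun setT (fun t => (psi t)^-1)%R.
    rewrite (_ : (fun t => _) = fun t => (psi t `^ (-1))%R).
      exact: measurableT_comp (measurable_powR _) mpsi.
    by apply/funext => t; rewrite powR_inv1// ltW.
  exact: (measurableT_comp mi measurable_snd).
have G0 z : 0 <= G z by rewrite mule_ge0 ?poweR_ge0// lee_fin ltW.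
suff H : \int[m1]_x ((\int[m2]_t F (x, t)) `^ p) <= I `^ p.
  rewrite -[leRHS](@poweRK _ p) ?gt_eqF//; apply: lee_poweR => //.
    by rewrite invr_ge0 ltW.
  by apply: integral_ge0 => x _; exact: poweR_ge0.
apply: (@le_trans _ _ (\int[m1]_x (I `^ (p - 1) * \int[m2]_t G (x, t)))).
  apply: ge0_le_integral => //.
  - by move=> x _; exact: poweR_ge0.
  - exact: measurable_fun_poweR.
  - apply: measurable_funeM.
    exact: (measurable_fun_fubini_tonelli_F (m2 := m2) G).
  move=> x _.
  have -> : \int[m2]_t F (x, t) =
      \int[m2]_t ((F (x, t) * ((psi t)^-1)%:E) * (psi t)%:E).
    apply: eq_integral => t _.
    by rewrite -muleA -EFinM mulVf ?mule1// gt_eqF.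
  apply: ge0_jensen => //.
  - apply: emeasurable_funM => //; apply/measurable_EFinP.
    rewrite (_ : (fun t => _) = fun t => (psi t `^ (-1))%R).
      exact: measurableT_comp (measurable_powR _) mpsi.
    by apply/funext => t; rewrite powR_inv1// ltW.
  - exact/measurable_EFinP.
  - by move=> t; rewrite mule_ge0// lee_fin invr_ge0 ltW.
  - by move=> t; rewrite lee_fin ltW.
rewrite ge0_integralZl//; last 3 first.
- exact: (measurable_fun_fubini_tonelli_F (m2 := m2) G).
- by move=> x _; exact: integral_ge0.
- exact: poweR_ge0.
rewrite fubini_tonelli//.
have -> : I `^ p = I `^ (p - 1) * I.
  rewrite -[X in _ * X](@poweRe1 _ I)// -poweRD; first by rewrite subrK.
  by rewrite /poweRD_def subrK (gt_eqF p0).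
apply: lee_wpmul2l; first exact: poweR_ge0.
apply: ae_ge0_le_integral => //.
- by move=> t _; exact: integral_ge0.
- exact: (measurable_fun_fubini_tonelli_G (m1 := m1) G).
- by move=> t _; rewrite lee_fin ltW.
- exact/measurable_EFinP.
apply: filterS phiae => t phit _ /=; rewrite /G /=.
have mFt : measurable_fun setT (fun x => F (x, t)) by exact: measurableT_comp.
under eq_integral do rewrite poweRM ?lee_fin ?invr_ge0 ?(ltW (psi0 t))// -muleA.
have c0 : 0 <= ((psi t)^-1)%:E `^ p * (psi t)%:E.
  by rewrite mule_ge0 ?poweR_ge0// lee_fin ltW.
rewrite ge0_integralZr//; last 2 first.
- exact: measurable_fun_poweR.
- by move=> x _; exact: poweR_ge0.
rewrite -poweR_eLp ?gt_eqF// -/(phi t) muleA.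
rewrite -[leRHS]mul1e; apply: lee_wpmul2r; first by rewrite lee_fin ltW.
rewrite -poweRM ?lee_fin ?invr_ge0 ?(ltW (psi0 t))//.
rewrite -(poweR1r p); apply: lee_poweR; first exact: ltW.
  by rewrite mule_ge0// lee_fin invr_ge0 ltW.
rewrite -(@fineK _ (phi t)) ?ge0_fin_numE// -EFinM lee_fin.
by rewrite ler_pdivrMr// mul1r lerDl mulr_ge0// ltW.
Qed.

End minkowski_integral.

(** * Herz seminorms of nonnegative functions *)

Section sums_over_int.
Context {R : realType}.
Local Open Scope ereal_scope.
Implicit Types (a b : int -> \bar R).

(** The enumeration 0, -1, 1, -2, 2, ... of the integers. It turns sums over the annuli into series,
    to which the convergence theorems for counting measure apply. *)
Definition int_of_nat (i : nat) : int := if odd i then Negz i./2 else Posz i./2.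

Lemma int_of_nat_bij : set_bij [set: nat] [set: int] int_of_nat.
Proof.
pose g (k : int) : nat := match k with Posz m => m.*2 | Negz m => m.*2.+1 end.
have fK : cancel g int_of_nat.
  move=> [m|m]; rewrite /int_of_nat /g; first by rewrite odd_double doubleK.
  by rewrite /= odd_double/= uphalf_double.
have gK : cancel int_of_nat g.
  move=> i; rewrite /int_of_nat -{4}(odd_double_half i).
  by case: (odd i).
split=> //; first by move=> i j _ _ /(congr1 g); rewrite !gK.
by move=> k _; exists (g k).
Qed.

Lemma esum_intE a : (forall k, 0 <= a k) ->
  \esum_(k in [set: int]) a k = \sum_(i <oo) a (int_of_nat i).
Proof.
by move=> a0; rewrite nneseries_esumT// (reindex_esum _ _ _ _ int_of_nat_bij).
Qed.

Lemma esum_intZl (c : \bar R) a : 0 <= c -> (forall k, 0 <= a k) ->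
  \esum_(k in [set: int]) (c * a k) = c * \esum_(k in [set: int]) a k.
Proof.
move=> c0 a0; rewrite !esum_intE//; last by move=> k; exact: mule_ge0.
rewrite -!ge0_integral_count//; last by move=> k; exact: mule_ge0.
by rewrite ge0_integralZl.
Qed.

Lemma esum_int_exchange (a : int -> int -> \bar R) : (forall j k, 0 <= a j k) ->
  \esum_(j in [set: int]) \esum_(k in [set: int]) a j k =
  \esum_(k in [set: int]) \esum_(j in [set: int]) a j k.
Proof.
move=> a0; rewrite esum_intE; last by move=> j; exact: esum_ge0.
under eq_eseriesr do rewrite esum_intE//.
rewrite nneseries_interchange//.
rewrite [RHS]esum_intE; last by move=> j; exact: esum_ge0.
by under [RHS]eq_eseriesr do rewrite esum_intE//.
Qed.

Lemma esum_int_shift a (j : int) :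
  \esum_(k in [set: int]) a (k + j)%R = \esum_(k in [set: int]) a k.
Proof.
rewrite [RHS](reindex_esum [set: int] [set: int] (fun k => k + j)%R)//.
split=> // [x y _ _|y _]; first exact: addIr.
by exists (y - j)%R => //; rewrite subrK.
Qed.

(** Tonelli's theorem and invariance under shifts: the discrete Young inequality for l^1, which is
    an equality for nonnegative sequences. *)
Lemma esum_int_convolution a b : (forall k, 0 <= a k) -> (forall k, 0 <= b k) ->
  \esum_(k in [set: int]) \esum_(j in [set: int]) (a (k - j)%R * b j) =
  (\esum_(k in [set: int]) a k) * \esum_(k in [set: int]) b k.
Proof.
move=> a0 b0; rewrite esum_int_exchange; last by move=> j k; exact: mule_ge0.
rewrite -esum_intZl//; last exact: esum_ge0.
apply: eq_esum => j _; rewrite -(esum_int_shift a (- j)%R).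
rewrite muleC -esum_intZl//; apply: eq_esum => k _.
by rewrite muleC.
Qed.

Lemma esum_int_geometric (e : R) : (0 < e)%R ->
  \esum_(k in [set: int]) (2 `^ (- (e * `|k|%:~R)))%:E < +oo :> \bar R.
Proof.
move=> e0; rewrite esum_intE => [|k]; last by rewrite lee_fin powR_ge0.
(* The i-th integer of the enumeration has absolute value at least (i - 1)/2; hence the ratio
   2^(-e/2) and the leading factor 2^(e/2). *)
pose z : R := (2 `^ (- (e / 2)))%R.
have z0 : (0 <= z)%R by exact: powR_ge0.
have z1 : (z < 1)%R by rewrite -(powRr0 2%R) pow2_lt oppr_lt0 divr_gt0.
apply: (@le_lt_trans _ _ (\sum_(i <oo) (geometric (2 `^ (e / 2))%R z i)%:E)).
  apply: lee_nneseries => i _; first by rewrite lee_fin powR_ge0.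
  rewrite lee_fin /geometric /= -powR_mulrn// -powRrM -pow2D pow2_le.
  have : (i%:R / 2 - 2^-1 <= `|int_of_nat i|%:~R :> R)%R.
    rewrite /int_of_nat -{1}(odd_double_half i); case: (odd i) => /=.
      rewrite natrD -muln2 natrM mulrDl mulfK// addrAC mul1r subrr add0r.
      by rewrite NegzE normrN (_ : `|Posz _.+1|%R = Posz (i./2.+1))// -pmulrn ler_nat.
    by rewrite add0n -muln2 natrM mulfK// lerBlDr lerDl invr_ge0.
  move=> h; have := ler_wpM2l (ltW e0) h; lra.
have := @cvg_geometric_series R (2 `^ (e / 2))%R z.
rewrite ger0_norm// => /(_ z1) h.
have -> : \sum_(i <oo) (geometric (2 `^ (e / 2))%R z i)%:E =
    (2 `^ (e / 2) * (1 - z)^-1)%:E.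
  apply/cvg_lim => //.
  rewrite (_ : (fun n => _) = EFin \o series (geometric (2 `^ (e / 2))%R z)).
    by apply: cvg_EFin => //; exact: nearW.
  by apply/funext => n /=; rewrite /series/= sumEFin.
exact: ltry.
Qed.

Lemma integral_esum_int d (T : measurableType d)
    (mu : {measure set T -> \bar R}) (f : int -> T -> \bar R) :
  (forall k, measurable_fun setT (f k)) -> (forall k x, 0 <= f k x) ->
  \int[mu]_x (\esum_(k in [set: int]) f k x) =
  \esum_(k in [set: int]) \int[mu]_x f k x.
Proof.
move=> mf f0; under eq_integral do rewrite esum_intE//.
rewrite integral_nneseries// esum_intE// => k.
by apply: integral_ge0.
Qed.

Lemma measurable_esum_int d (T : measurableType d) (f : int -> T -> \bar R) :
  (forall k, measurable_fun setT (f k)) -> (forall k x, 0 <= f k x) ->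
  measurable_fun setT (fun x => \esum_(k in [set: int]) f k x).
Proof.
move=> mf f0; under eq_fun do rewrite esum_intE//.
by apply: ge0_emeasurable_sum.
Qed.

(** Dominated convergence for counting measure. *)
Lemma esum_int_dominated (u : nat -> int -> \bar R) b :
  (forall m k, 0 <= u m k <= b k) ->
  \esum_(k in [set: int]) b k < +oo ->
  (forall k, u m k @[m --> \oo] --> 0) ->
  \esum_(k in [set: int]) u m k @[m --> \oo] --> 0.
Proof.
move=> ub bfin uk.
have u0 m k : 0 <= u m k by have /andP[] := ub m k.
have b0 k : 0 <= b k by have /andP[h1 h2] := ub 0%N k; exact: le_trans h2.
rewrite (_ : (fun m => _) = (fun m => \int[counting]_i u m (int_of_nat i))).
  have [] := @dominated_convergence _ _ R (@counting nat R) setT measurableT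
    (fun m i => u m (int_of_nat i)) (cst 0) (fun i => b (int_of_nat i)).
  - by [].
  - by [].
  - by apply/aeW => i _; exact: uk.
  - apply/integrableP; split => //.
    under eq_integral do rewrite gee0_abs//.
    by rewrite ge0_integral_count// -esum_intE.
  - by apply/aeW => i m _; rewrite gee0_abs//; have /andP[] := ub m (int_of_nat i).
  by rewrite integral0.
by apply/funext => m; rewrite esum_intE// ge0_integral_count.
Qed.

End sums_over_int.

Section ge0_mfun.
Context d (T : measurableType d) (R : realType).
Local Open Scope ereal_scope.
Implicit Types f g : T -> \bar R.

Definition ge0_mfun g := measurable_fun [set: T] g /\ forall x, 0 <= g x.

Lemma ge0_mfunD f g : ge0_mfun f -> ge0_mfun g -> ge0_mfun (fun x => f x + g x).
Proof.
by move=> [mf f0] [mg g0]; split=> [|x]; [exact: emeasurable_funD|exact: adde_ge0].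
Qed.

Lemma ge0_mfunM f g : ge0_mfun f -> ge0_mfun g -> ge0_mfun (fun x => f x * g x).
Proof.
by move=> [mf f0] [mg g0]; split=> [|x]; [exact: emeasurable_funM|exact: mule_ge0].
Qed.

Lemma ge0_mfun_cst (c : \bar R) : 0 <= c -> ge0_mfun (fun=> c).
Proof. by move=> c0; split. Qed.

Lemma ge0_mfun_indic (A : set T) : measurable A ->
  ge0_mfun (fun x => (\1_A x)%:E).
Proof.
move=> mA; split=> [|x]; last by rewrite lee_fin.
by apply/measurable_EFinP.
Qed.

Lemma ge0_mfun_poweR p g : ge0_mfun g -> ge0_mfun (fun x => g x `^ p).
Proof.
move=> [mg g0]; split=> [|x]; last exact: poweR_ge0.
exact: measurable_fun_poweR.
Qed.

Lemma ge0_mfun_abs (f : T -> R) : measurable_fun setT f ->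
  ge0_mfun (fun x => `|f x|%:E).
Proof.
move=> mf; split=> [|x]; last by rewrite lee_fin.
by apply/measurable_EFinP; exact: measurableT_comp.
Qed.

End ge0_mfun.

(** Makes counting measure eligible for Minkowski's integral inequality, which then becomes the
    triangle inequality for series. *)
HB.instance Definition _ (R : realType) :=
  Measure_isSigmaFinite.Build _ _ _ (@counting nat R) (sigma_finite_counting R).

Section ge0_convergence.
Context {R : realType}.
Local Open Scope ereal_scope.

Lemma cvge0P (T : Type) (F : set_system T) (u : T -> \bar R) : Filter F ->
  (forall x, 0 <= u x) ->
  u x @[x --> F] --> 0 <-> forall e : R, (0 < e)%R -> \forall x \near F, u x <= e%:E.
Proof.
move=> FF u0; split=> [/fine_cvgP[ufin /cvgrPdist_le h] e e0|h].
  near=> x; have xfin : u x \is a fin_num by near: x.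
  rewrite -(fineK xfin) lee_fin.
  rewrite (_ : fine (u x) = `|0 - (fine \o u) x|)%R; first by near: x; exact: h.
  by rewrite sub0r normrN ger0_norm// fine_ge0.
apply/fine_cvgP; split.
  near=> x; rewrite ge0_fin_numE//; apply: (@le_lt_trans _ _ 1%:E); last exact: ltry.
  by near: x; exact: h.
apply/cvgrPdist_le => e e0; near=> x.
rewrite sub0r normrN ger0_norm ?fine_ge0//.
have ux : u x <= e%:E by near: x; exact: h.
by rewrite -lee_fin fineK// ge0_fin_numE// (le_lt_trans ux)// ltry.
Unshelve. all: by end_near. Qed.

Lemma cvg_poweR0 (T : Type) (F : set_system T) (u : T -> \bar R) (r : R) : Filter F ->
  (0 < r)%R -> (forall x, 0 <= u x) -> u x @[x --> F] --> 0 ->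
  (u x `^ r) @[x --> F] --> 0.
Proof.
move=> FF r0 u0 /(cvge0P FF u0) h; apply/cvge0P => [x|e e0]; first exact: poweR_ge0.
have e1 : (0 < e `^ r^-1)%R by rewrite powR_gt0.
apply: filterS (h _ e1) => x ux.
have eE : e%:E = (e `^ r^-1)%R%:E `^ r.
  by rewrite poweR_EFin -powRrM mulVf ?gt_eqF// powRr1// ltW.
by rewrite eE; apply: lee_poweR => //; exact: ltW.
Qed.

End ge0_convergence.

Section eLp_series.
Context d (T : measurableType d) (R : realType).
Variable mu : {sigma_finite_measure set T -> \bar R}.
Local Open Scope ereal_scope.

(** Minkowski's integral inequality with counting measure as second measure and the weights
    2^(-i-1), of total mass 1. *)
Lemma eLp_nneseries p (g : nat -> T -> \bar R) : (1 <= p)%R ->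
  (forall m, ge0_mfun (g m)) ->
  eLp mu p (fun x => \sum_(m <oo) g m x) <= \sum_(m <oo) eLp mu p (g m).
Proof.
move=> p1 hg; pose w (i : nat) : R := (2^-1 ^+ i.+1)%R.
have w0 i : (0 < w i)%R by rewrite exprn_gt0.
have w1 : \int[counting]_i (w i)%:E <= 1.
  rewrite ge0_integral_count; last by move=> i; rewrite lee_fin exprn_ge0.
  have := @cvg_geometric_series R 2^-1%R 2^-1%R.
  rewrite ger0_norm// invf_lt1// ltr1n => /(_ isT) h.
  rewrite (_ : \sum_(i <oo) _ = (2^-1 * (1 - 2^-1)^-1)%:E).
    by rewrite lee_fin (_ : 1 - 2^-1 = 2^-1)%R ?divff//; lra.
  apply/cvg_lim => //.
  rewrite (_ : (fun n => _) = EFin \o series (geometric 2^-1%R 2^-1%R)).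
    by apply: cvg_EFin => //; exact: nearW.
  apply/funext => i /=; rewrite /series/= sumEFin.
  by congr EFin; apply: eq_bigr => j _; rewrite /w exprS.
pose F (z : T * nat) := g z.2 z.1.
have F0 z : 0 <= F z by exact: (hg _).2.
have mF : measurable_fun setT F.
  move=> _ B mB; rewrite setTI.
  rewrite (_ : F @^-1` B = \bigcup_m ((g m @^-1` B) `*` [set m])).
    apply: bigcupT_measurable => m; apply: measurableX => //.
    by rewrite -[X in measurable X]setTI; exact: (hg m).1.
  apply/seteqP; split => [[x m] /= h|[x m] [i _ [/= h ->]]]; last exact: h.
  by exists m.
have mw : measurable_fun setT w by [].
have := @minkowski_integral _ _ _ nat _ mu counting p w F p1 mw w0 w1 mF F0.
rewrite ge0_integral_count; last by move=> i; exact: eLp_ge0.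
rewrite (_ : (fun x => \int[counting]_t F (x, t)) = (fun x => \sum_(m <oo) g m x))//.
by apply/funext => x; rewrite ge0_integral_count// => m; exact: (hg m).2.
Qed.

Lemma ge0_mfun_nneseries (g : nat -> T -> \bar R) :
  (forall m, ge0_mfun (g m)) -> ge0_mfun (fun x => \sum_(m <oo) g m x).
Proof.
move=> hg; split=> [|x]; first by apply: ge0_emeasurable_sum => m *; case: (hg m).
by apply: nneseries_ge0 => m _ _; exact: (hg m).2.
Qed.

End eLp_series.

Section herz_seminorm.
Context {R : realType} {n : nat}.
Local Notation V := 'rV[R]_n.
Local Notation mu := (@lebesgue_rV R n).
Local Open Scope ereal_scope.
Implicit Types (p q al : R) (k : int) (f g : V -> \bar R).

Definition annulus_Lp p k g : \bar R :=
  eLp mu p (fun x => g x * (\1_(dyadic_annulus k) x)%:E).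

Definition ge0_herz al p g : \bar R :=
  \esum_(k in [set: int]) ((2 `^ (k%:~R * al))%R%:E * annulus_Lp p k g).

Let mA k : measurable (@dyadic_annulus R n k).
Proof. exact: measurable_dyadic_annulus. Qed.

Lemma ge0_mfun_annulus k g : ge0_mfun g ->
  ge0_mfun (fun x => g x * (\1_(dyadic_annulus k) x)%:E).
Proof. by move=> hg; apply: ge0_mfunM => //; exact: ge0_mfun_indic. Qed.

Lemma annulus_Lp_ge0 p k g : 0 <= annulus_Lp p k g.
Proof. exact: eLp_ge0. Qed.

Lemma ge0_herz_ge0 al p g : 0 <= ge0_herz al p g.
Proof.
by apply: esum_ge0 => k _; rewrite mule_ge0 ?annulus_Lp_ge0// lee_fin powR_ge0.
Qed.

Lemma annulus_Lp_le p k f g : (0 < p)%R -> ge0_mfun f -> ge0_mfun g ->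
  (\forall x \ae mu, dyadic_annulus k x -> f x <= g x) ->
  annulus_Lp p k f <= annulus_Lp p k g.
Proof.
move=> p0 hf hg fg.
have [mf' f'0] := ge0_mfun_annulus k hf; have [mg' g'0] := ge0_mfun_annulus k hg.
apply: eLp_le => //; apply: filterS fg => x fg.
have [xk|xk] := pselect (dyadic_annulus k x).
  by rewrite indicE mem_set// !mule1; exact: fg.
by rewrite indicE memNset// !mule0.
Qed.

Lemma annulus_Lp_le_eLp p k g : (0 < p)%R -> ge0_mfun g ->
  annulus_Lp p k g <= eLp mu p g.
Proof.
move=> p0 hg; have [mg g0] := hg; have [mg' g'0] := ge0_mfun_annulus k hg.
apply: eLp_le => //; apply: aeW => x.
by rewrite -[leRHS]mule1 lee_wpmul2l// lee_fin indicE; case: (_ \in _).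
Qed.

Lemma annulus_LpD p k f g : (1 <= p)%R -> ge0_mfun f -> ge0_mfun g ->
  annulus_Lp p k (fun x => f x + g x) <= annulus_Lp p k f + annulus_Lp p k g.
Proof.
move=> p1 hf hg.
have [mf' f'0] := ge0_mfun_annulus k hf; have [mg' g'0] := ge0_mfun_annulus k hg.
apply: le_trans (eLpD mu p1 mf' mg' f'0 g'0).
rewrite le_eqVlt; apply/orP; left; apply/eqP; congr eLp; apply/funext => x.
by rewrite ge0_muleDl// ?hf.2 ?hg.2.
Qed.

Lemma annulus_LpZ p k (c : \bar R) g : (0 < p)%R -> ge0_mfun g -> 0 <= c ->
  annulus_Lp p k (fun x => c * g x) = c * annulus_Lp p k g.
Proof.
move=> p0 hg c0; have [mg' g'0] := ge0_mfun_annulus k hg.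
rewrite -eLpZ//; congr eLp; apply/funext => x.
by rewrite muleA.
Qed.

Lemma annulus_Lp_cst p k (c : \bar R) g : (0 < p)%R -> ge0_mfun g -> 0 <= c ->
  (forall x, dyadic_annulus k x -> g x <= c) ->
  annulus_Lp p k g <= c * (2 `^ ((k%:~R + 1) * (n%:R / p)))%R%:E.
Proof.
move=> p0 hg c0 gc.
apply: (@le_trans _ _ (annulus_Lp p k (fun=> c * 1))).
  apply: annulus_Lp_le => //; first by rewrite mule1; exact: ge0_mfun_cst.
  by apply: aeW => x xk; rewrite mule1 gc.
rewrite annulus_LpZ//.
apply: lee_wpmul2l => //; rewrite /annulus_Lp /eLp.
rewrite (eq_integral (fun x => (\1_(dyadic_annulus k) x)%:E)); last first.
  move=> x _; rewrite mul1e indicE; case: (_ \in _); first by rewrite poweR1r.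
  by rewrite poweR0r// gt_eqF.
rewrite integral_indic// setIT.
apply: (le_trans (lee_poweR _ _ (lebesgue_dyadic_annulus_le k))) => //.
  by rewrite invr_ge0 ltW.
by rewrite poweR_EFin -powRrM lee_fin pow2_le mulrCA mulrA.
Qed.

(** Hoelder's inequality against the indicator of the annulus. The conjugate exponent does not exist
    at p = 1, where the two sides coincide. *)
Lemma annulus_L1_le p k g : (1 <= p)%R -> ge0_mfun g ->
  annulus_Lp 1 k g <=
  (2 `^ ((k%:~R + 1) * (n%:R * (1 - p^-1))))%R%:E * annulus_Lp p k g.
Proof.
move=> p1 hg; have p0 : (0 < p)%R by exact: lt_le_trans p1.
have [mg' g'0] := ge0_mfun_annulus k hg.
move: p1; rewrite le_eqVlt => /predU1P[<-|p1].
  by rewrite invr1 subrr !mulr0 powRr0 mul1e.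
pose q := (p / (p - 1))%R.
have pB0 : (0 < p - 1)%R by rewrite subr_gt0.
have q0 : (0 < q)%R by rewrite divr_gt0.
have pq : (p^-1 + q^-1 = 1)%R by rewrite /q; field; rewrite !gt_eqF.
have h1 := ge0_mfun_indic R (mA k).
rewrite /annulus_Lp eLp1//.
rewrite (eq_integral (fun x => g x * (\1_(dyadic_annulus k) x)%:E *
    (\1_(dyadic_annulus k) x)%:E)); last first.
  by move=> x _; rewrite -muleA -EFinM indicE; case: (_ \in _); rewrite ?mulr1 ?mulr0.
apply: le_trans (ge0_hoelder mu p0 q0 pq mg' h1.1 g'0 h1.2) _.
rewrite muleC; apply: lee_wpmul2r; first exact: eLp_ge0.
have := @annulus_Lp_cst q k 1 (cst 1) q0 (ge0_mfun_cst _ _) lee01 (fun _ _ => lexx _).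
rewrite mul1e /annulus_Lp.
rewrite (_ : (fun x => _) = (fun x => (\1_(dyadic_annulus k) x)%:E)); last first.
  by apply/funext => x; rewrite mul1e.
move/(_ lee01)/le_trans; apply; rewrite lee_fin pow2_le.
by rewrite (_ : (1 - p^-1 = q^-1)%R)// -pq addrAC subrr add0r.
Qed.

Section parametric.
Context d2 (T2 : measurableType d2).
Variables (m2 : {sigma_finite_measure set T2 -> \bar R}) (w : T2 -> R).
Hypothesis mw : measurable_fun setT w.
Hypothesis w0 : (forall t, 0 < w t)%R.
Hypothesis w1 : \int[m2]_t (w t)%:E <= 1.

Let mFk k (F : V * T2 -> \bar R) : ge0_mfun F ->
  ge0_mfun (fun z => F z * (\1_(dyadic_annulus k) z.1)%:E).
Proof.
move=> hF; apply: ge0_mfunM => //; have [m0 h0] := ge0_mfun_indic R (mA k).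
split=> [|z]; last exact: h0.
exact: (measurableT_comp m0 measurable_fst).
Qed.

Lemma measurable_annulus_Lp p k (F : V * T2 -> \bar R) : ge0_mfun F ->
  measurable_fun setT (fun t => annulus_Lp p k (fun x => F (x, t))).
Proof.
move=> /(mFk k)[mF F0].
exact: (@measurable_fun_eLp _ _ _ _ _ mu p _ mF F0).
Qed.

(** Because the outer exponent is 1, the sum over the annuli commutes with the integral, and
    Minkowski's inequality is applied on each annulus separately. *)
Lemma ge0_herz_minkowski al p (F : V * T2 -> \bar R) : (1 <= p)%R ->
  ge0_mfun F ->
  ge0_herz al p (fun x => \int[m2]_t F (x, t)) <=
  \int[m2]_t ge0_herz al p (fun x => F (x, t)).
Proof.
move=> p1 hF; rewrite integral_esum_int => [|k|k t]; last first.
- by rewrite mule_ge0 ?annulus_Lp_ge0// lee_fin powR_ge0.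
- by apply: measurable_funeM; exact: measurable_annulus_Lp.
apply: le_esum => k _; rewrite ge0_integralZl//; last 2 first.
- exact: measurable_annulus_Lp.
- by move=> t _; exact: annulus_Lp_ge0.
apply: lee_wpmul2l; first by rewrite lee_fin powR_ge0.
have [mF F0] := mFk k hF.
apply: le_trans (@minkowski_integral _ _ _ _ _ mu m2 p w _ p1 mw w0 w1 mF F0).
rewrite le_eqVlt; apply/orP; left; apply/eqP; congr eLp; apply/funext => x /=.
rewrite ge0_integralZr//.
  exact: (measurableT_comp hF.1).
by move=> t _; exact: hF.2.
Qed.

End parametric.

Lemma ge0_herz_le al p f g : (0 < p)%R -> ge0_mfun f -> ge0_mfun g ->
  (\forall x \ae mu, f x <= g x) -> ge0_herz al p f <= ge0_herz al p g.
Proof.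
move=> p0 hf hg fg; apply: le_esum => k _.
apply: lee_wpmul2l; first by rewrite lee_fin powR_ge0.
by apply: annulus_Lp_le => //; apply: filterS fg.
Qed.

Lemma ge0_herz_ae_eq al p f g : (0 < p)%R -> ge0_mfun f -> ge0_mfun g ->
  (\forall x \ae mu, f x = g x) -> ge0_herz al p f = ge0_herz al p g.
Proof.
move=> p0 hf hg fg; apply/eqP; rewrite eq_le; apply/andP; split;
  by apply: ge0_herz_le => //; apply: filterS fg => x ->.
Qed.

Lemma ge0_herzD al p f g : (1 <= p)%R -> ge0_mfun f -> ge0_mfun g ->
  ge0_herz al p (fun x => f x + g x) <= ge0_herz al p f + ge0_herz al p g.
Proof.
move=> p1 hf hg; rewrite -esumD; last 2 first.
- by move=> k _; rewrite mule_ge0 ?annulus_Lp_ge0// lee_fin powR_ge0.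
- by move=> k _; rewrite mule_ge0 ?annulus_Lp_ge0// lee_fin powR_ge0.
apply: le_esum => k _; rewrite -ge0_muleDr ?annulus_Lp_ge0//.
by rewrite lee_wpmul2l ?annulus_LpD// lee_fin powR_ge0.
Qed.

Lemma ge0_herzZ al p (c : \bar R) g : (0 < p)%R -> ge0_mfun g -> 0 <= c ->
  ge0_herz al p (fun x => c * g x) = c * ge0_herz al p g.
Proof.
move=> p0 hg c0; rewrite /ge0_herz -esum_intZl//; last first.
  by move=> k; rewrite mule_ge0 ?annulus_Lp_ge0// lee_fin powR_ge0.
by apply: eq_esum => k _; rewrite annulus_LpZ// muleCA.
Qed.

Lemma ge0_herz_ge al p k g :
  (2 `^ (k%:~R * al))%R%:E * annulus_Lp p k g <= ge0_herz al p g.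
Proof.
apply: esum_ge; exists [set k]; first by split.
by rewrite fsbig_set1.
Qed.

Lemma annulus_Lp_lty al p k g : ge0_herz al p g < +oo -> annulus_Lp p k g < +oo.
Proof.
move=> h; have := le_lt_trans (ge0_herz_ge al p k g) h.
case: (annulus_Lp p k g) (annulus_Lp_ge0 p k g) => [r _ _|_|//]; first exact: ltry.
by rewrite gt0_muley ?ltxx// lte_fin pow2_gt0.
Qed.

(* The point 0 belongs to no annulus; it is null when n > 0. *)
Lemma ae_neq0 : (0 < n)%N -> \forall x \ae mu, x != 0%R.
Proof.
move=> n0; exists [set 0%R]; split.
- rewrite (_ : [set 0%R] = ~` (\bigcup_k @dyadic_annulus R n k)).
    by apply: measurableC; apply: countable_bigcupT_measurable.
  rewrite bigcup_dyadic_annulus; apply/seteqP; split => [x /= ->|x /= /negP].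
    by rewrite eqxx.
  by rewrite negbK => /eqP.
- exact: lebesgue_rV_set1.
- by move=> x /= /negP; rewrite negbK => /eqP.
Qed.

Lemma ae_forall_annulus (P : V -> Prop) : (0 < n)%N ->
  (forall k, \forall x \ae mu, dyadic_annulus k x -> P x) ->
  \forall x \ae mu, P x.
Proof.
move=> n0 h; have {}h : \forall x \ae mu, forall i : nat,
    dyadic_annulus (int_of_nat i) x -> P x.
  by apply/ae_foralln => i; exact: h.
apply: filterS2 (ae_neq0 n0) h => x x0 h.
have : (\bigcup_k @dyadic_annulus R n k) x by rewrite bigcup_dyadic_annulus.
move=> [k _ xk]; have [_ _ /(_ k I)[i _ ik]] := int_of_nat_bij.
by apply: (h i); rewrite ik.
Qed.

Lemma ge0_herz_eq0 al p g : (0 < n)%N -> (0 < p)%R -> ge0_mfun g ->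
  ge0_herz al p g = 0 -> \forall x \ae mu, g x = 0.
Proof.
move=> n0 p0 hg h; apply: ae_forall_annulus => // k.
have [mg' g'0] := ge0_mfun_annulus k hg.
have : annulus_Lp p k g = 0.
  apply/eqP; rewrite eq_le annulus_Lp_ge0 andbT.
  have := ge0_herz_ge al p k g; by rewrite h pmule_rle0// lte_fin pow2_gt0.
move=> /(eLp_eq0 p0 mg' g'0); apply: filterS => x + xk.
by rewrite indicE mem_set// mule1.
Qed.

Lemma ge0_herz_lty_ae al p g : (0 < n)%N -> (0 < p)%R -> ge0_mfun g ->
  ge0_herz al p g < +oo -> \forall x \ae mu, g x < +oo.
Proof.
move=> n0 p0 hg h; apply: ae_forall_annulus => // k.
have [mg' g'0] := ge0_mfun_annulus k hg.
have := eLp_lty_ae p0 mg' g'0 (annulus_Lp_lty k h).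
apply: filterS => x + xk.
by rewrite indicE mem_set// mule1.
Qed.

Lemma ge0_herz_nneseries al p (g : nat -> V -> \bar R) : (1 <= p)%R ->
  (forall m, ge0_mfun (g m)) ->
  ge0_herz al p (fun x => \sum_(m <oo) g m x) <= \sum_(m <oo) ge0_herz al p (g m).
Proof.
move=> p1 hg.
have w0 k (c : \bar R) : 0 <= c -> 0 <= (2 `^ (k%:~R * al))%R%:E * c.
  by move=> c0; rewrite mule_ge0// lee_fin powR_ge0.
apply: (@le_trans _ _ (\esum_(k in [set: int]) \sum_(m <oo)
    ((2 `^ (k%:~R * al))%R%:E * annulus_Lp p k (g m)))).
  apply: le_esum => k _; rewrite nneseriesZl => [|m _]; last exact: annulus_Lp_ge0.
  apply: lee_wpmul2l; first by rewrite lee_fin powR_ge0.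
  apply: le_trans (eLp_nneseries mu p1 (fun m => ge0_mfun_annulus k (hg m))).
  rewrite le_eqVlt; apply/orP; left; apply/eqP; congr eLp; apply/funext => x.
  rewrite muleC -nneseriesZl => [|m _]; last exact: (hg m).2.
  by apply: eq_eseriesr => m _; rewrite muleC.
rewrite esum_intE => [|k]; last first.
  by apply: nneseries_ge0 => m _ _; rewrite w0 ?annulus_Lp_ge0.
rewrite nneseries_interchange => [|i j]; last by rewrite w0 ?annulus_Lp_ge0.
rewrite le_eqVlt; apply/orP; left; apply/eqP; apply: eq_eseriesr => m _.
by rewrite [RHS]esum_intE// => k; rewrite w0 ?annulus_Lp_ge0.
Qed.

Lemma annulus_Lp_esum_int p k (g : int -> V -> \bar R) : (1 <= p)%R ->
  (forall j, ge0_mfun (g j)) ->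
  annulus_Lp p k (fun x => \esum_(j in [set: int]) g j x) <=
  \esum_(j in [set: int]) annulus_Lp p k (g j).
Proof.
move=> p1 hg; rewrite esum_intE => [|j]; last exact: annulus_Lp_ge0.
apply: le_trans (eLp_nneseries mu p1 (fun m => ge0_mfun_annulus k (hg (int_of_nat m)))).
rewrite le_eqVlt; apply/orP; left; apply/eqP; congr eLp; apply/funext => x.
rewrite esum_intE => [|j]; last exact: (hg j).2.
rewrite muleC -nneseriesZl => [|m _]; last exact: (hg _).2.
by apply: eq_eseriesr => m _; rewrite muleC.
Qed.

(** Dominated convergence is used twice: in L^p on a fixed annulus, then for the sum over the
    annuli. Pointwise convergence is asked for where [g] is finite, which is almost everywhere on
    every annulus. *)
Lemma ge0_herz_dominated al p (f : nat -> V -> \bar R) g : (0 < p)%R ->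
  (forall m, ge0_mfun (f m)) -> ge0_mfun g -> ge0_herz al p g < +oo ->
  (forall m x, f m x <= g x) ->
  (\forall x \ae mu, g x < +oo -> f m x @[m --> \oo] --> 0) ->
  ge0_herz al p (f m) @[m --> \oo] --> 0.
Proof.
move=> p0 hf hg gfin fg f0.
have ale m k : annulus_Lp p k (f m) <= annulus_Lp p k g.
  by apply: annulus_Lp_le => //; apply: aeW => x _; exact: fg.
have w0 k : 0 <= (2 `^ (k%:~R * al))%R%:E :> \bar R by rewrite lee_fin powR_ge0.
apply: (@esum_int_dominated _ _
    (fun k => (2 `^ (k%:~R * al))%R%:E * annulus_Lp p k g)) => //.
  by move=> m k; rewrite mule_ge0 ?annulus_Lp_ge0//= lee_wpmul2l.
move=> k; rewrite -[X in _ --> X](mule0 (2 `^ (k%:~R * al))%R%:E).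
apply: cvgeZl => //.
have [mg' g'0] := ge0_mfun_annulus k hg.
have afin := annulus_Lp_lty k gfin.
apply: cvg_poweR0; first by rewrite invr_gt0.
  by move=> m; apply: integral_ge0 => x _; exact: poweR_ge0.
pose G x := (g x * (\1_(dyadic_annulus k) x)%:E) `^ p.
pose Fm m x := (f m x * (\1_(dyadic_annulus k) x)%:E) `^ p.
have [] := @dominated_convergence _ _ R mu setT measurableT Fm (cst 0) G.
- by move=> m; apply: measurable_fun_poweR; exact: (ge0_mfun_annulus k (hf m)).1.
- by [].
- apply: filterS2 f0 (eLp_lty_ae p0 mg' g'0 afin) => x f0 gx _.
  rewrite /Fm /cst /=; have [xk|xk] := boolP (x \in dyadic_annulus k).
    apply: cvg_poweR0 => // [m|]; first by rewrite mule_ge0// (hf m).2.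
    move: gx; rewrite indicE xk mule1 => /f0 {}f0.
    by under eq_fun do rewrite mule1.
  rewrite (_ : (fun m => _) = cst 0); first exact: cvg_cst.
  by apply/funext => m; rewrite indicE (negbTE xk) mule0 poweR0r// gt_eqF.
- apply/integrableP; split; first exact: measurable_fun_poweR.
  under eq_integral do rewrite gee0_abs ?poweR_ge0//.
  by apply: lty_poweRy afin; rewrite invr_eq0 gt_eqF.
- apply: aeW => x m _; rewrite gee0_abs ?poweR_ge0//.
  apply: lee_poweR; first exact: ltW.
    by rewrite mule_ge0// (hf m).2.
  by rewrite lee_wpmul2r// lee_fin.
by rewrite integral0.
Qed.

End herz_seminorm.

(** * Heat semigroup estimates in Herz spaces *)

Section heat_semigroup_ge0.
Context {R : realType} {n : nat}.
Local Notation V := 'rV[R]_n.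
Local Notation mu := (@lebesgue_rV R n).
Local Open Scope ereal_scope.
Implicit Types (s t p q : R) (f g : V -> \bar R) (x y : V).

(** The semigroup with values in [0, +oo]. Applied to |f| it majorises the modulus of the solution
    of the heat equation with data f, and its finiteness at x is the absolute convergence of the
    integral there. *)
Definition ge0_heat t g x : \bar R :=
  \int[mu]_y ((heat_kernel t (x - y))%:E * g y).

Let hkE t x : 0 <= (heat_kernel t x)%:E :> \bar R.
Proof. by rewrite lee_fin heat_kernel_ge0. Qed.

Lemma measurable_heat_kernel_sub t x :
  measurable_fun setT (fun y : V => (heat_kernel t (x - y))%:E).
Proof.
apply/measurable_EFinP; apply: (measurableT_comp (measurable_heat_kernel t)).
exact: measurable_rV_sub.
Qed.

Lemma ge0_mfun_heat_kernelM t x g : ge0_mfun g ->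
  ge0_mfun (fun y => (heat_kernel t (x - y))%:E * g y).
Proof.
by move=> hg; apply: ge0_mfunM => //; split; [exact: measurable_heat_kernel_sub|].
Qed.

Lemma ge0_mfun_heat2 t g : ge0_mfun g ->
  ge0_mfun (fun z : V * V => (heat_kernel t (z.1 - z.2))%:E * g z.2).
Proof.
move=> [mg g0]; split=> [|z]; last by rewrite mule_ge0.
apply: emeasurable_funM; last exact: (measurableT_comp mg measurable_snd).
apply/measurable_EFinP; apply: (measurableT_comp (measurable_heat_kernel t)).
by apply: measurable_rV_sub; [exact: measurable_fst|exact: measurable_snd].
Qed.

Lemma ge0_mfun_heat t g : ge0_mfun g -> ge0_mfun (ge0_heat t g).
Proof.
move=> hg; have [m2 h2] := ge0_mfun_heat2 t hg; split=> [|x].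
  exact: (measurable_fun_fubini_tonelli_F (m2 := mu) _ m2 h2).
by apply: integral_ge0 => y _; rewrite mule_ge0// hg.2.
Qed.

Lemma ge0_heatD t f g x : ge0_mfun f -> ge0_mfun g ->
  ge0_heat t (fun y => f y + g y) x = ge0_heat t f x + ge0_heat t g x.
Proof.
move=> hf hg.
have [mf f0] := ge0_mfun_heat_kernelM t x hf.
have [mg g0] := ge0_mfun_heat_kernelM t x hg.
rewrite /ge0_heat -ge0_integralD//; apply: eq_integral => y _.
by rewrite ge0_muleDr ?hf.2 ?hg.2.
Qed.

Lemma ge0_heat_semigroup s t g x : (0 < s)%R -> (0 < t)%R -> ge0_mfun g ->
  ge0_heat s (ge0_heat t g) x = ge0_heat (s + t) g x.
Proof.
move=> s0 t0 hg.
pose F (z : V * V) : \bar R :=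
  (heat_kernel s (x - z.1))%:E * ((heat_kernel t (z.1 - z.2))%:E * g z.2).
have [m2 h2] := ge0_mfun_heat2 t hg.
have F0 z : 0 <= F z by rewrite mule_ge0.
have mF : measurable_fun setT F.
  apply: emeasurable_funM => //.
  exact: (measurableT_comp (measurable_heat_kernel_sub s x) measurable_fst).
transitivity (\int[mu]_y \int[mu]_z F (y, z)).
  apply: eq_integral => y _; rewrite /F /= ge0_integralZl//.
    exact: (ge0_mfun_heat_kernelM t y hg).1.
  by move=> z _; exact: (ge0_mfun_heat_kernelM t y hg).2.
rewrite fubini_tonelli//; apply: eq_integral => z _; rewrite /F /=.
under eq_integral do rewrite muleA -EFinM.
rewrite ge0_integralZr//; last 3 first.
- apply/measurable_EFinP; apply: measurable_funM.
    by apply/measurable_EFinP; exact: measurable_heat_kernel_sub.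
  apply: (measurableT_comp (measurable_heat_kernel t)).
  exact: measurable_rV_sub.
- by move=> y _; rewrite lee_fin mulr_ge0 ?heat_kernel_ge0.
- exact: hg.2.
by rewrite heat_kernel_semigroup.
Qed.

Lemma integral_ge0_heat t g : (0 < t)%R -> ge0_mfun g ->
  \int[mu]_x ge0_heat t g x = \int[mu]_x g x.
Proof.
move=> t0 hg; have [m2 h2] := ge0_mfun_heat2 t hg.
rewrite /ge0_heat (fubini_tonelli (m1 := mu) (m2 := mu) _ m2 h2).
apply: eq_integral => y _ /=; rewrite ge0_integralZr//; last 2 first.
- apply/measurable_EFinP; apply: (measurableT_comp (measurable_heat_kernel t)).
  exact: measurable_rV_sub.
- exact: hg.2.
under eq_integral do rewrite heat_kernelBC.
by rewrite integral_heat_kernel_sub// mul1e.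
Qed.

(** Jensen's inequality for the probability density y |-> heat_kernel t (x - y), followed by
    conservation of mass for g^p. *)
Lemma eLp_heat_le p t g : (1 <= p)%R -> (0 < t)%R -> ge0_mfun g ->
  eLp mu p (ge0_heat t g) <= eLp mu p g.
Proof.
move=> p1 t0 hg; have p0 : (0 < p)%R by exact: lt_le_trans p1.
have hgp := ge0_mfun_poweR p hg.
apply: lee_poweR; first by rewrite invr_ge0 ltW.
  by apply: integral_ge0 => x _; exact: poweR_ge0.
rewrite -(integral_ge0_heat t0 hgp).
apply: ge0_le_integral => //.
- by move=> x _; exact: poweR_ge0.
- exact: (ge0_mfun_poweR p (ge0_mfun_heat t hg)).1.
- exact: (ge0_mfun_heat t hgp).1.
move=> x _; have := @ge0_jensen _ _ _ mu p g (fun y => (heat_kernel t (x - y))%:E)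
  p1 hg.1 (measurable_heat_kernel_sub t x) hg.2 (fun y => hkE t (x - y)).
rewrite integral_heat_kernel_sub// poweR1r mul1e /ge0_heat.
by under eq_integral do rewrite muleC; under [leRHS]eq_integral do rewrite muleC.
Qed.

Lemma ge0_heat_le_sup t g x (c : R) : (0 <= c)%R -> ge0_mfun g ->
  (forall y, g y != 0 -> (heat_kernel t (x - y) <= c)%R) ->
  ge0_heat t g x <= c%:E * \int[mu]_y g y.
Proof.
move=> c0 hg hc; rewrite -ge0_integralZl//; last 2 first.
- exact: hg.1.
- by move=> y _; exact: hg.2.
apply: ge0_le_integral => //.
- by move=> y _; exact: (ge0_mfun_heat_kernelM t x hg).2.
- exact: (ge0_mfun_heat_kernelM t x hg).1.
- by apply: measurable_funeM; exact: hg.1.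
move=> y _; have [->|gy] := eqVneq (g y) 0; first by rewrite !mule0.
by rewrite lee_wpmul2r ?hg.2// lee_fin hc.
Qed.

(** Here |y| >= 2^(j-1) and |x| < 2^(j-2), so that the points are at least 2^(j-2) apart; this loss
    of a factor 4 in the radius turns 4 (n + 1) into 16 (n + 1). *)
Let heat_kernel_far t (j k : int) x y : (0 < t)%R ->
  dyadic_annulus k x -> dyadic_annulus j y -> (k + 2 <= j)%R ->
  (heat_kernel t (x - y) <=
   (16 * n.+1%:R) ^+ n * 2 `^ (- (n%:R * j%:~R)))%R.
Proof.
move=> t0 /dyadic_annulusE/andP[_ xk] /dyadic_annulusE/andP[yj _] kj.
have xj : (eucl_norm x < 2 `^ (j%:~R - 2))%R.
  apply: lt_le_trans xk _; rewrite pow2_le.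
  by move: kj; rewrite -(ler_int R) intrD; lra.
have dist : (2 `^ (j%:~R - 2) <= eucl_norm (x - y))%R.
  have E : (2 `^ (j%:~R - 1) = 2 * 2 `^ (j%:~R - 2) :> R)%R.
    rewrite (_ : j%:~R - 1 = 1 + (j%:~R - 2) :> R)%R; last by ring.
    by rewrite pow2D powRr1.
  have := ler_eucl_normB y x; rewrite eucl_normBC; move: yj; rewrite E.
  by move: xj; lra.
have d0 := lt_le_trans (pow2_gt0 (j%:~R - 2)) dist.
have /= h := heat_kernel_le_norm (x - y) t0.
have {}h : (heat_kernel t (x - y) <= (4 * n.+1%:R) ^+ n / eucl_norm (x - y) ^+ n)%R.
  by rewrite ler_pdivlMr ?exprn_gt0// mulrC.
apply: le_trans h _.
rewrite ler_pdivrMr ?exprn_gt0//.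
have -> : (2 `^ (- (n%:R * j%:~R)) = (2 `^ j%:~R) ^- n :> R)%R.
  by rewrite powRN mulrC powRrM powR_mulrn ?powR_ge0.
rewrite -mulrA mulrC -exprVn -exprMn mulrC -exprMn.
apply: lerXn2r; rewrite ?nnegrE ?mulr_ge0 ?invr_ge0 ?powR_ge0 ?(ltW d0)//.
apply: (@le_trans _ _ (16 * n.+1%:R * (2 `^ (j%:~R - 2) / 2 `^ j%:~R)))%R.
  rewrite -powRN -pow2D (_ : (_ - _ + _ = - 2%:R)%R); last by ring.
  rewrite powRN powR_mulrn// -natrX mulrAC.
  by rewrite (_ : (16 / (2 ^ 2)%N%:R = 4 :> R)%R)//; field.
rewrite ler_wpM2l ?mulr_ge0//.
by rewrite mulrC ler_wpM2l// invr_ge0 powR_ge0.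
Qed.

Lemma heat_kernel_annulus_le t (j k : int) x y : (0 < t)%R ->
  dyadic_annulus k x -> dyadic_annulus j y -> (2 <= `|k - j|)%R ->
  (heat_kernel t (x - y) <=
   (16 * n.+1%:R) ^+ n * 2 `^ (- (n%:R * (Num.max k j)%:~R)))%R.
Proof.
move=> t0 xk yj; have [kj|jk] := leP k j.
  rewrite ler0_norm ?subr_le0// opprB lerBrDl => h.
  exact: heat_kernel_far xk yj h.
rewrite gtr0_norm ?subr_gt0// lerBrDl => h.
by rewrite heat_kernelBC; exact: heat_kernel_far yj xk h.
Qed.

Lemma ge0_annulus_sum g y : 0 <= g y -> y != 0%R ->
  \esum_(j in [set: int]) (g y * (\1_(dyadic_annulus j) y)%:E) = g y.
Proof.
move=> g0 y0.
have g1 j : 0 <= g y * (\1_(@dyadic_annulus R n j) y)%:E by rewrite mule_ge0.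
have : (\bigcup_k @dyadic_annulus R n k) y by rewrite bigcup_dyadic_annulus.
move=> [k _ yk]; rewrite (esumID [set k])// setTI esum_set1//.
rewrite indicE mem_set// mule1 esum1 ?adde0// => j [_ /= jk].
rewrite indicE memNset ?mule0// => yj.
have /trivIsetP/(_ j k I I) := @trivIset_dyadic_annulus R n.
have jk' : j != k by apply/eqP.
by move=> /(_ jk') /seteqP[/(_ y) + _]; apply.
Qed.

Lemma integral_annulus_sum g : (0 < n)%N -> ge0_mfun g ->
  \int[mu]_y g y = \esum_(j in [set: int]) annulus_Lp 1 j g.
Proof.
move=> n0 hg; have hgj j := ge0_mfun_annulus j hg.
under eq_esum => j _ do rewrite /annulus_Lp (eLp1 mu (hgj j).2).
rewrite -integral_esum_int; last 2 first.
- by move=> j; exact: (hgj j).1.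
- by move=> j; exact: (hgj j).2.
apply: ae_eq_integral => //.
- exact: hg.1.
- by apply: measurable_esum_int => [j|j y]; [exact: (hgj j).1|exact: (hgj j).2].
by apply: filterS (ae_neq0 n0) => y y0 _; rewrite ge0_annulus_sum//; exact: hg.2.
Qed.

Lemma ge0_heat_annulus_sum t g x : (0 < n)%N -> ge0_mfun g ->
  ge0_heat t g x = \esum_(j in [set: int])
    ge0_heat t (fun y => g y * (\1_(dyadic_annulus j) y)%:E) x.
Proof.
move=> n0 hg; have hK := ge0_mfun_heat_kernelM t x hg.
rewrite /ge0_heat integral_annulus_sum//; apply: eq_esum => j _.
rewrite /annulus_Lp (eLp1 mu (ge0_mfun_annulus j hK).2).
by apply: eq_integral => y _; rewrite muleA.
Qed.

(** Reduces an estimate of the output on one annulus to data supported in one annulus, by the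
    triangle inequality for series. *)
Lemma annulus_Lp_heat_le q t g (k : int) (w : \bar R) (M : int -> \bar R) :
  (0 < n)%N -> (1 <= q)%R -> 0 <= w -> ge0_mfun g ->
  (forall j, w * annulus_Lp q k
     (ge0_heat t (fun y => g y * (\1_(dyadic_annulus j) y)%:E)) <= M j) ->
  w * annulus_Lp q k (ge0_heat t g) <= \esum_(j in [set: int]) M j.
Proof.
move=> n0 q1 w0 hg hM.
apply: (@le_trans _ _ (\esum_(j in [set: int]) (w * annulus_Lp q k
    (ge0_heat t (fun y => g y * (\1_(dyadic_annulus j) y)%:E))))); last first.
  by apply: le_esum => j _; exact: hM.
rewrite esum_intZl// => [|j]; last exact: annulus_Lp_ge0.
apply: lee_wpmul2l => //.
apply: le_trans (annulus_Lp_esum_int k q1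
  (fun j => ge0_mfun_heat t (ge0_mfun_annulus j hg))).
rewrite le_eqVlt; apply/orP; left; apply/eqP; congr (annulus_Lp _ _ _).
by apply/funext => x; exact: ge0_heat_annulus_sum.
Qed.

(* The kernel bound c is only needed between the annuli of index k and j. *)
Lemma annulus_Lp_heat_kernel_le q t g (k j : int) (c : R) :
  (1 <= q)%R -> (0 <= c)%R -> ge0_mfun g ->
  (forall x y, dyadic_annulus k x -> dyadic_annulus j y ->
     (heat_kernel t (x - y) <= c)%R) ->
  annulus_Lp q k (ge0_heat t (fun y => g y * (\1_(dyadic_annulus j) y)%:E)) <=
  (c * 2 `^ ((k%:~R + 1) * (n%:R / q)))%R%:E * annulus_Lp 1 j g.
Proof.
move=> q1 c0 hg hc; have q0 : (0 < q)%R by exact: lt_le_trans q1.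
have hgj := ge0_mfun_annulus j hg.
apply: le_trans (@annulus_Lp_cst _ _ q k (c%:E * annulus_Lp 1 j g) _ q0
  (ge0_mfun_heat t hgj) _ _) _.
- by rewrite mule_ge0 ?annulus_Lp_ge0.
- move=> x xk; rewrite /annulus_Lp eLp1; last exact: hgj.2.
  apply: ge0_heat_le_sup => // y gy; apply: hc => //.
  by apply: contra_neqP gy => yj; rewrite indicE memNset// mule0.
by rewrite EFinM muleAC.
Qed.

Section herz_bound.
Variables (al q : R).
Hypotheses (n0 : (0 < n)%N) (q1 : (1 <= q)%R).
(** The homogeneity of the space: dilating a function by a power of two, x |-> f(2^m x), multiplies
    its seminorm by 2^(-m delta). *)
Let delta : R := (al + n%:R / q)%R.
Hypotheses (d0 : (0 < delta)%R) (dn : (delta < n%:R)%R).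
(** Rate of decay in |k - j|: sources further out than the output annulus gain [delta] per step,
    sources further in gain [n - delta]. *)
Let e : R := Num.min delta (n%:R - delta)%R.
(** The first summand serves annuli at distance at least 2, with 2^n collecting the roundings k + 1
    and j + 1 of the radii; the second serves equal and adjacent annuli. *)
Let C : R := ((16 * n.+1%:R) ^+ n * 2 `^ n%:R + 2 `^ (`|al| + e))%R.
Let q0 : (0 < q)%R. Proof. exact: lt_le_trans q1. Qed.

Let e0 : (0 < e)%R.
Proof. by rewrite lt_min d0 subr_gt0. Qed.

Let C0 : (0 < C)%R.
Proof. by rewrite ltr_wpDl ?powR_gt0// mulr_ge0 ?powR_ge0// exprn_ge0 ?mulr_ge0. Qed.

Let a g (j : int) := (2 `^ (j%:~R * al))%R%:E * annulus_Lp q j g.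

(** Between distant annuli the kernel is at most a constant times 2^(-n max(k,j)), and Hoelder's
    inequality pays for the L^1 norm of the source. Otherwise contraction in L^q suffices, the two
    weights being comparable. *)
Lemma herz_heat_pair t g (k j : int) : (0 < t)%R -> ge0_mfun g ->
  (2 `^ (k%:~R * al))%R%:E *
    annulus_Lp q k (ge0_heat t (fun y => g y * (\1_(dyadic_annulus j) y)%:E)) <=
  (C * 2 `^ (- (e * `|k - j|%:~R)))%R%:E * a g j.
Proof.
move=> t0 hg; have hgj := ge0_mfun_annulus j hg.
have ed : (e <= delta)%R by rewrite ge_min lexx.
have en : (e <= n%:R - delta)%R by rewrite ge_min lexx orbT.
have [far|near] := leP (2 : int)%R `|k - j|%R.
  have cge0 : (0 <= (16 * n.+1%:R) ^+ n * 2 `^ (- (n%:R * (Num.max k j)%:~R)) :> R)%R.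
    by rewrite mulr_ge0 ?powR_ge0// exprn_ge0 ?mulr_ge0.
  have := annulus_Lp_heat_kernel_le q1 cge0 hg
    (fun x y xk yj => heat_kernel_annulus_le t0 xk yj far).
  move=> /(lee_wpmul2l (_ : 0 <= (2 `^ (k%:~R * al))%R%:E)).
  rewrite lee_fin powR_ge0 => /(_ isT)/le_trans; apply.
  rewrite /a !muleA.
  apply: (@le_trans _ _ (((2 `^ (k%:~R * al))%R%:E *
    ((16 * n.+1%:R) ^+ n * 2 `^ (- (n%:R * (Num.max k j)%:~R)) *
      2 `^ ((k%:~R + 1) * (n%:R / q)))%R%:E) *
    ((2 `^ ((j%:~R + 1) * (n%:R * (1 - q^-1))))%R%:E * annulus_Lp q j g))).
    apply: lee_wpmul2l; last exact: annulus_L1_le.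
    by rewrite -EFinM lee_fin !mulr_ge0 ?powR_ge0// exprn_ge0 ?mulr_ge0.
  rewrite muleA -!EFinM; apply: lee_wpmul2r; first exact: annulus_Lp_ge0.
  rewrite lee_fin.
  have assoc (A x y z w : R) : (x * (A * y * z) * w = A * (x * y * z * w))%R by ring.
  rewrite assoc.
  rewrite -!pow2D -mulrA -pow2D.
  apply: (@le_trans _ _ ((16 * n.+1%:R) ^+ n * 2 `^ n%:R *
      2 `^ (- (e * `|k - j|%:~R) + j%:~R * al))%R); last first.
    by rewrite ler_wpM2r ?powR_ge0// lerDl powR_ge0.
  rewrite -mulrA -pow2D ler_wpM2l ?exprn_ge0 ?mulr_ge0// pow2_le.
  have nq : (al = delta - n%:R / q)%R by rewrite /delta addrK.
  rewrite nq; have [kj|jk] := leP k j.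
    have kj' : (k%:~R <= j%:~R :> R)%R by rewrite ler_int.
    have -> : (`|k - j|%:~R = j%:~R - k%:~R :> R)%R.
      by rewrite ler0_norm ?subr_le0// intrN intrB opprB.
    rewrite -subr_ge0 (_ : (_ - _)%R = ((delta - e) * (j%:~R - k%:~R))%R).
      by rewrite mulr_ge0 ?subr_ge0.
    by field; rewrite gt_eqF.
  have jk' : (j%:~R <= k%:~R :> R)%R by rewrite ler_int ltW.
  have -> : (`|k - j|%:~R = k%:~R - j%:~R :> R)%R.
    by rewrite gtr0_norm ?subr_gt0// intrB.
  rewrite -subr_ge0 (_ : (_ - _)%R = ((n%:R - delta - e) * (k%:~R - j%:~R))%R).
    by rewrite mulr_ge0 ?subr_ge0.
  by field; rewrite gt_eqF.
have near1 : (`|k - j|%:~R <= 1 :> R)%R.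
  by rewrite -[1%R]/(1%:~R) ler_int -ltzD1.
have h : annulus_Lp q k (ge0_heat t (fun y => g y * (\1_(dyadic_annulus j) y)%:E)) <=
    annulus_Lp q j g.
  apply: le_trans (annulus_Lp_le_eLp k q0 (ge0_mfun_heat t hgj)) _.
  exact: eLp_heat_le.
rewrite /a muleA -EFinM; apply: lee_pmul => //; first exact: annulus_Lp_ge0.
rewrite lee_fin -mulrA -pow2D.
apply: (@le_trans _ _ (2 `^ (`|al| + e) * 2 `^ (- (e * `|k - j|%:~R) + j%:~R * al))%R); last first.
  by rewrite ler_wpM2r ?powR_ge0// lerDr mulr_ge0 ?powR_ge0// exprn_ge0 ?mulr_ge0.
rewrite -pow2D pow2_le.
have h1 : (e * `|k - j|%:~R <= e)%R by rewrite ler_piMr// ltW.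
have h2 : ((k%:~R - j%:~R) * al <= `|al|)%R.
  apply: le_trans (ler_norm _) _; rewrite normrM ler_piMl//.
  by rewrite -intrB -intr_norm.
lra.
Qed.

Let K : \bar R := \esum_(k in [set: int]) (C * 2 `^ (- (e * `|k|%:~R)))%R%:E.

Let Kfin : K < +oo.
Proof.
rewrite /K; under eq_esum do rewrite EFinM.
rewrite esum_intZl => [||k]; rewrite ?lee_fin ?powR_ge0 ?(ltW C0)//.
rewrite lte_mul_pinfty ?lee_fin ?(ltW C0)//.
exact: esum_int_geometric.
Qed.

(* The uniformity of b in t lets dominated convergence pass to the limit t -> 0
   in the Herz seminorm. *)
Lemma herz_heat_majorant g : ge0_mfun g -> exists b : int -> \bar R,
  (forall t k, (0 < t)%R ->
     (2 `^ (k%:~R * al))%R%:E * annulus_Lp q k (ge0_heat t g) <= b k) /\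
  \esum_(k in [set: int]) b k = K * ge0_herz al q g.
Proof.
move=> hg; have a0 j : 0 <= a g j.
  by rewrite mule_ge0 ?annulus_Lp_ge0// lee_fin powR_ge0.
exists (fun k => \esum_(j in [set: int])
  ((C * 2 `^ (- (e * `|k - j|%:~R)))%R%:E * a g j)); split.
  move=> t k t0; apply: annulus_Lp_heat_le => // j.
  exact: herz_heat_pair.
apply: (@esum_int_convolution _ (fun k => (C * 2 `^ (- (e * `|k|%:~R)))%R%:E)) => //.
by move=> k; rewrite lee_fin mulr_ge0 ?powR_ge0// ltW.
Qed.

Lemma herz_heat_majorant_lty g : ge0_mfun g -> ge0_herz al q g < +oo ->
  exists b : int -> \bar R,
  (forall t k, (0 < t)%R ->
     (2 `^ (k%:~R * al))%R%:E * annulus_Lp q k (ge0_heat t g) <= b k) /\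
  \esum_(k in [set: int]) b k < +oo.
Proof.
move=> hg gfin; have [b [hb bE]] := herz_heat_majorant hg; exists b; split => //.
have K0 : 0 <= K.
  by apply: esum_ge0 => k _; rewrite lee_fin mulr_ge0 ?powR_ge0// ltW.
rewrite bE -(fineK (_ : K \is a fin_num)) ?ge0_fin_numE//.
by rewrite lte_mul_pinfty// ?lee_fin ?fine_ge0.
Qed.

Lemma ge0_herz_heat_le : exists2 c : R, (0 < c)%R & forall t g, (0 < t)%R ->
  ge0_mfun g -> ge0_herz al q (ge0_heat t g) <= c%:E * ge0_herz al q g.
Proof.
have K0 : 0 <= K.
  by apply: esum_ge0 => k _; rewrite lee_fin mulr_ge0 ?powR_ge0// ltW.
exists (fine K + 1)%R; first by rewrite ltr_wpDl// fine_ge0.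
move=> t g t0 hg; have [b [hb bE]] := herz_heat_majorant hg.
apply: (@le_trans _ _ (K * ge0_herz al q g)).
  by rewrite -bE; apply: le_esum => k _; exact: hb.
apply: lee_wpmul2r; first exact: ge0_herz_ge0.
by rewrite EFinD fineK ?ge0_fin_numE// leeDl.
Qed.

End herz_bound.

(** Integrate g^q <= S^(q-p) g^p. *)
Lemma eLp_interpolation (p q : R) (S : \bar R) g : (0 < p)%R -> (p <= q)%R ->
  ge0_mfun g -> 0 <= S -> (forall x, g x <= S) ->
  eLp mu q g <= S `^ (1 - p / q) * eLp mu p g `^ (p / q).
Proof.
move=> p0 pq hg S0 gS; have q0 : (0 < q)%R by exact: lt_le_trans pq.
have ige0 r : 0 <= \int[mu]_x (g x `^ r) by apply: integral_ge0 => x _; exact: poweR_ge0.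
have h : \int[mu]_x (g x `^ q) <= S `^ (q - p) * \int[mu]_x (g x `^ p).
  rewrite -ge0_integralZl//; last 3 first.
  - exact: (ge0_mfun_poweR p hg).1.
  - by move=> x _; exact: poweR_ge0.
  - exact: poweR_ge0.
  apply: ge0_le_integral => //.
  - by move=> x _; exact: poweR_ge0.
  - exact: (ge0_mfun_poweR q hg).1.
  - by apply: measurable_funeM; exact: (ge0_mfun_poweR p hg).1.
  move=> x _; rewrite (_ : g x `^ q = g x `^ (q - p) * g x `^ p); last first.
    rewrite -poweRD ?subrK//.
    by rewrite /poweRD_def subrK (gt_eqF q0).
  rewrite lee_wpmul2r ?poweR_ge0// lee_poweR ?subr_ge0//; exact: hg.2.
rewrite /eLp; apply: (le_trans (lee_poweR _ (ige0 q) h)).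
  by rewrite invr_ge0 ltW.
rewrite poweRM ?poweR_ge0// -!poweRrM.
rewrite (_ : ((q - p) / q = 1 - p / q)%R); last by field; rewrite gt_eqF.
by rewrite (_ : (p^-1 * (p / q) = q^-1)%R)//; field; rewrite !gt_eqF.
Qed.

(** * Smoothing from the source space into the solution space *)

Section smoothing.
Variables (q sg gamma : R).
Hypotheses (n0 : (0 < n)%N) (sg0 : (0 < sg)%R) (sg1 : (sg < 1)%R).
Let p : R := (q * sg)%R.
Hypotheses (p1 : (1 <= p)%R) (g0 : (0 < gamma)%R) (gn : (gamma < n%:R)%R).
Let delta : R := ((n%:R - gamma) * sg)%R.
Let al : R := (delta - n%:R / q)%R.
Let al' : R := (n%:R * (1 - p^-1))%R.
Let e : R := Num.min delta (n%:R - delta)%R.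
Let Cn : R := ((16 * n.+1%:R) ^+ n)%R.
Let C : R := (Cn * 2 `^ (n%:R / q + al') + 2 `^ (al' + e))%R.

Let p0 : (0 < p)%R. Proof. exact: lt_le_trans p1. Qed.
Let q0 : (0 < q)%R. Proof. by rewrite -(pmulr_lgt0 _ sg0). Qed.
Let pq : (p <= q)%R. Proof. by rewrite /p ler_piMr// ltW. Qed.
Let q1 : (1 <= q)%R. Proof. exact: le_trans pq. Qed.
Let d0 : (0 < delta)%R. Proof. by rewrite mulr_gt0// subr_gt0. Qed.
Let dn : (delta < n%:R)%R.
Proof.
rewrite /delta; apply: (@lt_trans _ _ (n%:R - gamma)%R); last by rewrite gtrBl.
by rewrite gtr_pMr// subr_gt0.
Qed.
Let e0 : (0 < e)%R. Proof. by rewrite lt_min d0 subr_gt0. Qed.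
Let al'0 : (0 <= al')%R.
Proof. by rewrite mulr_ge0// subr_ge0 invf_le1. Qed.
Let Cn1 : (1 <= Cn)%R.
Proof.
rewrite exprn_ege1//; have : (1 <= n.+1%:R :> R)%R by rewrite ler1n.
lra.
Qed.
Let Cn0 : (0 <= Cn)%R. Proof. exact: le_trans Cn1. Qed.
Let C0 : (0 < C)%R.
Proof. by rewrite ltr_wpDl ?powR_gt0// mulr_ge0 ?powR_ge0. Qed.

Let c g (j : int) := (2 `^ (j%:~R * al'))%R%:E * annulus_Lp p j g.

Let c0 g j : 0 <= c g j.
Proof. by rewrite mule_ge0 ?annulus_Lp_ge0// lee_fin powR_ge0. Qed.

Let L1c g j : ge0_mfun g -> annulus_Lp 1 j g <= (2 `^ al')%R%:E * c g j.
Proof.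
move=> hg; apply: le_trans (annulus_L1_le j p1 hg) _.
by rewrite /c muleA -EFinM -pow2D mulrDl mul1r addrC.
Qed.

(** The time is written 2^(2s), so that 2^s = sqrt(t). If k <= s, the global bound t^(-n/2) is used;
    otherwise the annuli are distant and the kernel is at most a constant times 2^(-nk). In both
    cases the bound is 2^(-n max(k,s)), free of j, and the weighted norm [c g j] already controls
    the L^1 norm of the source. *)
Let smoothing_far s g (k j : int) : ge0_mfun g ->
  (2 <= `|k - j|)%R || (k%:~R <= s)%R ->
  (2 `^ (k%:~R * al))%R%:E * annulus_Lp q k
    (ge0_heat (2 `^ (2 * s))%R (fun y => g y * (\1_(dyadic_annulus j) y)%:E)) <=
  (C * 2 `^ (s * (delta - n%:R)) * 2 `^ (- (e * `|k%:~R - s|)))%R%:E * c g j.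
Proof.
move=> hg h; have t0 : (0 < 2 `^ (2 * s) :> R)%R by exact: pow2_gt0.
pose ka : R := (Cn * 2 `^ (- (n%:R * Num.max k%:~R s)))%R.
have ka0 : (0 <= ka)%R by rewrite mulr_ge0 ?powR_ge0.
have kas (z : V) : (heat_kernel (2 `^ (2 * s)) z <= 2 `^ (- (n%:R * s)))%R.
  apply: le_trans (heat_kernel_le_pow z t0) _.
  rewrite -powRrM (_ : (2 * s * - (n%:R / 2) = - (n%:R * s))%R)//.
  by field.
have hka x y : dyadic_annulus k x -> dyadic_annulus j y ->
    (heat_kernel (2 `^ (2 * s)) (x - y) <= ka)%R.
  move=> xk yj; rewrite /ka; have [ks|sk] := leP k%:~R s.
    by apply: le_trans (kas _) _; rewrite ler_peMl ?powR_ge0.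
  have {}h : (2 <= `|k - j|)%R by case/orP: h => // /(lt_le_trans sk); rewrite ltxx.
  apply: le_trans (heat_kernel_annulus_le t0 xk yj h) _.
  rewrite ler_wpM2l// pow2_le lerN2 ler_wpM2l// ler_int.
  by rewrite le_max lexx.
have := annulus_Lp_heat_kernel_le q1 ka0 hg hka.
have w0 : 0 <= (2 `^ (k%:~R * al))%R%:E by rewrite lee_fin powR_ge0.
move=> /(lee_wpmul2l w0)/le_trans; apply; rewrite muleA -EFinM.
apply: (@le_trans _ _ ((2 `^ (k%:~R * al) * (ka * 2 `^ ((k%:~R + 1) * (n%:R / q))))%R%:E
    * ((2 `^ al')%R%:E * c g j))).
  by apply: lee_wpmul2l; [rewrite lee_fin !mulr_ge0 ?powR_ge0|exact: L1c].
rewrite muleA -EFinM; apply: lee_wpmul2r => //; rewrite lee_fin /ka.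
have assoc (A x y z w : R) : (x * (A * y * z) * w = A * (x * y * z * w))%R by ring.
rewrite assoc -!pow2D -mulrA -pow2D.
apply: (@le_trans _ _ (Cn * 2 `^ (n%:R / q + al') *
    2 `^ (s * (delta - n%:R) - e * `|k%:~R - s|))%R); last first.
  by rewrite ler_wpM2r ?powR_ge0// lerDl powR_ge0.
rewrite -mulrA -pow2D ler_wpM2l// pow2_le /al.
have ed : (e <= delta)%R by rewrite ge_min lexx.
have en : (e <= n%:R - delta)%R by rewrite ge_min lexx orbT.
have [ks|sk] := leP k%:~R s.
  rewrite ler0_norm ?subr_le0// opprB.
  rewrite -subr_ge0 (_ : (_ - _)%R = ((delta - e) * (s - k%:~R))%R).
    by rewrite mulr_ge0 ?subr_ge0.
  by field; rewrite gt_eqF.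
rewrite gtr0_norm ?subr_gt0//.
rewrite -subr_ge0 (_ : (_ - _)%R = ((n%:R - delta - e) * (k%:~R - s))%R).
  by rewrite mulr_ge0 ?subr_ge0// ltW.
by field; rewrite gt_eqF.
Qed.

(** Beyond the scale sqrt(t), and between equal or adjacent annuli, the L^q norm is interpolated
    between contraction in L^p and the bound of the supremum by t^(-n/2) times the L^1 norm, with
    p/q = [sg]. *)
Let smoothing_near s g (k j : int) : ge0_mfun g ->
  (`|k - j| < 2)%R -> (s < k%:~R)%R ->
  (2 `^ (k%:~R * al))%R%:E * annulus_Lp q k
    (ge0_heat (2 `^ (2 * s))%R (fun y => g y * (\1_(dyadic_annulus j) y)%:E)) <=
  (C * 2 `^ (s * (delta - n%:R)) * 2 `^ (- (e * `|k - j|%:~R)))%R%:E * c g j.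
Proof.
move=> hg near sk; have t0 : (0 < 2 `^ (2 * s) :> R)%R by exact: pow2_gt0.
have near1 : (`|k - j|%:~R <= 1 :> R)%R.
  by rewrite -[1%R]/(1%:~R) ler_int -ltzD1.
have hgj := ge0_mfun_annulus j hg.
set h := fun y => _.
have w0 : 0 <= (2 `^ (k%:~R * al))%R%:E by rewrite lee_fin powR_ge0.
pose S := (2 `^ (al' - s * n%:R))%R%:E * c g j.
have S0 : 0 <= S by rewrite mule_ge0// lee_fin powR_ge0.
have hS x : ge0_heat (2 `^ (2 * s))%R h x <= S.
  apply: le_trans (@ge0_heat_le_sup _ h x (2 `^ (- (s * n%:R)))%R (powR_ge0 _ _) hgj _) _.
    move=> y _; apply: le_trans (heat_kernel_le_pow _ t0) _.
    rewrite -powRrM (_ : (2 * s * - (n%:R / 2) = - (s * n%:R))%R)//.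
    by field.
  rewrite -(eLp1 mu hgj.2) /S addrC pow2D EFinM -muleA.
  by apply: lee_wpmul2l; [rewrite lee_fin powR_ge0|exact: L1c].
have hp : eLp mu p (ge0_heat (2 `^ (2 * s))%R h) <= (2 `^ (- (j%:~R * al')))%R%:E * c g j.
  apply: le_trans (eLp_heat_le p1 t0 hgj) _.
  by rewrite /c muleA -EFinM -pow2D addNr powRr0 mul1e.
have hq : eLp mu q (ge0_heat (2 `^ (2 * s))%R h) <=
    (2 `^ ((al' - s * n%:R) * (1 - sg) - j%:~R * al' * sg))%R%:E * c g j.
  apply: le_trans (eLp_interpolation p0 pq (ge0_mfun_heat _ hgj) S0 hS) _.
  have pqE : (p / q = sg)%R by rewrite /p mulrAC mulfV ?mul1r// gt_eqF.
  rewrite pqE.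
  apply: (@le_trans _ _ (S `^ (1 - sg) * ((2 `^ (- (j%:~R * al')))%R%:E * c g j) `^ sg)).
    apply: lee_wpmul2l; first exact: poweR_ge0.
    by apply: lee_poweR => //; [exact: ltW|exact: eLp_ge0].
  have pM (x r : R) : ((2 `^ x)%R%:E * c g j) `^ r = (2 `^ (x * r))%R%:E * c g j `^ r.
    by rewrite (@poweRM _ (2 `^ x)%R%:E (c g j)) ?lee_fin ?powR_ge0// poweR_EFin -powRrM.
  rewrite /S !pM muleACA -EFinM -pow2D.
  rewrite -poweRD; last by rewrite /poweRD_def subrK oner_eq0.
  by rewrite subrK poweRe1// mulNr.
apply: (le_trans (lee_wpmul2l w0 (annulus_Lp_le_eLp k q0 (ge0_mfun_heat _ hgj)))).
apply: (le_trans (lee_wpmul2l w0 hq)).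
rewrite muleA -EFinM; apply: lee_wpmul2r => //; rewrite lee_fin -pow2D.
apply: (@le_trans _ _ (2 `^ (al' + e) * 2 `^ (s * (delta - n%:R)) *
    2 `^ (- (e * `|k - j|%:~R)))%R); last first.
  rewrite ler_wpM2r ?powR_ge0// ler_wpM2r ?powR_ge0// lerDr.
  by rewrite mulr_ge0 ?powR_ge0.
rewrite -!pow2D pow2_le.
have h1 : (e * `|k - j|%:~R <= e)%R by rewrite ler_piMr// ltW.
have asg : (0 <= al' * sg)%R by exact: mulr_ge0 al'0 (ltW sg0).
have h2 : ((k%:~R - j%:~R) * (al' * sg) <= al' * sg)%R.
  apply: le_trans (ler_norm _) _.
  rewrite normrM (ger0_norm asg) ler_piMl//.
  by rewrite -intrB -intr_norm.
(* Here gamma enters: after interpolation the weights differ by 2^(-k gamma sg), and k > s turns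
   this into the power of t still missing. *)
have h3 : (al - al' * sg = - (gamma * sg))%R.
  rewrite /al /al' /delta /p; field.
  by rewrite !gt_eqF.
have h4 : (s * (gamma * sg) <= k%:~R * (gamma * sg))%R.
  by rewrite ler_wpM2r ?mulr_ge0// ltW.
have h5 : (k%:~R * al = k%:~R * (al' * sg) - k%:~R * (gamma * sg))%R.
  by rewrite -mulrBr -h3; congr (_ * _)%R; ring.
rewrite h5 /delta.
suff : (0 <= (al' * sg - (k%:~R - j%:~R) * (al' * sg)) +
   (k%:~R * (gamma * sg) - s * (gamma * sg)) + (e - e * `|k - j|%:~R))%R.
  by lra.
by apply: addr_ge0; [apply: addr_ge0|]; rewrite subr_ge0.
Qed.

(** The bound for distant annuli is a product of a summable function of k and of [c g j]; the one
    for neighbours is a convolution. Both sums over k are bounded independently of s. *)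
Lemma ge0_herz_heat_smoothing : exists2 K : R, (0 < K)%R & forall t g, (0 < t)%R ->
  ge0_mfun g -> ge0_herz al q (ge0_heat t g) <=
  (K * t `^ (- ((n%:R - delta) / 2)))%R%:E * ge0_herz al' p g.
Proof.
pose G := \esum_(k in [set: int]) (2 `^ (- (e * `|k|%:~R)))%R%:E.
have Gfin : G < +oo by exact: esum_int_geometric.
have G0 : 0 <= G by apply: esum_ge0 => k _; rewrite lee_fin powR_ge0.
exists (C * (2 `^ e * fine G + fine G) + 1)%R.
  rewrite ltr_wpDl// mulr_ge0 ?(ltW C0)// addr_ge0 ?mulr_ge0 ?powR_ge0//.
    exact: fine_ge0.
  exact: fine_ge0.
move=> t g t0 hg.
pose s : R := (ln t / ln 2 / 2)%R.
have ln2 : (0 < ln 2 :> R)%R by rewrite ln_gt0// ltr1n.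
have tE : (t = 2 `^ (2 * s))%R.
  rewrite /powR pnatr_eq0/= /s (_ : (2 * _ * ln 2 = ln t)%R) ?lnK ?posrE//.
  by field; rewrite gt_eqF.
have tth : (t `^ (- ((n%:R - delta) / 2)) = 2 `^ (s * (delta - n%:R)))%R.
  by rewrite tE -powRrM; congr (_ `^ _)%R; field.
rewrite tth {1}tE.
set B : R := (C * 2 `^ (s * (delta - n%:R)))%R.
have B0 : (0 <= B)%R by rewrite mulr_ge0 ?powR_ge0// ltW.
have pow0 (x : R) : 0 <= (2 `^ x)%R%:E :> \bar R by rewrite lee_fin powR_ge0.
have step k : (2 `^ (k%:~R * al))%R%:E * annulus_Lp q k (ge0_heat (2 `^ (2 * s))%R g) <=
    \esum_(j in [set: int]) (B%:E * ((2 `^ (- (e * `|k%:~R - s|)))%R%:E * c g j +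
      (2 `^ (- (e * `|k - j|%:~R)))%R%:E * c g j)).
  apply: annulus_Lp_heat_le => // j.
  have [h|] := boolP ((2 <= `|k - j|)%R || (k%:~R <= s)%R).
    apply: le_trans (smoothing_far hg h) _; rewrite -/B EFinM -muleA.
    by rewrite lee_wpmul2l ?lee_fin// leeDl// mule_ge0.
  rewrite negb_or -!ltNge => /andP[h1 h2].
  apply: le_trans (smoothing_near hg h1 h2) _; rewrite -/B EFinM -muleA.
  by rewrite lee_wpmul2l ?lee_fin// leeDr// mule_ge0.
have sumc0 : 0 <= \esum_(j in [set: int]) c g j by exact: esum_ge0.
have Gs : \esum_(k in [set: int]) (2 `^ (- (e * `|k%:~R - s|)))%R%:E <= (2 `^ e)%R%:E * G.
  (* The scale s is real while the annuli are indexed by integers; shifting by the integer part of s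
     costs the factor 2^e. *)
  pose m := Num.floor s.
  rewrite -(esum_int_shift _ m) -esum_intZl//.
  apply: le_esum => k _; rewrite -EFinM -pow2D lee_fin pow2_le.
  have h : (`|k|%:~R <= `|(k + m)%:~R - s| + 1 :> R)%R.
    rewrite intr_norm (_ : k%:~R = ((k + m)%:~R - s) + (s - m%:~R) :> R)%R.
      rewrite (le_trans (ler_normD _ _))// lerD2l.
      have /andP[h1 h2] := floor_itv s; rewrite intrD in h2.
      by rewrite ger0_norm ?subr_ge0// lerBlDr addrC ltW.
    by rewrite intrD; ring.
  by have := ler_wpM2l (ltW e0) h; lra.
apply: (@le_trans _ _ (B%:E * (((2 `^ e)%R%:E * G + G) * \esum_(j in [set: int]) c g j))).
  apply: (le_trans (le_esum (fun k _ => step k))).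
  have inner k : \esum_(j in [set: int]) (B%:E * ((2 `^ (- (e * `|k%:~R - s|)))%R%:E * c g j +
      (2 `^ (- (e * `|k - j|%:~R)))%R%:E * c g j)) =
    B%:E * ((2 `^ (- (e * `|k%:~R - s|)))%R%:E * (\esum_(j in [set: int]) c g j) +
      \esum_(j in [set: int]) ((2 `^ (- (e * `|k - j|%:~R)))%R%:E * c g j)).
    rewrite esum_intZl ?lee_fin//; last by move=> j; rewrite adde_ge0// mule_ge0.
    rewrite esumD; [|by move=> j _; rewrite mule_ge0..].
    by rewrite esum_intZl.
  rewrite (eq_esum (fun k _ => inner k)) esum_intZl ?lee_fin//; last first.
    move=> k; rewrite adde_ge0 ?mule_ge0//.
    by apply: esum_ge0 => j _; rewrite mule_ge0.
  apply: lee_wpmul2l; first by rewrite lee_fin.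
  rewrite esumD; last 2 first.
  - by move=> k _; rewrite mule_ge0.
  - by move=> k _; apply: esum_ge0 => j _; rewrite mule_ge0.
  rewrite ge0_muleDl ?mule_ge0//; apply: leeD.
    under eq_esum do rewrite muleC.
    by rewrite esum_intZl// muleC lee_wpmul2r.
  by rewrite (@esum_int_convolution _ (fun k => (2 `^ (- (e * `|k|%:~R)))%R%:E)).
rewrite muleA; apply: lee_wpmul2r => //.
have GE : G = (fine G)%:E by rewrite fineK// ge0_fin_numE.
rewrite {1 2}GE -[leLHS]/((B * (2 `^ e * fine G + fine G))%R%:E) lee_fin /B mulrAC.
by rewrite ler_wpM2r ?powR_ge0// lerDl.
Qed.

End smoothing.

End heat_semigroup_ge0.

(** * Integrals of real-valued functions and Fubini's theorem *)

Section Rintegral_lemmas.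
Context d (T : measurableType d) (R : realType) (mu : {measure set T -> \bar R}).

Lemma normr_Rintegral_le (D : set T) (f : T -> R) : measurable D ->
  measurable_fun D f ->
  (`|\int[mu]_(x in D) f x|%:E <= \int[mu]_(x in D) `|f x|%:E)%E.
Proof.
move=> mD mf; have := @le_abse_integral _ _ _ mu D (EFin \o f) mD.
have mf' : measurable_fun D (EFin \o f) by exact/measurable_EFinP.
move=> /(_ mf'); apply: le_trans.
by rewrite /Rintegral; case: (integral _ _ _) => [r| |] //=; rewrite leey.
Qed.

Lemma ae_eq_Rintegral (D : set T) (f g : T -> R) : measurable D ->
  measurable_fun D f -> measurable_fun D g ->
  (\forall x \ae mu, D x -> f x = g x) ->
  \int[mu]_(x in D) f x = \int[mu]_(x in D) g x.
Proof.
move=> mD mf mg fg; congr fine; apply: ae_eq_integral => //.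
- exact/measurable_EFinP.
- exact/measurable_EFinP.
- by apply: filterS fg => x fg /fg ->.
Qed.

(** Tonelli's theorem for the positive and the negative part separately. This also covers the points
    where the integral diverges and [fine] returns a default value. *)
Lemma measurable_Rintegral_param d2 (T2 : measurableType d2)
    (nu : {sigma_finite_measure set T2 -> \bar R}) (F : T * T2 -> R) :
  measurable_fun setT F -> measurable_fun setT (fun x => \int[nu]_y F (x, y)).
Proof.
move=> mF; have mF' : measurable_fun setT (EFin \o F) by exact/measurable_EFinP.
apply: (measurableT_comp (fine_measurable _)) => //.
rewrite (_ : (fun x => _) = (fun x =>
  \int[nu]_y ((EFin \o F)^\+ (x, y)) - \int[nu]_y ((EFin \o F)^\- (x, y)))%E).
  apply: emeasurable_funB.
    apply: (measurable_fun_fubini_tonelli_F (m2 := nu) ((EFin \o F)^\+)%E) => //.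
    exact: measurable_funepos.
  apply: (measurable_fun_fubini_tonelli_F (m2 := nu) ((EFin \o F)^\-)%E) => //.
  exact: measurable_funeneg.
apply/funext => x; rewrite -[LHS]/(\int[nu]_y (EFin \o F) (x, y))%E.
by rewrite [LHS]integralE; congr (_ - _)%E; apply: eq_integral => y _;
  rewrite ?funeposE ?funenegE.
Qed.

Lemma ge0_le_integralT (f g : T -> \bar R) : (forall x, 0 <= f x)%E ->
  (forall x, f x <= g x)%E -> (\int[mu]_x f x <= \int[mu]_x g x)%E.
Proof.
move=> f0 fg; rewrite !ge0_integralTE// => [|x]; last exact: le_trans (fg x).
apply: le_ereal_sup => _ [h /= hf <-]; exists h => // x.
exact: le_trans (hf x) (fg x).
Qed.

End Rintegral_lemmas.

Section Rintegral_exchange.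
Context d (T : measurableType d) (R : realType).

(** Inner integrals may be infinite on a null set, where their real-valued versions take a default
    value; outside it they agree with the integrals of Fubini's theorem. *)
Lemma Rintegral_exchange d2 (T2 : measurableType d2)
    (m1 : {sigma_finite_measure set T -> \bar R})
    (m2 : {sigma_finite_measure set T2 -> \bar R}) (F : T * T2 -> R) :
  measurable_fun setT F ->
  (\int[m1]_x \int[m2]_y `|F (x, y)|%:E < +oo)%E ->
  \int[m1]_x \int[m2]_y F (x, y) = \int[m2]_y \int[m1]_x F (x, y).
Proof.
move=> mF Ffin; have mF' : measurable_fun setT (EFin \o F) by exact/measurable_EFinP.
have iF := (integrable12ltyP m1 m2 mF').2 Ffin.
have swap : measurable_fun setT (fun z : T2 * T => F (z.2, z.1)).
  apply: (measurableT_comp mF); apply/measurable_fun_pairP; split.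
    exact: measurable_snd.
  exact: measurable_fst.
have iG : (m2 \x m1)%E.-integrable setT (EFin \o (fun z : T2 * T => F (z.2, z.1))).
  have swap' : measurable_fun setT (EFin \o (fun z : T2 * T => F (z.2, z.1))).
    exact/measurable_EFinP.
  apply/(integrable12ltyP m2 m1 swap') => /=.
  rewrite -(fubini_tonelli (m1 := m1) (m2 := m2) (fun z => `|F z|%:E))//.
  by apply/measurable_EFinP; exact: measurableT_comp.
rewrite /Rintegral; congr fine.
transitivity (\int[m1]_x fubini_F m2 (EFin \o F) x)%E.
  apply: ae_eq_integral => //.
  - by apply/measurable_EFinP; exact: measurable_Rintegral_param.
  - exact: measurable_fubini_F iF.
  - by apply: filterS (integrable_ae measurableT (integrable_fubini_F iF)) => x /(_ I) h _;
      rewrite fineK.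
transitivity (\int[m2]_y fubini_G m1 (EFin \o F) y)%E; first exact: Fubini.
apply: ae_eq_integral => //.
- exact: (measurable_fubini_F iG).
- apply/measurable_EFinP.
  exact: (@measurable_Rintegral_param _ _ R _ _ m1 (fun z => F (z.2, z.1))).
- by apply: filterS (integrable_ae measurableT (integrable_fubini_F iG)) => x /(_ I) h _;
    rewrite fineK.
Qed.

End Rintegral_exchange.

Section absf.
Context d (T : measurableType d) (R : realType).
Implicit Types f g : T -> R.

Definition absf f (x : T) : \bar R := `|f x|%:E.

Lemma ge0_mfun_absf f : measurable_fun setT f -> ge0_mfun (absf f).
Proof. exact: ge0_mfun_abs. Qed.

Lemma absfD_le f g x : (absf (fun x => f x + g x)%R x <= absf f x + absf g x)%E.
Proof. by rewrite /absf -EFinD lee_fin ler_normD. Qed.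

Lemma absfB_le f g x : (absf (fun x => f x - g x)%R x <= absf f x + absf g x)%E.
Proof. by rewrite /absf -EFinD lee_fin ler_normB. Qed.

End absf.

(** * The Herz seminorm and the heat semigroup on real-valued functions *)

Section herz_real.
Context {R : realType} {n : nat}.
Local Notation V := 'rV[R]_n.
Local Notation mu := (@lebesgue_rV R n).
Implicit Types (al p q : R) (f g h : V -> R) (x y : V).

(* Sealed: comparing two Herz seminorms by unfolding them is prohibitive. *)
Fact Herz_key : unit. Proof. exact: tt. Qed.
Definition Herz : R -> R -> (V -> R) -> \bar R :=
  locked_with Herz_key (fun al p f => ge0_herz al p (absf f)).

Lemma HerzE al p f : Herz al p f = ge0_herz al p (absf f).
Proof. by rewrite /Herz; case: Herz_key. Qed.

Lemma Herz_ge0 al p f : (0 <= Herz al p f)%E.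
Proof. by rewrite HerzE; exact: ge0_herz_ge0. Qed.

Lemma herz_normE al p f : herz_norm al p%:E 1%:E f = Herz al p f.
Proof.
rewrite HerzE /herz_norm invr1 poweRe1; last first.
  apply: esum_ge0 => k _; rewrite mule_ge0 ?poweR_ge0// lee_fin powR_ge0//.
apply: eq_esum => k _; rewrite mulr1 poweRe1; last exact: Lnorm_ge0.
congr (_ * _)%E; rewrite /Lnorm_on LnormE; congr eLp.
apply/funext => x /=; rewrite normrM EFinM; congr (_ * _)%E.
by rewrite indicE; case: (_ \in _); rewrite ?normr1 ?normr0.
Qed.

Lemma HerzD al p f g : 1 <= p -> measurable_fun setT f -> measurable_fun setT g ->
  (Herz al p (fun x => f x + g x)%R <= Herz al p f + Herz al p g)%E.
Proof.
move=> p1 mf mg; have p0 : 0 < p by exact: lt_le_trans p1.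
have hf := ge0_mfun_absf mf; have hg := ge0_mfun_absf mg.
rewrite !HerzE; apply: le_trans (ge0_herzD al p1 hf hg); apply: ge0_herz_le => //.
- by apply: ge0_mfun_absf; exact: measurable_funD.
- exact: ge0_mfunD.
- by apply: aeW => x; exact: absfD_le.
Qed.

Lemma HerzB al p f g : 1 <= p -> measurable_fun setT f -> measurable_fun setT g ->
  (Herz al p (fun x => f x - g x)%R <= Herz al p f + Herz al p g)%E.
Proof.
move=> p1 mf mg; have p0 : 0 < p by exact: lt_le_trans p1.
have hf := ge0_mfun_absf mf; have hg := ge0_mfun_absf mg.
rewrite !HerzE; apply: le_trans (ge0_herzD al p1 hf hg); apply: ge0_herz_le => //.
- by apply: ge0_mfun_absf; exact: measurable_funB.
- exact: ge0_mfunD.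
- by apply: aeW => x; exact: absfB_le.
Qed.

Lemma HerzZ al p (c : R) f : 0 < p -> measurable_fun setT f ->
  Herz al p (fun x => c * f x) = (`|c|%:E * Herz al p f)%E.
Proof.
move=> p0 mf; have hf := ge0_mfun_absf mf.
have c0 : (0 <= `|c|%:E :> \bar R)%E by rewrite lee_fin.
rewrite !HerzE -(ge0_herzZ al p0 hf c0).
by congr ge0_herz; apply/funext => x; rewrite /absf normrM EFinM.
Qed.

Lemma HerzBC al p f g :
  Herz al p (fun x => f x - g x) = Herz al p (fun x => g x - f x).
Proof. by rewrite !HerzE; congr ge0_herz; apply/funext => x; rewrite /absf distrC. Qed.

Lemma Herz_ae_eq al p f g : 0 < p -> measurable_fun setT f -> measurable_fun setT g ->
  (\forall x \ae mu, f x = g x) -> Herz al p f = Herz al p g.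
Proof.
move=> p0 mf mg fg; rewrite !HerzE; apply: ge0_herz_ae_eq => //; try exact: ge0_mfun_absf.
by apply: filterS fg => x; rewrite /absf => ->.
Qed.

Lemma Herz_eq0 al p f : (0 < n)%N -> 0 < p -> measurable_fun setT f ->
  Herz al p f = 0%E -> \forall x \ae mu, f x = 0.
Proof.
move=> n0 p0 mf; rewrite HerzE => h; have := ge0_herz_eq0 n0 p0 (ge0_mfun_absf mf) h.
apply: filterS => x; rewrite /absf => -[].
by move/eqP; rewrite normr_eq0 => /eqP.
Qed.

Lemma Herz_le_ge0 al p f (g : V -> \bar R) : 0 < p -> measurable_fun setT f ->
  ge0_mfun g -> (\forall x \ae mu, absf f x <= g x)%E -> (Herz al p f <= ge0_herz al p g)%E.
Proof. by move=> p0 mf hg fg; rewrite HerzE; apply: ge0_herz_le => //; exact: ge0_mfun_absf. Qed.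

Lemma eucl_norm_continuous : continuous (@eucl_norm R n).
Proof.
move=> x; rewrite /eucl_norm.
apply: (@continuous_comp _ _ _ (fun x : V => \sum_(i < n) x ord0 i ^+ 2) Num.sqrt).
  rewrite (_ : (fun _ => _) = \sum_(i < n) (fun y : V => y ord0 i ^+ 2)); last first.
    by apply/funext => y; rewrite fct_sumE.
  apply: (big_ind (fun g : V -> R => {for x, continuous g})) => [|f g cf cg|i _].
  - exact: cst_continuous.
  - exact: continuousD.
  apply: (@continuous_comp _ _ _ (fun x : V => x ord0 i) (fun r => r ^+ 2)).
    exact: coord_continuous.
  exact: exprn_continuous.
exact: sqrt_continuous.
Qed.

(** The image of [K] under the Euclidean norm is a compact set of reals that misses 0, hence it lies
    between two powers of two. *)
Lemma compact_annuli (K : set V) : compact K -> K `<=` ~` [set 0] ->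
  exists N : nat, forall k x, K x -> dyadic_annulus k x -> (`|k| <= N%:Z)%R.
Proof.
move=> cK K0.
have cnK : compact (@eucl_norm R n @` K).
  by apply: continuous_compact => //; exact/continuous_subspaceT/eucl_norm_continuous.
have [M [_ hM]] := compact_bounded cnK.
have clK : closed (@eucl_norm R n @` K) by exact: compact_closed.
have n0K : ~ (@eucl_norm R n @` K) 0.
  by move=> [x Kx /eucl_norm0_eq0 x0]; have := K0 x Kx; apply.
have : nbhs (0 : R) (~` (@eucl_norm R n @` K)).
  by apply: open_nbhs_nbhs; split => //; exact: closed_openC.
move=> /nbhs_ballP[r /= r0 hr].
have upper x : K x -> eucl_norm x <= `|M| + 1.
  move=> Kx; have M1 : M < `|M| + 1 by rewrite (le_lt_trans (ler_norm M))// ltrDl.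
  have := hM _ M1 (eucl_norm x) (ex_intro2 _ _ x Kx erefl).
  by rewrite /= ger0_norm ?eucl_norm_ge0.
have lower x : K x -> r <= eucl_norm x.
  move=> Kx; rewrite leNgt; apply/negP => xr.
  apply: (hr (eucl_norm x)); last by exists x.
  by rewrite /ball /= sub0r normrN ger0_norm ?eucl_norm_ge0.
have [k1 /andP[_ hk1]] := @dyadic_bracket R (`|M| + 1) (ltr_wpDl (normr_ge0 _) ltr01).
have [k0 /andP[hk0 _]] := dyadic_bracket r0.
exists (`|k0| + `|k1|)%N => k x Kx /dyadic_annulusE/andP[h1 h2].
have kk1 : k <= k1.
  have := le_lt_trans (le_trans h1 (upper x Kx)) hk1.
  by rewrite pow2_lt ltrBlDr -[1]/(1%:~R) -intrD ltr_int ltzD1.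
have kk0 : k0 <= k.
  have := le_lt_trans (le_trans hk0 (lower x Kx)) h2.
  by rewrite pow2_lt ltrBlDr -[1]/(1%:~R) -intrD ltr_int ltzD1.
lia.
Qed.

(** A compact set away from 0 meets finitely many annuli, on which the weights are bounded below; so
    |f| on it is at most a constant times the weighted series of its restrictions. Membership in the
    space thus reduces to measurability and a finite seminorm. *)
Lemma Lp_loc_away0_Herz al q f : 1 <= q -> measurable_fun setT f ->
  (Herz al q f < +oo)%E -> Lp_loc_away0 q%:E f.
Proof.
move=> q1 mf fin; split=> // K cK K0; have q0 : 0 < q by exact: lt_le_trans q1.
have [N hN] := compact_annuli cK K0.
pose w k : \bar R := (2 `^ (k%:~R * al))%:E.
have w0 k : (0 <= w k)%E by rewrite lee_fin powR_ge0.
(* The inverse of a lower bound for the weights 2^(k al) with |k| <= N. *)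
pose c : \bar R := (2 `^ (N%:R * `|al|))%:E.
have c0 : (0 <= c)%E by rewrite lee_fin powR_ge0.
have hf := ge0_mfun_absf mf.
pose g i x : \bar R := (w (int_of_nat i) * (absf f x * (\1_(dyadic_annulus (int_of_nat i)) x)%:E))%E.
have hg i : ge0_mfun (g i).
  by apply: ge0_mfunM; [exact: ge0_mfun_cst|exact: ge0_mfun_annulus].
have hG := ge0_mfun_nneseries hg.
apply: (@le_lt_trans _ _ (eLp mu q (fun x => c * \sum_(i <oo) g i x)%E)).
  rewrite /Lnorm_on LnormE; apply: lee_poweR; first by rewrite invr_ge0 ltW.
    by apply: integral_ge0 => x _; exact: poweR_ge0.
  apply: ge0_le_integralT => x; first exact: poweR_ge0.
  apply: lee_poweR; [exact: ltW|exact: abse_ge0|].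
  have [xK|xK] := pselect (K x); last first.
    by rewrite /= indicE memNset// mulr0 normr0 mule_ge0// hG.2.
  have : (\bigcup_k @dyadic_annulus R n k) x.
    by rewrite bigcup_dyadic_annulus; apply/eqP => x0; exact: K0 x xK x0.
  move=> [k _ xk]; have [_ _ /(_ k I)[i _ ik]] := int_of_nat_bij.
  apply: (@le_trans _ _ (c * g i x)%E); last first.
    apply: lee_wpmul2l => //; rewrite nneseries_esumT => [|m]; last exact: (hg m).2.
    by apply: esum_ge; exists [set i]; [split|rewrite fsbig_set1].
  rewrite /g ik indicE mem_set// mule1 /= indicE mem_set// mulr1 muleA.
  rewrite -[leLHS]mul1e; apply: lee_wpmul2r; first by rewrite /absf lee_fin.
  have -> : (c * w k = (2 `^ (N%:R * `|al| + k%:~R * al))%:E)%E by rewrite pow2D.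
  rewrite -[1%E]/(1%:E) -[X in X%:E](powRr0 (2 : R)) lee_fin pow2_le.
  have : `|k%:~R : R| <= N%:R.
    by rewrite -intr_norm (_ : N%:R = (N%:Z)%:~R)// ler_int; exact: hN xK xk.
  move=> kN; have := ler_wpM2r (normr_ge0 al) kN; rewrite -normrM => h.
  by have := ler_norm (- (k%:~R * al)); rewrite normrN; lra.
rewrite eLpZ//; [|exact: hG.1|exact: hG.2].
rewrite lte_mul_pinfty//; apply: le_lt_trans (eLp_nneseries mu q1 hg) _.
rewrite (le_lt_trans _ fin)//; rewrite HerzE /ge0_herz esum_intE => [|k]; last first.
  by rewrite mule_ge0// annulus_Lp_ge0.
apply: lee_nneseries => i *; first exact: eLp_ge0.
have hgi := ge0_mfun_annulus (int_of_nat i) hf.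
by rewrite /g eLpZ//; [exact: hgi.1|exact: hgi.2].
Qed.

Lemma herzP al q f : 1 <= q ->
  herz al q%:E 1%:E f <-> measurable_fun setT f /\ (Herz al q f < +oo)%E.
Proof.
move=> q1; split=> [[[mf _]]|[mf fin]]; first by rewrite herz_normE.
by split; [exact: Lp_loc_away0_Herz fin|rewrite herz_normE].
Qed.

Section real_heat.
Implicit Types (s t : R).

Let mhk t x f : measurable_fun setT f ->
  measurable_fun setT (fun y => heat_kernel t (x - y) * f y).
Proof.
move=> mf; apply: measurable_funM => //.
by apply/measurable_EFinP; exact: measurable_heat_kernel_sub.
Qed.

Lemma ge0_heat_absf t f x :
  ge0_heat t (absf f) x = (\int[mu]_y `|(heat_kernel t (x - y) * f y)%:E|)%E.
Proof.
apply: eq_integral => y _.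
by rewrite /absf -EFinM /= normrM (ger0_norm (heat_kernel_ge0 _ _)).
Qed.

Lemma heat_integrable t f x : measurable_fun setT f ->
  (ge0_heat t (absf f) x < +oo)%E ->
  mu.-integrable setT (fun y => (heat_kernel t (x - y) * f y)%:E).
Proof.
move=> mf h; apply/integrableP; split; last by rewrite -ge0_heat_absf.
by apply/measurable_EFinP; exact: mhk.
Qed.

Lemma heatE t f x : 0 < t -> heat t f x = \int[mu]_y (heat_kernel t (x - y) * f y).
Proof. by move=> t0; rewrite /heat gt_eqF. Qed.

Lemma measurable_heat t f : measurable_fun setT f -> measurable_fun setT (heat t f).
Proof.
move=> mf; rewrite /heat; case: (t == 0) => //.
apply: (@measurable_Rintegral_param _ _ R _ _ mu
  (fun z : V * V => heat_kernel t (z.1 - z.2) * f z.2)).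
apply: measurable_funM; last exact: (measurableT_comp mf measurable_snd).
apply: (measurableT_comp (measurable_heat_kernel t)).
by apply: measurable_rV_sub; [exact: measurable_fst|exact: measurable_snd].
Qed.

Lemma absf_heat_le t f x : 0 < t -> measurable_fun setT f ->
  (absf (heat t f) x <= ge0_heat t (absf f) x)%E.
Proof.
move=> t0 mf; rewrite /absf heatE// ge0_heat_absf.
exact: (@normr_Rintegral_le _ _ _ mu setT _ measurableT (mhk t x mf)).
Qed.

Lemma heat_ae_eq t f g x : 0 < t -> measurable_fun setT f -> measurable_fun setT g ->
  (\forall y \ae mu, f y = g y) -> heat t f x = heat t g x.
Proof.
move=> t0 mf mg fg; rewrite !heatE//; apply: ae_eq_Rintegral => //; try exact: mhk.
by apply: filterS fg => y ->.
Qed.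

Lemma heatB t f g x : 0 < t -> measurable_fun setT f -> measurable_fun setT g ->
  (ge0_heat t (absf f) x < +oo)%E -> (ge0_heat t (absf g) x < +oo)%E ->
  heat t (fun y => f y - g y) x = heat t f x - heat t g x.
Proof.
move=> t0 mf mg hf hg; rewrite !heatE// -RintegralB//; try exact: heat_integrable.
by apply: eq_Rintegral => y _; rewrite mulrBr.
Qed.

Lemma heatD t f g x : 0 < t -> measurable_fun setT f -> measurable_fun setT g ->
  (ge0_heat t (absf f) x < +oo)%E -> (ge0_heat t (absf g) x < +oo)%E ->
  heat t (fun y => f y + g y) x = heat t f x + heat t g x.
Proof.
move=> t0 mf mg hf hg; rewrite !heatE// -RintegralD//; try exact: heat_integrable.
by apply: eq_Rintegral => y _; rewrite mulrDr.
Qed.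

Lemma heatZ t (c : R) f x : 0 < t -> measurable_fun setT f ->
  (ge0_heat t (absf f) x < +oo)%E ->
  heat t (fun y => c * f y) x = c * heat t f x.
Proof.
move=> t0 mf hf; rewrite !heatE// -RintegralZl//; last exact: heat_integrable.
by apply: eq_Rintegral => y _; rewrite mulrCA.
Qed.

(** Fubini's theorem and the semigroup law of the kernel; the absolute convergence it needs is, by
    [ge0_heat_semigroup], the finiteness assumed at time s + t. *)
Lemma heat_semigroup s t f x : 0 < s -> 0 < t -> measurable_fun setT f ->
  (ge0_heat (s + t) (absf f) x < +oo)%E ->
  heat s (heat t f) x = heat (s + t) f x.
Proof.
move=> s0 t0 mf; have hf := ge0_mfun_absf mf.
rewrite -ge0_heat_semigroup// => fin; rewrite !heatE ?addr_gt0//.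
pose F (z : V * V) : R := heat_kernel s (x - z.1) * (heat_kernel t (z.1 - z.2) * f z.2).
have mF : measurable_fun setT F.
  apply: measurable_funM.
    apply: (measurableT_comp (f := fun y => heat_kernel s (x - y)) _ measurable_fst).
    by apply/measurable_EFinP; exact: measurable_heat_kernel_sub.
  apply: measurable_funM; last exact: (measurableT_comp mf measurable_snd).
  apply: (measurableT_comp (measurable_heat_kernel t)).
  by apply: measurable_rV_sub; [exact: measurable_fst|exact: measurable_snd].
have absF y z : `|F (y, z)|%:E =
    ((heat_kernel s (x - y))%:E * ((heat_kernel t (y - z))%:E * absf f z))%E.
  rewrite /F /= /absf -!EFinM normrM (ger0_norm (heat_kernel_ge0 s _)).
  by rewrite normrM (ger0_norm (heat_kernel_ge0 t _)).
have inner y : (\int[mu]_z `|F (y, z)|%:E =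
    (heat_kernel s (x - y))%:E * ge0_heat t (absf f) y)%E.
  under eq_integral do rewrite absF.
  rewrite ge0_integralZl//.
  - exact: (ge0_mfun_heat_kernelM t y hf).1.
  - by move=> z _; exact: (ge0_mfun_heat_kernelM t y hf).2.
  - by rewrite lee_fin heat_kernel_ge0.
have Ffin : (\int[mu]_y \int[mu]_z `|F (y, z)|%:E < +oo)%E.
  by under eq_integral do rewrite inner.
transitivity (\int[mu]_y \int[mu]_z F (y, z)).
  apply: ae_eq_Rintegral => //.
  - exact: mhk (measurable_heat _ mf).
  - exact: (@measurable_Rintegral_param _ _ R _ _ mu F).
  have ifin : mu.-integrable setT
      (fun y => (heat_kernel s (x - y))%:E * ge0_heat t (absf f) y)%E.
    have hm := ge0_mfun_heat_kernelM s x (ge0_mfun_heat t hf).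
    apply/integrableP; split; first exact: hm.1.
    by under eq_integral do rewrite gee0_abs ?hm.2//.
  apply: filterS (integrable_ae measurableT ifin) => y /(_ I) yfin _.
  rewrite heatE// -RintegralZl//; apply: heat_integrable => //.
  move: yfin; have h0 := heat_kernel_gt0 (x - y) s0.
  case: (ge0_heat t (absf f) y) => [r _|/=|]; rewrite ?ltry ?ltNyy//.
  by rewrite gt0_muley ?lte_fin.
rewrite (Rintegral_exchange (m1 := mu) (m2 := mu) mF Ffin).
apply: eq_Rintegral => z _; rewrite /F /=.
rewrite -(_ : \int[mu]_y (heat_kernel s (x - y) * heat_kernel t (y - z)) =
    heat_kernel (s + t) (x - z)); last by rewrite /Rintegral heat_kernel_semigroup.
rewrite -RintegralZr//; first by apply: eq_Rintegral => y _; rewrite mulrA.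
apply/integrableP; split.
  apply/measurable_EFinP; apply: mhk.
  apply: (measurableT_comp (measurable_heat_kernel t)).
  exact: measurable_rV_sub.
under eq_integral => y _.
  rewrite gee0_abs ?lee_fin; last exact: mulr_ge0 (heat_kernel_ge0 _ _) (heat_kernel_ge0 _ _).
  over.
by rewrite heat_kernel_semigroup// ltry.
Qed.

End real_heat.

End herz_real.

(** * Strong continuity of the heat semigroup *)

Section strong_continuity.
Context {R : realType} {n : nat}.
Local Opaque ge0_herz heat ge0_heat heat_kernel lebesgue_rV.
Local Notation V := 'rV[R]_n.
Local Notation mu := (@lebesgue_rV R n).
Variables (al q : R).
Hypotheses (n0 : (0 < n)%N) (q1 : 1 <= q).
Hypotheses (d0 : 0 < al + n%:R / q) (dn : al + n%:R / q < n%:R).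
Implicit Types (f g h : V -> R) (x y : V) (t : R).

Let q0 : 0 < q. Proof. exact: lt_le_trans q1. Qed.
Local Notation H := (Herz al q).

Definition in_Herz f := measurable_fun setT f /\ (H f < +oo)%E.

Lemma in_HerzD f g : in_Herz f -> in_Herz g -> in_Herz (fun x => f x + g x).
Proof.
move=> [mf hf] [mg hg]; split; first exact: measurable_funD.
by apply: le_lt_trans (HerzD al q1 mf mg) _; exact: lte_add_pinfty.
Qed.

Lemma in_HerzB f g : in_Herz f -> in_Herz g -> in_Herz (fun x => f x - g x).
Proof.
move=> [mf hf] [mg hg]; split; first exact: measurable_funB.
by apply: le_lt_trans (HerzB al q1 mf mg) _; exact: lte_add_pinfty.
Qed.

Lemma in_HerzZ (c : R) f : in_Herz f -> in_Herz (fun x => c * f x).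
Proof.
move=> [mf hf]; split; first exact: measurable_funM.
by rewrite HerzZ// lte_mul_pinfty// lee_fin.
Qed.

Lemma Herz_heat_le : exists2 c : R, 0 < c & forall t f, 0 < t ->
  measurable_fun setT f ->
  (ge0_herz al q (ge0_heat t (absf f)) <= c%:E * H f)%E /\
  (H (heat t f) <= c%:E * H f)%E.
Proof.
have [c c0 hc] := ge0_herz_heat_le n0 q1 d0 dn.
exists c => // t f t0 mf; have hf := ge0_mfun_absf mf.
rewrite !HerzE; split; first exact: hc.
rewrite -!HerzE; apply: (@le_trans _ _ (ge0_herz al q (ge0_heat t (absf f)))); last first.
  by rewrite HerzE; exact: hc.
apply: Herz_le_ge0 => //; first exact: measurable_heat.
  exact: ge0_mfun_heat.
by apply: aeW => x; exact: absf_heat_le.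
Qed.

Lemma in_Herz_heat t f : 0 < t -> in_Herz f -> in_Herz (heat t f).
Proof.
move=> t0 [mf hf]; have [c c0 hc] := Herz_heat_le; split.
  exact: measurable_heat.
by apply: le_lt_trans (hc t f t0 mf).2 _; rewrite lte_mul_pinfty// lee_fin ltW.
Qed.

Lemma ge0_heat_lty_ae t f : 0 < t -> in_Herz f ->
  \forall x \ae mu, (ge0_heat t (absf f) x < +oo)%E.
Proof.
move=> t0 [mf hf]; have [c c0 hc] := Herz_heat_le.
apply: (ge0_herz_lty_ae (al := al) n0 q0 (ge0_mfun_heat t (ge0_mfun_absf mf))).
by apply: le_lt_trans (hc t f t0 mf).1 _; rewrite lte_mul_pinfty// lee_fin ltW.
Qed.

(** Continuity at time 0 is tested along sequences, the form in which dominated convergence delivers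
    it. *)
Definition heat_approximable f := in_Herz f /\
  forall t_ : nat -> R, (forall m, 0 < t_ m) -> t_ @ \oo --> 0 ->
    H (fun x => heat (t_ m) f x - f x) @[m --> \oo] --> 0%E.

Let approxB_ae t f g : 0 < t -> in_Herz f -> in_Herz g ->
  \forall x \ae mu, heat t (fun x => f x - g x) x - (f x - g x) =
    (heat t f x - f x) - (heat t g x - g x).
Proof.
move=> t0 hf hg.
apply: filterS2 (ge0_heat_lty_ae t0 hf) (ge0_heat_lty_ae t0 hg) => x fx gx.
by rewrite heatB ?hf.1 ?hg.1//; [ring|exact: hf.1|exact: hg.1].
Qed.

Let mE t f : measurable_fun setT f -> measurable_fun setT (fun x => heat t f x - f x).
Proof. by move=> mf; apply: measurable_funB => //; exact: measurable_heat. Qed.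

Let Herz_ge0' f : (0 <= H f)%E. Proof. exact: Herz_ge0. Qed.

Lemma heat_approximableZ (c : R) f : heat_approximable f ->
  heat_approximable (fun x => c * f x).
Proof.
move=> [hf hE]; split; first exact: in_HerzZ.
move=> t_ t0 tt; have := hE t_ t0 tt.
move=> /(@cvgeZl _ _ _ _ _ `|c|%:E) => /(_ isT); rewrite mule0.
apply: cvg_trans; apply: near_eq_cvg; apply: nearW => m.
rewrite -HerzZ//; last exact: mE hf.1.
apply: Herz_ae_eq => //.
- by apply: measurable_funM => //; exact: mE hf.1.
- by apply: mE; exact: (in_HerzZ c hf).1.
apply: filterS (ge0_heat_lty_ae (t0 m) hf) => x fx.
by rewrite heatZ//; [ring|exact: hf.1].
Qed.

Lemma heat_approximableB f g : heat_approximable f -> heat_approximable g ->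
  heat_approximable (fun x => f x - g x).
Proof.
move=> [hf fE] [hg gE]; split; first exact: in_HerzB.
move=> t_ t0 tt; have fE' := fE t_ t0 tt; have gE' := gE t_ t0 tt.
have := cvgeD (isT : (0%E +? 0%E)%E) fE' gE'; rewrite adde0 => h.
apply: squeeze_cvge (h _); last exact: cvg_cst.
apply: nearW => m; rewrite Herz_ge0'/=.
rewrite (@Herz_ae_eq _ _ _ _ _
  (fun x => (heat (t_ m) f x - f x) - (heat (t_ m) g x - g x)))//.
- by apply: HerzB => //; apply: mE; [exact: hf.1|exact: hg.1].
- by apply: mE; exact: (in_HerzB hf hg).1.
- by apply: measurable_funB; apply: mE; [exact: hf.1|exact: hg.1].
exact: approxB_ae.
Qed.

Lemma heat_approximableD f g : heat_approximable f -> heat_approximable g ->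
  heat_approximable (fun x => f x + g x).
Proof.
move=> hf hg; rewrite (_ : (fun x => _) = (fun x => f x - (-1) * g x)).
  by apply: heat_approximableB => //; exact: heat_approximableZ.
by apply/funext => x; rewrite mulN1r opprK.
Qed.

(** Uniform boundedness of the semigroup: the remainder r = f - g contributes at most (c + 1) times
    its norm, whatever the time. *)
Lemma heat_approximable_limit f : in_Herz f ->
  (forall e : R, 0 < e -> exists2 g, heat_approximable g &
     (H (fun x => f x - g x)%R <= e%:E)%E) ->
  heat_approximable f.
Proof.
move=> hf fg; split=> // t_ t0 tt.
have [c c0 hc] := Herz_heat_le.
apply/cvge0P => // e e0.
have e1 : 0 < e / 2 / (c + 1) by rewrite !divr_gt0// addr_gt0.
have [g [hg gE] fge] := fg _ e1.
have /cvge0P := gE t_ t0 tt => /(_ (fun m => Herz_ge0' _)) /(_ (e / 2)).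
move=> /(_ (divr_gt0 e0 (ltr0n _ 2))); apply: filterS => m hm.
have hfg := in_HerzB hf hg.
pose r := fun x => f x - g x.
rewrite (@Herz_ae_eq _ _ _ _ _
  (fun x => (heat (t_ m) g x - g x) + (heat (t_ m) r x - r x)))//; last 3 first.
- exact: mE hf.1.
- by apply: measurable_funD; apply: mE; [exact: hg.1|exact: hfg.1].
- apply: filterS (approxB_ae (t0 m) hf hg) => x ->.
  by ring.
apply: (le_trans (HerzD _ _ _ _)) => //; [exact: mE hg.1|exact: mE hfg.1|].
have : (H (fun x => heat (t_ m) r x - r x)%R <= (e / 2)%:E)%E.
  apply: (le_trans (HerzB _ _ _ _)) => //; [exact: measurable_heat hfg.1|exact: hfg.1|].
  apply: (@le_trans _ _ ((c + 1)%:E * H r)%E).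
    rewrite EFinD ge0_muleDl ?lee_fin ?(ltW c0)// mul1e.
    by apply: leeD => //; exact: (hc (t_ m) r (t0 m) hfg.1).2.
  apply: (@le_trans _ _ ((c + 1)%:E * (e / 2 / (c + 1))%:E)%E).
    by apply: lee_wpmul2l fge; rewrite lee_fin addr_ge0// ltW.
  by rewrite -EFinM lee_fin mulrC divfK// gt_eqF// addr_gt0.
move=> h; apply: (le_trans (leeD hm h)).
by rewrite -EFinD lee_fin -splitr.
Qed.

Lemma heat_approximable_dominated (f_ : nat -> V -> R) f (g : V -> \bar R) :
  (forall m, heat_approximable (f_ m)) -> measurable_fun setT f ->
  ge0_mfun g -> (ge0_herz al q g < +oo)%E ->
  (forall m x, (absf (f_ m) x <= g x)%E) ->
  (forall x, (absf f x <= g x)%E) ->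
  (\forall x \ae mu, f_ m x @[m --> \oo] --> f x) ->
  heat_approximable f.
Proof.
move=> hf_ mf hg gfin f_g fg f_f.
have inf : in_Herz f.
  split => //; apply: le_lt_trans gfin; apply: Herz_le_ge0 => //.
  exact: aeW.
apply: heat_approximable_limit => // e e0.
have hgg := ge0_mfunD hg hg.
have ggfin : (ge0_herz al q (fun x => g x + g x) < +oo)%E.
  by apply: le_lt_trans (ge0_herzD al q1 hg hg) _; exact: lte_add_pinfty.
have mB m : measurable_fun setT (fun x => f x - f_ m x).
  by apply: measurable_funB => //; exact: (hf_ m).1.1.
have : H (fun x => f x - f_ m x) @[m --> \oo] --> 0%E.
  under eq_fun do rewrite HerzE.
  apply: (ge0_herz_dominated _ _ hgg ggfin) => //.
  - by move=> m; exact: ge0_mfun_absf.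
  - move=> m x; apply: le_trans (absfB_le _ _ _) _.
    exact: leeD.
  apply: filterS f_f => x fx _; rewrite /absf.
  rewrite -[X in _ --> X]/((0 : R)%:E); apply: cvg_EFin; first exact: nearW.
  rewrite -(@normr0 _ R); apply: cvg_norm; rewrite -(subrr (f x)).
  by apply: cvgB => //; exact: cvg_cst.
move=> /cvge0P => /(_ (fun m => Herz_ge0' _) e e0)[N _ hN].
by exists (f_ N) => //; exact: (hN N (leqnn N)).
Qed.

Lemma heat_approximable_sum (I : Type) (s : seq I) (F : I -> V -> R) :
  (forall i, heat_approximable (F i)) ->
  heat_approximable (fun x => \sum_(i <- s) F i x).
Proof.
move=> hF; elim: s => [|i s IH].
  under eq_fun do rewrite big_nil.
  split.
    split; first exact: measurable_cst.
    rewrite (_ : (fun=> 0) = (fun x : V => 0 * 0))//; last by rewrite mulr0.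
    rewrite HerzZ ?normr0 ?mul0e ?ltry//; exact: measurable_cst.
  move=> t_ t0 _; rewrite (_ : (fun m => _) = fun=> 0%E); first exact: cvg_cst.
  apply/funext => m.
  have e0 : (fun x => heat (t_ m) (fun=> 0) x - 0) = (fun x : V => 0 * 0).
    apply/funext => x; rewrite heatE// subr0 mulr0.
    under eq_Rintegral do rewrite mulr0.
    by rewrite /Rintegral integral0.
  rewrite e0 HerzZ ?normr0 ?mul0e//; exact: measurable_cst.
under eq_fun do rewrite big_cons.
exact: heat_approximableD.
Qed.

Definition dyadic_shell (J : nat) : set V :=
  [set x | 2 `^ (- J%:R) < eucl_norm x < 2 `^ J%:R].

Lemma measurable_dyadic_shell J : measurable (dyadic_shell J).
Proof.
rewrite (_ : dyadic_shell J = setT `&` (@eucl_norm R n @^-1` `]2 `^ (- J%:R), 2 `^ J%:R[)).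
  exact: measurable_eucl_norm.
by apply/seteqP; split=> x /=; rewrite in_itv/= => // -[].
Qed.

Lemma ge0_herz_dyadic_shell (be p : R) J : 1 <= p ->
  (ge0_herz be p (fun x => (\1_(dyadic_shell J) x)%:E) < +oo)%E.
Proof.
move=> p1; have p0 : 0 < p by exact: lt_le_trans p1.
have hI := ge0_mfun_indic R (measurable_dyadic_shell J).
(* The last summand J + 1 of the exponent makes up for the factor 2^(-|k|) of the summable majorant,
   since |k| <= J + 1 on the annuli that meet the shell. *)
pose C := 2 `^ ((J%:R + 1) * `|be| + (J%:R + 2) * (n%:R / p) + (J%:R + 1)) : R.
apply: (@le_lt_trans _ _ (\esum_(k in [set: int]) (C%:E * (2 `^ (- (1 * `|k|%:~R)))%:E)%E)); last first.
  rewrite esum_intZl; [|by rewrite lee_fin powR_ge0|by move=> k; rewrite lee_fin powR_ge0].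
  by rewrite lte_mul_pinfty ?lee_fin ?powR_ge0//; exact: esum_int_geometric.
apply: le_esum => k _.
have [kJ|kJ] := leP `|k| (J%:Z + 1); last first.
  rewrite (_ : annulus_Lp p k _ = 0%E) ?mule0 ?mule_ge0 ?lee_fin ?powR_ge0//.
  apply/eqP; rewrite eq_le annulus_Lp_ge0 andbT.
  have := annulus_Lp_cst (k := k) p0 hI (lexx 0%E); rewrite mul0e; apply => x.
  move=> /dyadic_annulusE/andP[h1 h2]; rewrite indicE memNset// => /andP[h3 h4].
  have := le_lt_trans h1 h4; have := lt_trans h3 h2; rewrite !pow2_lt.
  rewrite -[J%:R]/((J%:Z)%:~R) -mulrNz -[1]/(1%:~R) -intrB !ltr_int.
  lia.
apply: (@le_trans _ _ ((2 `^ (k%:~R * be))%:E * (1 * (2 `^ ((k%:~R + 1) * (n%:R / p)))%:E))%E).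
  apply: lee_wpmul2l; first by rewrite lee_fin powR_ge0.
  apply: annulus_Lp_cst => // x _.
  by rewrite lee_fin indicE; case: (_ \in _).
rewrite mul1e -!EFinM lee_fin /C -!pow2D pow2_le mul1r.
have kR : `|k|%:~R <= J%:R + 1 :> R.
  by rewrite (_ : J%:R + 1 = (J%:Z + 1)%:~R) ?ler_int// intrD.
have kR' : `|k%:~R| <= J%:R + 1 :> R by rewrite -intr_norm.
have h1 : k%:~R * be <= (J%:R + 1) * `|be|.
  by apply: le_trans (ler_norm _) _; rewrite normrM ler_wpM2r.
have h2 : (k%:~R + 1) * (n%:R / p) <= (J%:R + 2) * (n%:R / p).
  rewrite ler_wpM2r ?divr_ge0 ?ler0n ?(ltW p0)//.
  by have := ler_norm (k%:~R : R); lra.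
lra.
Qed.

(** * The semigroup on indicators of open sets *)

Section open_set.
Variables (J : nat) (W : set V).
Hypotheses (mW : measurable W) (WJ : W `<=` dyadic_shell J).
Hypothesis oW : forall x, W x -> exists2 r : R, 0 < r &
  forall y, eucl_norm (x - y) < r -> W y.

Let g x : \bar R := (\1_W x)%:E.
Let gc x : \bar R := (\1_(~` W) x)%:E.
Let hg : ge0_mfun g. Proof. exact: ge0_mfun_indic. Qed.
Let hgc : ge0_mfun gc. Proof. by apply: ge0_mfun_indic; exact: measurableC. Qed.

Let gD x : (g x + gc x = 1)%E.
Proof.
rewrite /g /gc -EFinD !indicE in_setC.
by case: (x \in W); rewrite /= ?addr0 ?add0r.
Qed.

Let herz_fin be p : 1 <= p -> (ge0_herz be p g < +oo)%E.
Proof.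
move=> p1; apply: le_lt_trans (ge0_herz_dyadic_shell be J p1).
apply: ge0_herz_le => //; first exact: lt_le_trans p1.
  by apply: ge0_mfun_indic; exact: measurable_dyadic_shell.
apply: aeW => x; rewrite lee_fin !indicE.
have [xW|xW] := pselect (W x); last by rewrite (memNset xW)// ler0n.
by rewrite !mem_set//; exact: WJ.
Qed.

Let PQ t x : 0 < t -> (ge0_heat t g x + ge0_heat t gc x = 1)%E.
Proof.
move=> t0; rewrite -ge0_heatD// -(integral_heat_kernel_sub x t0).
by apply: eq_integral => y _; rewrite gD mule1.
Qed.

Let D t x : \bar R := absf (fun x => heat t \1_W x - \1_W x) x.

Let mI : measurable_fun setT (\1_W : V -> R).
Proof. exact: measurable_indic. Qed.

Let hD t : ge0_mfun (D t).
Proof. by apply: ge0_mfun_absf; exact: mE. Qed.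

Let P_ge0 t x : (0 <= ge0_heat t g x)%E. Proof. exact: (ge0_mfun_heat t hg).2. Qed.
Let Q_ge0 t x : (0 <= ge0_heat t gc x)%E. Proof. exact: (ge0_mfun_heat t hgc).2. Qed.

Let heat_fine t x : 0 < t -> heat t \1_W x = fine (ge0_heat t g x).
Proof. by move=> t0; rewrite heatE. Qed.

(** The semigroup applied to the indicators of [W] and of its complement adds up to 1, so [D] is the
    second of these on [W] and the first one elsewhere. The identity is written with sums only,
    ready for integration in [0, +oo]. *)
Let DE t x : 0 < t ->
  (D t x + g x = ge0_heat t g x + 2%:E * (g x * ge0_heat t gc x))%E.
Proof.
move=> t0; rewrite /D /absf heat_fine// /g.
have := PQ x t0; move: (P_ge0 t x) (Q_ge0 t x).
case: (ge0_heat t g x) => [a| |]//; case: (ge0_heat t gc x) => [b| |]//.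
rewrite !lee_fin /= => a0 b0; rewrite -EFinD => -[ab].
rewrite -!EFinM -!EFinD; congr EFin.
rewrite indicE; case: (x \in W) => /=.
  by rewrite distrC ger0_norm; lra.
by rewrite subr0 ger0_norm; lra.
Qed.

Let D_le t x : 0 < t -> (D t x <= 1)%E.
Proof.
move=> t0; rewrite /D /absf heat_fine//.
have := PQ x t0; move: (P_ge0 t x) (Q_ge0 t x).
case: (ge0_heat t g x) => [a| |]//; case: (ge0_heat t gc x) => [b| |]//.
rewrite !lee_fin /= => a0 b0; rewrite -EFinD => -[ab].
rewrite indicE; case: (x \in W) => /=.
  by rewrite distrC ger0_norm; lra.
by rewrite subr0 ger0_norm; lra.
Qed.

Let mass_fin : (\int[mu]_x g x < +oo)%E.
Proof.
rewrite integral_annulus_sum//; apply: le_lt_trans (herz_fin 0 (lexx 1)).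
by apply: le_esum => k _; rewrite mulr0 powRr0 mul1e.
Qed.

Let hgQ t : ge0_mfun (fun x => g x * ge0_heat t gc x)%E.
Proof. by apply: ge0_mfunM => //; exact: ge0_mfun_heat. Qed.

(* As e^(tD) conserves mass, the L^1 distance of e^(tD)1_W to 1_W is twice the
   mass that has left W. *)
Let integral_D t : 0 < t ->
  (\int[mu]_x D t x = 2%:E * \int[mu]_x (g x * ge0_heat t gc x))%E.
Proof.
move=> t0; have : (\int[mu]_x (D t x + g x) =
    \int[mu]_x (ge0_heat t g x + 2%:E * (g x * ge0_heat t gc x)))%E.
  by apply: eq_integral => x _; exact: DE.
rewrite ge0_integralD//; [|by move=> x _; exact: (hD t).2|exact: (hD t).1|
  by move=> x _; exact: hg.2|exact: hg.1].
rewrite ge0_integralD//; last 3 first.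
- exact: (ge0_mfun_heat t hg).1.
- by move=> x _; rewrite mule_ge0//; exact: (hgQ t).2.
- by apply: measurable_funeM; exact: (hgQ t).1.
rewrite integral_ge0_heat// ge0_integralZl//; last 2 first.
- exact: (hgQ t).1.
- by move=> x _; exact: (hgQ t).2.
have : (\int[mu]_x g x)%E \is a fin_num.
  by rewrite ge0_fin_numE// integral_ge0// => x _; exact: hg.2.
case: (\int[mu]_x g x)%E => [r| |]// _ /(congr1 (fun z => z - r%:E)%E).
by rewrite addeK// [in RHS]addeAC subee// add0e.
Qed.

(** A ball of radius r around x lies in [W], so only the tail of the kernel sees the complement.
    [heat_kernel_tail] bounds it by exp(-r^2/(8t)) times a kernel of mass 1, and exp(-y) <= 1/y
    gives a bound linear in t. *)
Let Q_cvg (t_ : nat -> R) x : (forall m, 0 < t_ m) -> t_ @ \oo --> 0 -> W x ->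
  ge0_heat (t_ m) gc x @[m --> \oo] --> 0%E.
Proof.
move=> t0 tt /oW[r r0 hr].
pose C := 2 `^ (n%:R / 2) * (8 / r ^+ 2).
have C0 : 0 <= C by rewrite mulr_ge0 ?powR_ge0// divr_ge0// exprn_ge0// ltW.
have tC : (C * t_ m)%:E @[m --> \oo] --> (0 : R)%:E.
  apply: cvg_EFin; first exact: nearW.
  by rewrite -(mulr0 C); apply: cvgM => //; exact: cvg_cst.
apply: squeeze_cvge tC; last exact: cvg_cst.
apply: nearW => m; rewrite Q_ge0/=.
pose c := 2 `^ (n%:R / 2) * expR (- (r ^+ 2 / (8 * t_ m))).
have c0 : 0 <= c by rewrite mulr_ge0 ?powR_ge0 ?expR_ge0.
have t20 : 0 < 2 * t_ m by rewrite mulr_gt0.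
apply: (@le_trans _ _ c%:E).
  rewrite -[leRHS]mule1 -(integral_heat_kernel_sub x t20) -ge0_integralZl//; last 2 first.
  - exact: measurable_heat_kernel_sub.
  - by move=> y _; rewrite lee_fin heat_kernel_ge0.
  apply: ge0_le_integralT => y.
    by rewrite mule_ge0 ?lee_fin ?heat_kernel_ge0//; exact: hgc.2.
  rewrite /gc indicE; have [yW|yW] := pselect (W y).
    by rewrite memNset// mule0 mule_ge0// lee_fin// heat_kernel_ge0.
  rewrite mem_set// mule1 -EFinM lee_fin; apply: heat_kernel_tail => //; first exact: ltW.
  by rewrite leNgt; apply/negP => /hr.
rewrite lee_fin /c /C -mulrA ler_wpM2l ?powR_ge0//.
have y0 : 0 < r ^+ 2 / (8 * t_ m) by rewrite divr_gt0 ?exprn_gt0// mulr_gt0.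
rewrite (_ : 8 / r ^+ 2 * t_ m = (r ^+ 2 / (8 * t_ m))^-1); last first.
  by rewrite invf_div; ring.
rewrite expRN lef_pV2 ?posrE ?expR_gt0//.
by apply: le_trans (expR_ge1Dx _); rewrite lerDr.
Qed.

Let integral_D_cvg (t_ : nat -> R) : (forall m, 0 < t_ m) -> t_ @ \oo --> 0 ->
  (\int[mu]_x D (t_ m) x)%E @[m --> \oo] --> 0%E.
Proof.
move=> t0 tt; under eq_fun do rewrite integral_D//.
rewrite -(mule0 2%:E); apply: cvgeZl => //.
rewrite -(integral0 mu setT).
apply: (@dominated_cvg _ _ _ mu setT measurableT _ _ g) => //.
- by move=> m; exact: (hgQ (t_ m)).1.
- move=> x _; rewrite /g indicE; have [xW|xW] := pselect (W x).
    by rewrite mem_set//; under eq_fun do rewrite mul1e; exact: Q_cvg.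
  by rewrite memNset//; under eq_fun do rewrite mul0e; exact: cvg_cst.
- apply/integrableP; split; first exact: hg.1.
  by rewrite (eq_integral g) => [//|x _]; rewrite gee0_abs//; exact: hg.2.
move=> m x _; rewrite gee0_abs; last exact: (hgQ (t_ m)).2.
rewrite -[leRHS]mule1; apply: lee_wpmul2l; first exact: hg.2.
by rewrite -(PQ x (t0 m)) leeDr.
Qed.

(** On each annulus 0 <= D <= 1 gives D^q <= D, so that convergence in L^1 controls the L^q norm;
    the summable majorant uniform in time then permits the limit under the sum over the annuli. *)
Lemma heat_approximable_open : heat_approximable \1_W.
Proof.
split.
  split => //; rewrite HerzE; apply: le_lt_trans (herz_fin al q1).
  apply: ge0_herz_le => //; first exact: ge0_mfun_absf.
  by apply: aeW => x; rewrite /absf lee_fin ger0_norm.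
move=> t_ t0 tt; under eq_fun do rewrite HerzE.
have [b [hb bfin]] := herz_heat_majorant_lty n0 q1 d0 dn hg (herz_fin al q1).
pose c k : \bar R := ((2 `^ (k%:~R * al))%:E * annulus_Lp q k g)%E.
have w0 k : (0 <= (2 `^ (k%:~R * al))%:E :> \bar R)%E by rewrite lee_fin powR_ge0.
have c0 k : (0 <= c k)%E by rewrite mule_ge0// annulus_Lp_ge0.
have b0 k : (0 <= b k)%E.
  by apply: le_trans (hb _ k (t0 0%N)); rewrite mule_ge0// annulus_Lp_ge0.
apply: (@esum_int_dominated _ _ (fun k => b k + c k)%E).
- move=> m k; rewrite mule_ge0 ?annulus_Lp_ge0//=.
  apply: (@le_trans _ _ ((2 `^ (k%:~R * al))%:E *
      (annulus_Lp q k (ge0_heat (t_ m) g) + annulus_Lp q k g))%E).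
    apply: lee_wpmul2l => //.
    apply: le_trans (annulus_LpD k q1 (ge0_mfun_heat (t_ m) hg) hg).
    apply: annulus_Lp_le => //; [exact: hD|by apply: ge0_mfunD => //; exact: ge0_mfun_heat|].
    apply: aeW => x _; rewrite /D.
    apply: le_trans (absfB_le _ _ _) _; apply: leeD.
      rewrite /absf heat_fine// ger0_norm ?fine_ge0//.
      by rewrite fineK// ge0_fin_numE// (@le_lt_trans _ _ 1%E) ?ltry// -(PQ x (t0 m)) leeDl.
    by rewrite /absf lee_fin ger0_norm.
  rewrite ge0_muleDr ?annulus_Lp_ge0//; apply: leeD => //; exact: hb.
- by rewrite esumD// lte_add_pinfty//; exact: (herz_fin al q1).
move=> k; rewrite -(mule0 (2 `^ (k%:~R * al))%:E); apply: cvgeZl => //.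
have qV : 0 < q^-1 by rewrite invr_gt0.
have h := cvg_poweR0 _ qV (fun m => integral_ge0 _ (fun x _ => (hD (t_ m)).2 x)) (integral_D_cvg t0 tt).
apply: squeeze_cvge (h _); last exact: cvg_cst.
apply: nearW => m; rewrite annulus_Lp_ge0/=.
apply: le_trans (annulus_Lp_le_eLp k q0 (hD _)) _.
apply: lee_poweR; [exact: ltW|by apply: integral_ge0 => x _; exact: poweR_ge0|].
apply: ge0_le_integralT => x; first exact: poweR_ge0.
have := D_le x (t0 m); have := (hD (t_ m)).2 x; rewrite -/(D (t_ m) x).
case: (D (t_ m) x) => [d| |]//; rewrite !lee_fin => d0' d1.
have [->|dn0] := eqVneq d 0; first by rewrite powR0// gt_eqF.
by apply: ge1r_powR => //; rewrite d1 andbT lt_neqAle eq_sym dn0.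
Qed.

End open_set.

(** The half-spaces x_i > a are open and generate the coordinate sigma-algebra. The generating
    family is stable under intersection, as Dynkin induction requires. *)
Lemma measurable_rV_open_generated : (@measurable _ V) = <<s [set W : set V |
  measurable W /\ forall x, W x -> exists2 r : R, 0 < r &
  forall y, eucl_norm (x - y) < r -> W y] >>.
Proof.
set G := (X in <<s X >>).
apply/seteqP; split=> [A mA|]; last first.
  by apply: smallest_sub; [exact: sigma_algebra_measurable|move=> A []].
suff mid : measurable_fun [set: g_sigma_algebraType G] (fun x => x : V).
  by have := mid measurableT _ mA; rewrite setTI.
apply: (@measurable_fun_rV _ _ _ _ _ (fun x : g_sigma_algebraType G => x : V)) => i.
apply: (measurability _ (RGenOInfty.measurableE R)) => _ [_ [a ->] <-].
rewrite setTI; apply: sub_sigma_algebra; split.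
  rewrite -[X in measurable X]setTI; apply: measurable_rV_coord => //.
move=> x /=; rewrite in_itv/= andbT => ax.
exists (x ord0 i - a) => [|y xy]; first by rewrite subr_gt0.
have := le_lt_trans (eucl_norm_coord (x - y) i) xy; rewrite !mxE in_itv/= andbT => h.
by have := ler_norm (x ord0 i - y ord0 i); lra.
Qed.

(* Dynkin induction, starting from the open sets. *)
Lemma heat_approximable_indic J A : measurable A ->
  heat_approximable \1_(A `&` dyadic_shell J).
Proof.
move=> mA; have mJ := measurable_dyadic_shell J.
have oJ x : dyadic_shell J x -> exists2 r : R, 0 < r &
    forall y, eucl_norm (x - y) < r -> dyadic_shell J y.
  move=> /andP[h1 h2].
  exists (Num.min (eucl_norm x - 2 `^ (- J%:R)) (2 `^ J%:R - eucl_norm x)).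
    by rewrite lt_min !subr_gt0 h1.
  move=> y; rewrite lt_min => /andP[y1 y2]; apply/andP.
  have := ler_eucl_normB x y; have := ler_eucl_normB y x.
  by rewrite [eucl_norm (y - x)]eucl_normBC; split; lra.
(* Cutting with a shell keeps all indicators in the space. The shell is itself open, so complements
   within it are differences of approximable functions. *)
pose P A := heat_approximable \1_(A `&` dyadic_shell J).
have := mA; rewrite measurable_rV_open_generated; move: A {mA}.
apply: (@dynkin_induction _ _ _ P) => //.
- exact: measurable_rV_open_generated.
- move=> A B [mA oA] [mB oB]; split=> [|x [Ax Bx]]; first exact: measurableI.
  have [r1 r10 h1] := oA x Ax; have [r2 r20 h2] := oB x Bx.
  exists (Num.min r1 r2) => [|y]; first by rewrite lt_min r10.
  by rewrite lt_min => /andP[/h1 ? /h2 ?].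
- rewrite /P setTI; apply: (@heat_approximable_open J) => //.
- move=> A [mA oA]; apply: (@heat_approximable_open J) => //.
  + exact: measurableI.
  move=> x [Ax Jx]; have [r1 r10 h1] := oA x Ax; have [r2 r20 h2] := oJ x Jx.
  exists (Num.min r1 r2) => [|y]; first by rewrite lt_min r10.
  by rewrite lt_min => /andP[/h1 ? /h2 ?].
- move=> A mA PA; rewrite /P (_ : \1__ =
    (fun x => \1_(dyadic_shell J) x - \1_(A `&` dyadic_shell J) x)); last first.
    apply/funext => x; rewrite !indicE !in_setI in_setC.
    by case: (x \in A); case: (x \in _); rewrite /= ?subr0 ?subrr.
  by apply: heat_approximableB => //; apply: (@heat_approximable_open J).
move=> F mF tF PF; rewrite /P.
have hJ := ge0_mfun_indic R mJ.
have mJF i : measurable (F i `&` dyadic_shell J) by exact: measurableI.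
pose f_ m x := \sum_(i < m) (\1_(F i `&` dyadic_shell J) x : R).
have f_E m x : f_ m x = \1_(\big[setU/set0]_(i < m) F i `&` dyadic_shell J) x.
  elim: m => [|m IH]; first by rewrite /f_ !big_ord0 set0I indic0.
  rewrite /f_ big_ord_recr big_ord_recr/= -/(f_ m x) IH.
  rewrite !indicE !in_setI in_setU.
  have [|_] := boolP (x \in \big[setU/set0]_(i < m) F i); last by rewrite /= add0r.
  rewrite inE -bigcup_mkord => -[i /= im Fix].
  have [xm|] := boolP (x \in F m); last by rewrite /= addr0.
  exfalso; move: xm; rewrite inE => xm.
  have /trivIsetP/(_ i m I I) := tF; rewrite neq_ltn im /= => /(_ isT)/seteqP[/(_ x) + _].
  by apply.
have le1 (B : set V) x : (absf \1_(B `&` dyadic_shell J) x <= (\1_(dyadic_shell J) x)%:E :> \bar R)%E.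
  rewrite /absf lee_fin ger0_norm// !indicE in_setI.
  by case: (x \in B); case: (x \in _); rewrite /= ?ler01.
apply: (@heat_approximable_dominated f_ _ (fun x => (\1_(dyadic_shell J) x)%:E)) => //.
- by move=> m; apply: (@heat_approximable_sum _ _ (fun i : 'I_m => \1_(F i `&` dyadic_shell J))) => i; exact: PF.
- by apply: measurable_indic; apply: measurableI => //; exact: bigcup_measurable.
- exact: ge0_herz_dyadic_shell.
- by move=> m x; rewrite /absf f_E; exact: le1.
apply: aeW => x; have [[i _ Fix]|nF] := pselect ((\bigcup_k F k) x); last first.
  rewrite indicE memNset => [|[]//]; apply: cvg_near_cst; apply: nearW => m.
  rewrite f_E indicE memNset// => -[+ _]; rewrite -bigcup_mkord => -[k /= km Fkx].
  by apply: nF; exists k.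
apply: cvg_near_cst; exists i.+1 => // m /= im; rewrite f_E !indicE !in_setI.
rewrite (mem_set (_ : (\bigcup_k F k) x)); last by exists i.
by rewrite mem_set// -bigcup_mkord; exists i.
Qed.

Lemma dyadic_shell_cvg x : x != 0 -> \forall m \near \oo, dyadic_shell m x.
Proof.
move=> x0; have : 0 < eucl_norm x.
  rewrite lt_neqAle eucl_norm_ge0 andbT eq_sym.
  by apply/eqP => /eucl_norm0_eq0; exact/eqP.
move=> /dyadic_bracket[k /andP[h1 h2]].
exists (`|k|.+2) => // m /= km; apply/andP; split.
  apply: lt_le_trans h1; rewrite pow2_lt.
  have : - m%:Z < k - 1 by lia.
  by rewrite -(ltr_int R) intrB mulrNz.
apply: lt_le_trans h2 _; rewrite pow2_le -[m%:R]/((m%:Z)%:~R) ler_int; lia.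
Qed.

Import HBNNSimple.

(** Simple functions increasing to [f], cut off to growing shells, are dominated by [f] and converge
    to it away from the origin. *)
Lemma heat_approximable_ge0 f : in_Herz f -> (forall x, 0 <= f x) ->
  heat_approximable f.
Proof.
move=> [mf hf] f0.
have mEf : measurable_fun setT (EFin \o f) by exact/measurable_EFinP.
pose s := nnsfun_approx measurableT mEf.
have s_le m x : s m x <= f x.
  rewrite -lee_fin.
  have sx := @cvg_nnsfun_approx _ _ _ _ measurableT _ mEf (fun x _ => f0 x) x I.
  apply: (cvge_to_ge sx).
  exists m => // k /= mk; rewrite lee_fin.
  by have /lefP := nd_nnsfun_approx measurableT mEf mk; apply.
pose f_ m x := s m x * \1_(dyadic_shell m) x.
apply: (@heat_approximable_dominated f_ f (absf f)) => //.
- move=> m; rewrite (_ : f_ m = fun x =>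
    \sum_(y <- finmap.enum_fset (fset_set (range (s m)))) y * \1_((s m @^-1` [set y]) `&` dyadic_shell m) x).
    apply: heat_approximable_sum => y; apply: heat_approximableZ.
    by apply: heat_approximable_indic; exact: measurable_sfunP.
  apply/funext => x; rewrite /f_ fimfunE fsbig_finite//= mulr_suml.
  by apply: eq_bigr => y _; rewrite indicI mulrA.
- exact: ge0_mfun_absf.
- by rewrite -HerzE.
- move=> m x; rewrite /absf lee_fin !ger0_norm// /f_ ?mulr_ge0//.
  by rewrite indicE; case: (_ \in _); rewrite ?mulr1 ?mulr0.
apply: filterS (ae_neq0 n0) => x x0.
have : s m x @[m --> \oo] --> f x.
  exact: (fine_cvg (@cvg_nnsfun_approx _ _ _ _ measurableT _ mEf (fun x _ => f0 x) x I)).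
apply: cvg_trans; apply: near_eq_cvg; near=> m.
rewrite /f_ indicE mem_set ?mulr1//; near: m.
exact: dyadic_shell_cvg.
Unshelve. all: by end_near. Qed.

Lemma heat_strong_continuity f : in_Herz f -> forall e : R, 0 < e ->
  exists2 d : R, 0 < d & forall t, 0 < t < d ->
    (H (fun x => heat t f x - f x)%R <= e%:E)%E.
Proof.
move=> hf; have [mf ff] := hf.
have hn : in_Herz (fun x => `|f x|).
  split; first exact: measurableT_comp.
  rewrite HerzE; move: ff; rewrite HerzE; apply: le_lt_trans.
  apply: ge0_herz_le => //; try exact: ge0_mfun_absf.
    by apply: ge0_mfun_absf; exact: measurableT_comp.
  by apply: aeW => x; rewrite /absf normr_id.
have [_ fE] : heat_approximable f.
  rewrite (_ : f = fun x => 2^-1 * (`|f x| + f x) - 2^-1 * (`|f x| - f x)); last first.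
    by apply/funext => x; lra.
  apply: heat_approximableB; apply: heat_approximableZ; apply: heat_approximable_ge0.
  - exact: in_HerzD.
  - by move=> x; have := ler_norm (- f x); rewrite normrN; lra.
  - exact: in_HerzB.
  - by move=> x; have := ler_norm (f x); lra.
move=> e e0; apply: contrapT => h.
(* If no d works, choosing a bad time below 1/(m + 1) for every m gives a sequence tending to 0 that
   contradicts the sequential statement. *)
have /choice[t_ ht] : forall m : nat, exists t : R, 0 < t < m.+1%:R^-1 /\
    ~ (H (fun x => heat t f x - f x)%R <= e%:E)%E.
  move=> m; apply: contrapT => hm; apply: h; exists m.+1%:R^-1; first by rewrite invr_gt0.
  by move=> t tm; apply: contrapT => ht; apply: hm; exists t.
have t0 m : 0 < t_ m by have [/andP[]] := ht m.
have tt : t_ @ \oo --> 0.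
  apply: squeeze_cvgr (@cvg_harmonic R); last exact: cvg_cst.
  by apply: nearW => m; rewrite ltW//=; have [/andP[_ /ltW]] := ht m.
have := fE t_ t0 tt => /cvge0P => /(_ (fun m => Herz_ge0' _) e e0)[N _ /(_ N (leqnn N))].
by have [_] := ht N.
Qed.

End strong_continuity.

(** Assume |b| <= |a| and put s = |b|/|a|. The difference of the powers is governed by 1 - s^beta <=
    1 - s^k <= k (1 - s), for an integer k >= beta and by Bernoulli's inequality; this replaces the
    mean value theorem. *)
Lemma source_diff_bound {R : realType} (beta a b : R) (k : nat) : 0 < beta ->
  beta <= k%:R ->
  `| `|a| `^ beta * a - `|b| `^ beta * b| <=
  (k.+1)%:R * ((`|a| + `|b|) `^ beta * `|a - b|).
Proof.
move=> b0 bk; wlog ba : a b / `|b| <= `|a|.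
  move=> h; have [/h//|/ltW/h] := leP `|b| `|a|.
  by rewrite distrC [`|b| + _]addrC [`|b - a|]distrC.
have -> : `|a| `^ beta * a - `|b| `^ beta * b =
    `|a| `^ beta * (a - b) + (`|a| `^ beta - `|b| `^ beta) * b by ring.
apply: (@le_trans _ _ (`|a| `^ beta * `|a - b| + k%:R * (`|a| `^ beta * `|a - b|))); last first.
  rewrite -[(k.+1)%:R]nat1r mulrDl mul1r.
  have h : `|a| `^ beta * `|a - b| <= (`|a| + `|b|) `^ beta * `|a - b|.
    rewrite ler_wpM2r// ge0_ler_powR ?nnegrE ?addr_ge0 ?lerDl//; exact: ltW.
  by apply: lerD => //; rewrite ler_wpM2l.
apply: le_trans (ler_normD _ _) _; apply: lerD.
  by rewrite normrM ger0_norm ?powR_ge0.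
rewrite normrM ger0_norm; last first.
  by rewrite subr_ge0 ge0_ler_powR ?nnegrE//; exact: ltW.
have [az|an0] := eqVneq a 0.
  by move: ba; rewrite az normr0 normr_le0 => /eqP ->; rewrite !normr0 subrr !mul0r subrr normr0 !mulr0.
have a0 : 0 < `|a| by rewrite normr_gt0.
pose s := `|b| / `|a|.
have s0 : 0 <= s by rewrite divr_ge0.
have s1 : s <= 1 by rewrite ler_pdivrMr// mul1r.
have bE : `|b| = s * `|a| by rewrite /s divfK// gt_eqF.
have sk : s ^+ k <= s `^ beta.
  have [->|sn0] := eqVneq s 0; last first.
    rewrite -powR_mulrn//; apply: ger_powR => //.
    by rewrite s1 andbT lt_neqAle eq_sym sn0.
  case: k bk => [|k _]; first by rewrite leNgt b0.
  by rewrite expr0n/= powR_ge0.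
have bern : 1 - s ^+ k <= k%:R * (1 - s).
  elim: (k) => [|m IH]; first by rewrite expr0 subrr mul0r.
  rewrite exprS -[m.+1%:R]nat1r mulrDl mul1r.
  have -> : 1 - s * s ^+ m = (1 - s) + s * (1 - s ^+ m) by ring.
  rewrite lerD2l; apply: le_trans IH.
  by rewrite ler_piMl// subr_ge0 exprn_ile1.
have h1 : `|a| `^ beta - `|b| `^ beta = `|a| `^ beta * (1 - s `^ beta).
  by rewrite bE powRM// mulrBr mulr1 mulrC.
rewrite h1 -mulrA [leRHS]mulrCA ler_wpM2l ?powR_ge0//.
have ab : `|a| * (1 - s) <= `|a - b|.
  rewrite mulrBr mulr1 mulrC -bE.
  by have := ler_normD (a - b) b; rewrite subrK; lra.
apply: (@le_trans _ _ (k%:R * (1 - s) * `|b|)).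
  by rewrite ler_wpM2r// (le_trans _ bern)// lerD2l lerN2.
rewrite -mulrA ler_wpM2l// (le_trans _ ab)// mulrC ler_wpM2r// subr_ge0//.
Qed.

Section eLp_power_hoelder.
Context d (T : measurableType d) (R : realType)
  (mu : {sigma_finite_measure set T -> \bar R}).
Local Open Scope ereal_scope.

(** Hoelder's inequality with the conjugate exponents (beta + 1)/beta and beta + 1, for the p-th
    powers. *)
Lemma eLp_power_hoelder (p beta : R) (W D : T -> \bar R) :
  (0 < p)%R -> (0 < beta)%R -> ge0_mfun W -> ge0_mfun D ->
  eLp mu p (fun x => W x `^ beta * D x) <=
  eLp mu (p * (beta + 1)) W `^ beta * eLp mu (p * (beta + 1)) D.
Proof.
move=> p0 b0 [mW W0] [mD D0].
have b1 : (0 < beta + 1)%R by rewrite addr_gt0.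
pose r : R := ((beta + 1) / beta)%R.
have r0 : (0 < r)%R by rewrite divr_gt0.
have conj : (r^-1 + (beta + 1)^-1 = 1)%R.
  by rewrite /r invf_div -[X in (_ + X)%R]mul1r -mulrDl mulfV// gt_eqF.
have iW : 0 <= \int[mu]_x (W x `^ (p * (beta + 1))).
  by apply: integral_ge0 => x _; exact: poweR_ge0.
have iD : 0 <= \int[mu]_x (D x `^ (p * (beta + 1))).
  by apply: integral_ge0 => x _; exact: poweR_ge0.
have /(lee_poweR (r := p^-1)) := @ge0_hoelder _ T R mu r (beta + 1)%R
   (fun x => W x `^ (beta * p)) (fun x => D x `^ p) r0 b1 conj
   (measurable_fun_poweR _ mW) (measurable_fun_poweR _ mD)
   (fun x => poweR_ge0 _ _) (fun x => poweR_ge0 _ _).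
have pV : (0 <= p^-1)%R by rewrite invr_ge0 ltW.
have i0 : 0 <= \int[mu]_x (W x `^ (beta * p) * D x `^ p).
  by apply: integral_ge0 => x _; rewrite mule_ge0 ?poweR_ge0.
move=> /(_ pV i0).
under eq_integral do rewrite poweRrM -poweRM ?poweR_ge0//.
move=> /le_trans; apply.
rewrite poweRM ?eLp_ge0//; apply: lee_pmul; rewrite ?poweR_ge0//.
  rewrite /eLp; under eq_integral do rewrite -poweRrM.
  rewrite (_ : (beta * p * r = p * (beta + 1))%R); last first.
    by rewrite /r; field; rewrite gt_eqF.
  rewrite -!poweRrM (_ : (r^-1 / p)%R = ((p * (beta + 1))^-1 * beta)%R)//.
  by rewrite /r invf_div; field; rewrite !gt_eqF.
rewrite /eLp; under eq_integral do rewrite -poweRrM.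
by rewrite -!poweRrM -invfM mulrC.
Qed.

End eLp_power_hoelder.

(** * The nonlinearity *)

Section source.
Context {R : realType} {n : nat}.
Local Notation V := 'rV[R]_n.
Local Notation mu := (@lebesgue_rV R n).
Variables (q beta gamma : R).
Hypotheses (n0 : (0 < n)%N) (b0 : 0 < beta) (bq : beta + 1 <= q).
Hypotheses (g0 : 0 < gamma).

Local Notation sg := (beta + 1)^-1.
Local Notation al := ((n%:R - gamma) / (beta + 1) - n%:R / q).
Local Notation p := (q * sg).
Local Notation al' := (n%:R * (1 - p^-1)).
Local Notation F := (hardy_henon_source gamma beta).

Let b1 : 0 < beta + 1. Proof. by rewrite addr_gt0. Qed.
Let q0 : 0 < q. Proof. exact: lt_le_trans bq. Qed.
Let p1 : 1 <= p. Proof. by rewrite ler_pdivlMr// mul1r. Qed.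
Let p0 : 0 < p. Proof. exact: lt_le_trans p1. Qed.

Let eN_ge0 : ge0_mfun (fun x : V => (eucl_norm x `^ (- gamma))%:E).
Proof.
split=> [|x]; last by rewrite lee_fin powR_ge0.
apply/measurable_EFinP; apply: (measurableT_comp (measurable_powR _)).
exact: measurable_eucl_norm.
Qed.

(** The factor 2^gamma bounds |x|^(-gamma) on an annulus by its value on the inner sphere, of radius
    2^(k-1). The powers of [W] are estimated by the whole seminorm, and the single factor [D]
    carries the sum over k. *)
Lemma ge0_herz_source (W D : V -> \bar R) : ge0_mfun W -> ge0_mfun D ->
  (ge0_herz al' p (fun x => (eucl_norm x `^ (- gamma))%:E * (W x `^ beta * D x)) <=
  (2 `^ gamma)%:E * (ge0_herz al q W `^ beta * ge0_herz al q D))%E.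
Proof.
move=> hW hD; have hWD := ge0_mfunM (ge0_mfun_poweR beta hW) hD.
have H0 (g : V -> \bar R) : (0 <= ge0_herz al q g)%E by exact: ge0_herz_ge0.
have w0 k (r : R) : (0 <= (2 `^ (k%:~R * r))%:E :> \bar R)%E by rewrite lee_fin powR_ge0.
rewrite muleA {2}/ge0_herz -esum_intZl; last 2 first.
- by rewrite mule_ge0 ?lee_fin ?powR_ge0// poweR_ge0.
- by move=> k; rewrite mule_ge0 ?annulus_Lp_ge0.
apply: le_esum => k _.
have A0 (r : R) (g : V -> \bar R) : (0 <= annulus_Lp r k g)%E by exact: annulus_Lp_ge0.
apply: (@le_trans _ _ ((2 `^ (k%:~R * al'))%:E * ((2 `^ (- ((k%:~R - 1) * gamma)))%:E *
    annulus_Lp p k (fun x => W x `^ beta * D x)%E))%E).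
  apply: lee_wpmul2l; first exact: w0.
  rewrite -(annulus_LpZ k p0 hWD); last by rewrite lee_fin powR_ge0.
  apply: annulus_Lp_le => //; [exact: ge0_mfunM| |].
    by apply: ge0_mfunM => //; exact: ge0_mfun_cst.
  apply: aeW => x /dyadic_annulusE/andP[h _].
  apply: lee_wpmul2r; first exact: hWD.2.
  rewrite lee_fin -mulrN powRrM !powRN lef_pV2 ?posrE ?powR_gt0 ?pow2_gt0//; last first.
    exact: lt_le_trans (pow2_gt0 _) h.
  by rewrite ge0_ler_powR ?nnegrE ?powR_ge0 ?eucl_norm_ge0// ltW.
have : (annulus_Lp p k (fun x => W x `^ beta * D x) <=
    annulus_Lp q k W `^ beta * annulus_Lp q k D)%E.
  have hWk := ge0_mfun_annulus k hW; have hDk := ge0_mfun_annulus k hD.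
  have := eLp_power_hoelder mu p0 b0 hWk hDk.
  rewrite mulfVK ?gt_eqF//; apply: le_trans.
  rewrite le_eqVlt; apply/orP; left; apply/eqP; congr eLp; apply/funext => x.
  rewrite indicE; case: (x \in _); rewrite ?mule1// !mule0.
  reflexivity.
move=> h.
apply: (@le_trans _ _ ((2 `^ (k%:~R * al'))%:E * ((2 `^ (- ((k%:~R - 1) * gamma)))%:E *
    (annulus_Lp q k W `^ beta * annulus_Lp q k D)))%E).
  by do 2 (apply: lee_wpmul2l; first by rewrite lee_fin powR_ge0).
have hk : ((2 `^ (k%:~R * al))%:E * annulus_Lp q k W <= ge0_herz al q W)%E.
  exact: ge0_herz_ge.
apply: (@le_trans _ _ ((2 `^ gamma)%:E * ((2 `^ (k%:~R * al))%:E * annulus_Lp q k W) `^ beta *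
   ((2 `^ (k%:~R * al))%:E * annulus_Lp q k D))%E); last first.
  apply: lee_wpmul2r; first by rewrite mule_ge0.
  apply: lee_wpmul2l; first by rewrite lee_fin powR_ge0.
  apply: lee_poweR => //; first exact: ltW.
  by rewrite mule_ge0.
rewrite poweRM// poweR_EFin -powRrM !muleA.
rewrite [X in (X * _)%E](_ : _ = ((2 `^ gamma * 2 `^ (k%:~R * al * beta) * 2 `^ (k%:~R * al))%:E *
  annulus_Lp q k W `^ beta)%E); last first.
  congr (_ * _)%E; rewrite -EFinM -!pow2D; congr (_ `^ _)%:E.
  by field; rewrite !gt_eqF.
rewrite le_eqVlt; apply/orP; left; apply/eqP; rewrite !EFinM -!muleA.
by congr (_ * (_ * _))%E; rewrite muleCA.
Qed.

Lemma measurable_source (f : V -> R) : measurable_fun setT f ->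
  measurable_fun setT (F f).
Proof.
move=> mf; apply: measurable_funM => //; apply: measurable_funM.
  by apply/measurable_EFinP; exact: eN_ge0.1.
apply: (measurableT_comp (measurable_powR _)).
exact: measurableT_comp.
Qed.

Lemma herz_source_lip : exists2 C : R, 0 < C & forall (f g : V -> R) (M : R),
  measurable_fun setT f -> measurable_fun setT g -> 0 <= M ->
  (Herz al q f <= M%:E)%E -> (Herz al q g <= M%:E)%E ->
  (Herz al' p (fun x => F f x - F g x)%R <=
    (C * M `^ beta)%:E * Herz al q (fun x => f x - g x)%R)%E.
Proof.
have q1 : 1 <= q by apply: le_trans bq; rewrite lerDr ltW.
pose k := (Num.trunc beta).+1.
have bk : beta <= k%:R by exact/ltW/Num.Theory.truncnS_gt.
(* The factor k + 1 comes from [source_diff_bound], 2^gamma from the annulus estimate, and 2^beta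
   from the bound 2M for the seminorm of |f| + |g|. *)
exists (k.+1%:R * 2 `^ gamma * 2 `^ beta).
  by rewrite !mulr_gt0 ?powR_gt0// ltr0n.
move=> f g M mf mg M0 fM gM.
pose W x : \bar R := (absf f x + absf g x)%E.
pose D := absf (fun x => f x - g x).
have hW : ge0_mfun W by apply: ge0_mfunD; exact: ge0_mfun_absf.
have hD : ge0_mfun D by apply: ge0_mfun_absf; exact: measurable_funB.
have hG : ge0_mfun (fun x => (eucl_norm x `^ (- gamma))%:E * (W x `^ beta * D x))%E.
  by apply: ge0_mfunM => //; apply: ge0_mfunM => //; exact: ge0_mfun_poweR.
apply: (@le_trans _ _ (ge0_herz al' p (fun x => k.+1%:R%:E *
   ((eucl_norm x `^ (- gamma))%:E * (W x `^ beta * D x)))%E)).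
  apply: Herz_le_ge0 => //.
  - by apply: measurable_funB; exact: measurable_source.
  - by apply: ge0_mfunM => //; apply: ge0_mfun_cst; rewrite lee_fin.
  apply: aeW => x; rewrite /W /D /absf -EFinD poweR_EFin -!EFinM lee_fin.
  rewrite /hardy_henon_source -!mulrA -mulrBr normrM (ger0_norm (powR_ge0 _ _)).
  rewrite mulrCA ler_wpM2l ?powR_ge0//.
  exact: source_diff_bound.
rewrite ge0_herzZ// ?lee_fin//.
apply: (@le_trans _ _ (k.+1%:R%:E * ((2 `^ gamma)%:E *
   (ge0_herz al q W `^ beta * ge0_herz al q D)))%E).
  by apply: lee_wpmul2l; [rewrite lee_fin|exact: ge0_herz_source].
have WM : (ge0_herz al q W <= (2 * M)%:E)%E.
  apply: le_trans (ge0_herzD al q1 (ge0_mfun_absf mf) (ge0_mfun_absf mg)) _.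
  by rewrite (_ : 2 * M = M + M) ?EFinD -?HerzE ?leeD//; ring.
have -> : (ge0_herz al q D = Herz al q (fun x => f x - g x)%R) by rewrite HerzE.
rewrite !muleA; apply: lee_wpmul2r; first exact: Herz_ge0.
rewrite -!mulrA [X in (_ <= X)%E]EFinM [X in (_ <= _ * X)%E]EFinM muleA.
apply: lee_wpmul2l; first by rewrite -EFinM lee_fin mulr_ge0 ?powR_ge0.
rewrite -powRM// -poweR_EFin; apply: lee_poweR => //; first exact: ltW.
exact: ge0_herz_ge0.
Qed.

Lemma source0 (x : V) : F (fun=> 0) x = 0.
Proof. by rewrite /hardy_henon_source mulr0. Qed.

End source.

(** * The Duhamel operator *)

Section line_integrals.
Context {R : realType}.
Local Notation leb := (@lebesgue_measure R).

Lemma ge0_integral_lebesgue_shift (c : R) (f : R -> \bar R) :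
  measurable_fun [set: R] f -> (forall x, 0 <= f x)%E ->
  (\int[leb]_x f (x + c)%R = \int[leb]_x f x)%E.
Proof.
move=> mf f0.
have mg : measurable_fun [set: R] (fun x => f (c - x)).
  by apply: (measurableT_comp mf); exact: measurable_funB.
rewrite -(ge0_integral_lebesgue_reflect c mf f0).
rewrite -(ge0_integral_lebesgue_reflect 0 mg); last by move=> x; exact: f0.
by apply: eq_integral => x _; rewrite sub0r opprK addrC.
Qed.

Lemma Rintegral_lebesgue_shift (c : R) (f : R -> R) :
  measurable_fun [set: R] f -> \int[leb]_x f (x + c) = \int[leb]_x f x.
Proof.
move=> mf; have mE : measurable_fun [set: R] (EFin \o f) by exact/measurable_EFinP.
congr fine; rewrite integralE [in RHS]integralE; congr (_ - _)%E.
  have := ge0_integral_lebesgue_shift c (measurable_funepos mE) (fun x => funepos_ge0 _ x).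
  by apply: etrans; apply: eq_integral => x _; rewrite !funeposE.
have := ge0_integral_lebesgue_shift c (measurable_funeneg mE) (fun x => funeneg_ge0 _ x).
by apply: etrans; apply: eq_integral => x _; rewrite !funenegE.
Qed.

(* Splitting [0, t[ into dyadic pieces around t avoids any antiderivative. *)
Lemma integral_power_singularity (th : R) : 0 < th -> th < 1 ->
  exists2 C : R, 0 < C & forall t, 0 <= t ->
    (\int[leb]_x (\1_`[0, t[ x * (t - x) `^ (- th))%:E <= (C * t `^ (1 - th))%:E)%E.
Proof.
move=> th0 th1; pose e := 1 - th; have e0 : 0 < e by rewrite subr_gt0.
pose G := (\esum_(k in [set: int]) (2 `^ (- (e * `|k|%:~R)) : R)%:E)%E.
have Gfin : (G < +oo)%E by exact: esum_int_geometric.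
have G0 : (0 <= G)%E by apply: esum_ge0 => k _; rewrite lee_fin powR_ge0.
exists (2 `^ e * fine G + 1).
  by rewrite ltr_wpDl// mulr_ge0 ?powR_ge0 ?fine_ge0.
move=> t; rewrite le_eqVlt => /predU1P[<-|t0].
  under eq_integral do rewrite set_itvco0 indic0 mul0r.
  by rewrite integral0 lee_fin mulr_ge0 ?powR_ge0// addr_ge0 ?mulr_ge0 ?powR_ge0 ?fine_ge0.
pose I k : set R := `]t - t * 2 `^ k%:~R, t - t * 2 `^ (k%:~R - 1)]%classic.
(* On [I k] the distance t - x lies between t 2^(k-1), included, and t 2^k. For k > 1 it exceeds t,
   so the piece misses [0, t[; k = 1 is kept for the point x = 0. *)
pose c k : R := if k <= 1 then (t * 2 `^ (k%:~R - 1)) `^ (- th) else 0.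
have c0 k : 0 <= c k by rewrite /c; case: ifP => // _; exact: powR_ge0.
have mI k : measurable_fun [set: R] (fun x => (c k * \1_(I k) x)%:E).
  apply/measurable_EFinP; apply: measurable_funM; first exact: measurable_cst.
  by apply: measurable_indic; exact: measurable_itv.
apply: (@le_trans _ _ (\int[leb]_x \esum_(k in [set: int]) (c k * \1_(I k) x)%:E)%E).
  apply: ge0_le_integralT => x; first by rewrite lee_fin mulr_ge0 ?powR_ge0.
  have f0 k : (0 <= (c k * \1_(I k) x)%:E)%E by rewrite lee_fin mulr_ge0.
  rewrite [\1_`[0, t[ x]indicE; have [|_] := boolP (x \in _); last first.
    by rewrite mul0r esum_ge0.
  rewrite inE/= in_itv/= mul1r => /andP[x0 xt].
  have s0 : 0 < (t - x) / t by rewrite divr_gt0// subr_gt0.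
  have [k /andP[k1 k2]] := dyadic_bracket s0.
  have tk1 : t * 2 `^ (k%:~R - 1) <= t - x by rewrite mulrC -ler_pdivlMr.
  have tk2 : t - x < t * 2 `^ k%:~R by rewrite [ltRHS]mulrC -ltr_pdivrMr.
  have k_le1 : k <= 1.
    have : 2 `^ (k%:~R - 1) <= 2 `^ 0 :> R.
      by rewrite powRr0; apply: le_trans k1 _; rewrite ler_pdivrMr// mul1r gerBl.
    by rewrite pow2_le subr_le0 (ler_int _ k 1).
  apply: esum_ge; exists [set k]; [by split|].
  rewrite fsbig_set1 lee_fin indicE mem_set ?mulr1; last first.
    by rewrite /I/= in_itv/=; apply/andP; split; lra.
  rewrite /c k_le1 !powRN lef_pV2 ?posrE ?powR_gt0 ?subr_gt0//; last first.
    by rewrite mulr_gt0 ?pow2_gt0.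
  apply: ge0_ler_powR => //; rewrite ?nnegrE ?mulr_ge0 ?powR_ge0 ?(ltW t0) ?subr_ge0//; exact: ltW.
rewrite integral_esum_int; last 2 first.
- exact: mI.
- by move=> k x; rewrite lee_fin mulr_ge0.
apply: (@le_trans _ _ (\esum_(k in [set: int]) ((t `^ e * 2 `^ e)%:E *
    (2 `^ (- (e * `|k|%:~R)))%:E))%E); last first.
  rewrite esum_intZl; [|by rewrite lee_fin mulr_ge0 ?powR_ge0|by move=> k; rewrite lee_fin powR_ge0].
  rewrite -/G -(fineK (_ : G \is a fin_num)) ?ge0_fin_numE// -EFinM lee_fin.
  rewrite (_ : _ * fine G = 2 `^ e * fine G * t `^ e); last by ring.
  by rewrite mulrDl mul1r lerDl powR_ge0.
apply: le_esum => k _; under eq_integral do rewrite EFinM.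
rewrite ge0_integralZl//; last 2 first.
- apply/measurable_EFinP; apply: measurable_indic; exact: measurable_itv.
- by rewrite lee_fin.
rewrite integral_indic//; last exact: measurable_itv.
rewrite setIT.
have h2 : 2 `^ k%:~R = 2 * 2 `^ (k%:~R - 1) :> R.
  by rewrite -{2}[2 : R]powRr1// -pow2D; congr (_ `^ _); ring.
have z0 : 0 < t * 2 `^ (k%:~R - 1) by rewrite mulr_gt0 ?pow2_gt0.
rewrite [X in (_ * X <= _)%E](_ : _ = (t * 2 `^ (k%:~R - 1))%:E); last first.
  apply: etrans; first exact: lebesgue_measure_itv.
  rewrite /= lte_fin ifT; last by rewrite h2; lra.
  by rewrite -EFinB h2; congr EFin; ring.
rewrite -!EFinM lee_fin.
rewrite /c; case: ifP => [k1|_]; last first.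
  by rewrite mul0r !mulr_ge0 ?powR_ge0.
set z := t * _ in z0 *.
have zE : z `^ (- th) * z = z `^ e.
  rewrite -[X in _ * X]powRr1 ?(ltW z0)// -powRD; last by rewrite (gt_eqF z0) implybT.
  by rewrite addrC.
rewrite zE /z powRM ?powR_ge0 ?(ltW t0)// -powRrM -!mulrA ler_wpM2l ?powR_ge0//.
rewrite -pow2D pow2_le.
have : `|k|%:~R <= 2 - k%:~R :> R.
  by rewrite -[2]/(2%:~R) -intrB ler_int; lia.
by move=> kk; have := ler_wpM2l (ltW e0) kk; rewrite mulrBr; lra.
Qed.

End line_integrals.

Lemma measurable_fun_glue d1 d2 (T1 : measurableType d1) (T2 : measurableType d2)
    (idx : T1 -> nat) (Phi : nat -> T1 -> T2) :
  (forall j, measurable (idx @^-1` [set j])) ->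
  (forall j, measurable_fun setT (Phi j)) ->
  measurable_fun setT (fun x => Phi (idx x) x).
Proof.
move=> midx mPhi _ A mA; rewrite setTI.
rewrite (_ : _ @^-1` A = \bigcup_j ((idx @^-1` [set j]) `&` (Phi j @^-1` A))).
  apply: bigcup_measurable => j _; apply: measurableI => //.
  by rewrite -[X in measurable X]setTI; exact: mPhi.
apply/seteqP; split=> [x Ax|x [j _ [/= <-]]//].
by exists (idx x).
Qed.

Section duhamel.
Context {R : realType} {n : nat}.
Local Notation V := 'rV[R]_n.
Local Notation mu := (@lebesgue_rV R n).
Local Notation leb := (@lebesgue_measure R).
Local Notation MR := (measurableTypeR R).
Variables (q sg gamma : R).
Hypotheses (n0 : (0 < n)%N) (sg0 : 0 < sg) (sg1 : sg < 1).
Local Notation p := (q * sg).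
Hypotheses (p1 : 1 <= p) (g0 : 0 < gamma) (gn : gamma < n%:R).
Local Notation th := ((n%:R - (n%:R - gamma) * sg) / 2).
Hypothesis (th1 : th < 1).
Local Notation al := ((n%:R - gamma) * sg - n%:R / q).
Local Notation al' := (n%:R * (1 - p^-1)).
Local Notation H := (Herz al q).
Local Notation HY := (Herz al' p).
Implicit Types (f g : R -> V -> R) (x y : V) (t T tau : R).

Let p0 : 0 < p. Proof. exact: lt_le_trans p1. Qed.
Let q1 : 1 <= q.
Proof. by apply: le_trans p1 _; rewrite ler_piMr ?ltW// -(pmulr_lgt0 _ sg0). Qed.
Let q0 : 0 < q. Proof. exact: lt_le_trans q1. Qed.
Let d0 : 0 < al + n%:R / q. Proof. by rewrite subrK mulr_gt0// subr_gt0. Qed.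
Let dn : al + n%:R / q < n%:R.
Proof.
rewrite subrK (@lt_trans _ _ (n%:R - gamma))//; last by rewrite gtrBl.
by rewrite gtr_pMr// subr_gt0.
Qed.
Let th0 : 0 < th.
Proof. by rewrite divr_gt0// subr_gt0; move: dn; rewrite subrK. Qed.

Lemma integral_le_herz : exists2 C : R, 0 < C & forall g : V -> \bar R, ge0_mfun g ->
  (\int[mu]_x g x <= C%:E * ge0_herz al' p g)%E.
Proof.
exists (2 `^ al'); first exact: pow2_gt0.
move=> g hg; rewrite integral_annulus_sum// /ge0_herz -esum_intZl; last 2 first.
- by rewrite lee_fin powR_ge0.
- by move=> k; rewrite mule_ge0 ?annulus_Lp_ge0// lee_fin powR_ge0.
apply: le_esum => k _; rewrite muleA -EFinM -pow2D.
rewrite (_ : al' + k%:~R * al' = (k%:~R + 1) * al'); last by rewrite mulrDl mul1r addrC.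
exact: annulus_L1_le.
Qed.

(** A bound at every point x, from L^1 to the supremum. It makes the spatial integrals converge
    everywhere and the Duhamel integrand depend continuously on the source at each point. *)
Lemma ge0_heat_le_herz : exists2 C : R, 0 < C & forall s (g : V -> \bar R) x, 0 < s ->
  ge0_mfun g -> (ge0_heat s g x <= (C * s `^ (- (n%:R / 2)))%:E * ge0_herz al' p g)%E.
Proof.
have [C C0 hC] := integral_le_herz; exists C => // s g x s0 hg.
apply: (@le_trans _ _ ((s `^ (- (n%:R / 2)))%:E * \int[mu]_y g y)%E).
  apply: ge0_heat_le_sup => // [|y _]; first exact: powR_ge0.
  exact: heat_kernel_le_pow.
rewrite [C * _]mulrC EFinM -muleA; apply: lee_wpmul2l; first by rewrite lee_fin powR_ge0.
exact: hC.
Qed.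

Lemma ge0_heat_source_lty s (g : V -> R) x : 0 < s -> measurable_fun setT g ->
  (HY g < +oo)%E -> (ge0_heat s (absf g) x < +oo)%E.
Proof.
move=> s0 mg; rewrite HerzE => gfin; have [C C0 hC] := ge0_heat_le_herz.
apply: le_lt_trans (hC s _ x s0 (ge0_mfun_absf mg)) _.
by rewrite lte_mul_pinfty// lee_fin mulr_ge0 ?powR_ge0// ltW.
Qed.

(** The Duhamel operator is studied on abstract sources, bounded and uniformly continuous in time
    with values in the source space. The explicit bound [K] lets one estimate serve both for growth
    and for differences. *)
Definition source_path T (K : R) f :=
  [/\ forall tau, 0 <= tau <= T -> measurable_fun setT (f tau),
      forall tau, 0 <= tau <= T -> (HY (f tau) <= K%:E)%E &
      forall e : R, 0 < e -> exists2 d : R, 0 < d &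
        forall s tau, 0 <= s <= T -> 0 <= tau <= T -> `|s - tau| < d ->
        (HY (fun x => f s x - f tau x)%R <= e%:E)%E].

(** The interval excludes tau = t, where [heat 0] would return the source itself. Extension by zero
    to the whole line gives a product domain for Fubini's theorem and for shifts in time. *)
Definition duh_ker f t tau x : R := \1_`[0, t[ tau * heat (t - tau) (f tau) x.

Definition duhamel f t x : R := \int[leb]_tau duh_ker f t tau x.

Lemma measurable_duh_ker_cst (g : V -> R) t : measurable_fun setT g ->
  measurable_fun setT (fun z : V * MR => duh_ker (fun=> g) t z.2 z.1).
Proof.
move=> mg; have m1 : measurable_fun setT (fun z : V * MR => \1_`[0, t[ z.2 : R).
  apply: (measurableT_comp (f := fun tau : MR => \1_`[0, t[ tau : R) _ measurable_snd).
  by apply: measurable_indic; exact: measurable_itv.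
(* The kernel with division by 4s replaced by the power -1, which agrees with it for s > 0 and is
   measurable jointly in time and space. *)
pose hk (s : R) (w : V) := (4 * pi * s) `^ (- (n%:R / 2)) *
  expR (- (eucl_norm w ^+ 2 * (4 * s) `^ (-1))).
rewrite (_ : (fun z => _) = (fun z : V * MR => \1_`[0, t[ z.2 *
    \int[mu]_y (hk (t - z.2) (z.1 - y) * g y))); last first.
  apply/funext => -[x tau] /=; rewrite /duh_ker indicE.
  have [|_] := boolP (tau \in _); last by rewrite !mul0r.
  rewrite inE/= in_itv/= => /andP[_ tt]; rewrite 2!mul1r heatE; last by rewrite subr_gt0.
  apply: eq_Rintegral => y _; congr (_ * _); rewrite /heat_kernel /hk.
  by rewrite powR_inv1// mulr_ge0// subr_ge0 ltW.
apply: measurable_funM => //.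
pose G (z : (V * MR) * V) : R := hk (t - z.1.2) (z.1.1 - z.2) * g z.2.
apply: (@measurable_Rintegral_param _ _ R _ _ mu G).
apply: measurable_funM; last exact: (measurableT_comp mg measurable_snd).
have ms : measurable_fun setT (fun z : (V * MR) * V => t - z.1.2).
  apply: measurable_funB => //.
  exact: (measurableT_comp measurable_snd measurable_fst).
apply: measurable_funM.
  apply: (measurableT_comp (measurable_powR _)).
  by apply: measurable_funM.
apply: measurableT_comp => //; apply: measurableT_comp => //.
apply: measurable_funM.
  apply: measurable_funX; apply: (measurableT_comp measurable_eucl_norm).
  apply: measurable_rV_sub; last exact: measurable_snd.
  exact: (measurableT_comp measurable_fst measurable_fst).
apply: (measurableT_comp (measurable_powR _)).
by apply: measurable_funM.
Qed.

Let heat_source_lip : exists2 C : R, 0 < C & forall s (f g : V -> R) x, 0 < s ->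
  measurable_fun setT f -> measurable_fun setT g ->
  (HY f < +oo)%E -> (HY g < +oo)%E ->
  (`|heat s f x - heat s g x|%:E <=
     (C * s `^ (- (n%:R / 2)))%:E * HY (fun x => f x - g x)%R)%E.
Proof.
have [C C0 hC] := ge0_heat_le_herz; exists C => // s f g x s0 mf mg ff fg.
have mfg : measurable_fun setT (fun x => f x - g x) by exact: measurable_funB.
rewrite -heatB//; [|exact: ge0_heat_source_lty|exact: ge0_heat_source_lty].
rewrite HerzE; apply: le_trans (hC s _ x s0 (ge0_mfun_absf mfg)).
exact: absf_heat_le.
Qed.

Lemma measurable_duh_ker T K f t : source_path T K f -> t <= T ->
  measurable_fun setT (fun z : V * MR => duh_ker f t z.2 z.1).
Proof.
move=> [mf Kf cf] tT.
(* f is only continuous in time with values in HY, so joint measurability is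
   obtained as the limit of paths that are piecewise constant in time. *)
pose idx (m : nat) (z : V * MR) : nat := Num.trunc (Num.max 0 (m.+1%:R * z.2)).
(* Time is rounded down to the grid of mesh 1/(m + 1). The test against [T] discards the grid times
   at which nothing is known about [f]; for tau < t the rounded time stays below [T]. *)
pose P m j (z : V * MR) : R := if j%:R / m.+1%:R <= T
  then duh_ker (fun=> f (j%:R / m.+1%:R)) t z.2 z.1 else 0.
apply: (@measurable_fun_cvg _ _ R setT (fun m z => P m (idx m z) z)).
  move=> m; apply: measurable_fun_glue => j; last first.
    have [jT|jT] := boolP (j%:R / m.+1%:R <= T); last first.
      rewrite (_ : P m j = fun=> 0); first exact: measurable_cst.
      by apply/funext => z; rewrite /P (negbTE jT).
    have -> : P m j = fun z => duh_ker (fun=> f (j%:R / m.+1%:R)) t z.2 z.1.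
      by apply/funext => z; rewrite /P jT.
    by apply: measurable_duh_ker_cst; apply: mf; rewrite divr_ge0.
  rewrite -[X in measurable X]setTI.
  pose h (z : V * MR) : R := Num.max 0 (m.+1%:R * z.2).
  have mh : measurable_fun setT h.
    by apply: measurable_maxr; [exact: measurable_cst|exact: measurable_funM].
  rewrite (_ : _ @^-1` _ = h @^-1` `[j%:R, j.+1%:R[%classic).
    by apply: mh => //; exact: measurable_itv.
  apply/seteqP; split=> z /=; rewrite /idx -/(h z) in_itv/=.
    by move=> /eqP; rewrite truncn_eq// le_max lexx.
  by move=> hj; apply/eqP; rewrite truncn_eq// le_max lexx.
move=> [x tau] _ /=.
have [|tn] := boolP (tau \in `[0, t[%classic); last first.
  rewrite (_ : (fun m => _) = fun=> 0); last first.
    apply/funext => m; rewrite /P /duh_ker; case: ifP => // _.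
    by rewrite indicE (negbTE tn) mul0r.
  by rewrite /duh_ker indicE (negbTE tn) mul0r; exact: cvg_cst.
rewrite inE/= in_itv/= => /andP[tau0 taut].
have s0 : 0 < t - tau by rewrite subr_gt0.
have tauT : tau <= T by rewrite (le_trans (ltW taut)).
have [C C0 hC] := heat_source_lip.
apply/cvgrPdist_le => /= e e0.
pose e' := e / (C * (t - tau) `^ (- (n%:R / 2))).
have c0 : 0 < C * (t - tau) `^ (- (n%:R / 2)) by rewrite mulr_gt0// powR_gt0.
have e'0 : 0 < e' by rewrite divr_gt0.
have [d dgt0 hd] := cf e' e'0.
have : \forall m \near \oo, (m.+1%:R^-1 : R) < d.
  have := @cvg_harmonic R => /cvgrPdist_lt/(_ d dgt0); apply: filterS => m.
  by rewrite /= sub0r normrN ger0_norm.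
apply: filterS => m md.
have m0 : 0 < m.+1%:R :> R by rewrite ltr0n.
pose s := (idx m (x, tau))%:R / m.+1%:R : R.
have /andP[t1 t2] : (idx m (x, tau))%:R <= m.+1%:R * tau < (idx m (x, tau)).+1%:R.
  by rewrite /idx /= max_r ?mulr_ge0//; apply: truncn_itv; rewrite mulr_ge0.
have s_le : s <= tau by rewrite /s ler_pdivrMr// mulrC.
have s_ge : tau < s + m.+1%:R^-1.
  by rewrite /s -[X in _ + X]mul1r -mulrDl ltr_pdivlMr// mulrC natr1.
have s_ge0 : 0 <= s by rewrite divr_ge0.
have sT : 0 <= s <= T by rewrite s_ge0 (le_trans s_le).
have tT' : 0 <= tau <= T by rewrite tau0.
rewrite /P -/s (andP sT).2 /duh_ker /= indicE mem_set ?mul1r; last first.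
  by rewrite /= in_itv/= tau0.
rewrite -lee_fin; apply: le_trans (hC _ _ _ _ s0 (mf _ tT') (mf _ sT) _ _) _.
- by rewrite (le_lt_trans (Kf _ tT'))// ltry.
- by rewrite (le_lt_trans (Kf _ sT))// ltry.
apply: (@le_trans _ _ ((C * (t - tau) `^ (- (n%:R / 2)))%:E * e'%:E)%E).
  apply: lee_wpmul2l; first by rewrite lee_fin ltW.
  apply: hd => //; rewrite ger0_norm ?subr_ge0//.
  by apply: le_lt_trans md; rewrite lerBlDl ltW.
by rewrite -EFinM lee_fin mulrC divfK// gt_eqF.
Qed.

Lemma source_pathB T K1 K2 f g : source_path T K1 f -> source_path T K2 g ->
  source_path T (K1 + K2) (fun tau x => f tau x - g tau x).
Proof.
move=> [mf Kf cf] [mg Kg cg]; split=> [tau tT|tau tT|e e0].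
- by apply: measurable_funB; [exact: mf|exact: mg].
- apply: le_trans (HerzB _ p1 (mf _ tT) (mg _ tT)) _.
  by rewrite EFinD; apply: leeD; [exact: Kf|exact: Kg].
have [d1 d10 h1] := cf _ (divr_gt0 e0 (ltr0n _ 2)).
have [d2 d20 h2] := cg _ (divr_gt0 e0 (ltr0n _ 2)).
exists (Num.min d1 d2) => [|s tau sT tT]; first by rewrite lt_min d10.
rewrite lt_min => /andP[s1 s2].
rewrite (_ : (fun x => _) =
    (fun x => (f s x - f tau x) - (g s x - g tau x))); last first.
  by apply/funext => x; ring.
have mfs := measurable_funB (mf _ sT) (mf _ tT).
have mgs := measurable_funB (mg _ sT) (mg _ tT).
apply: le_trans (HerzB _ p1 mfs mgs) _.
by rewrite [e]splitr EFinD; apply: leeD; [exact: h1|exact: h2].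
Qed.

Lemma source_path_shift T K f s : 0 <= s -> source_path T K f ->
  source_path (T - s) K (fun tau => f (tau + s)).
Proof.
move=> s0 [mf Kf cf].
have sh tau : 0 <= tau <= T - s -> 0 <= tau + s <= T.
  by move=> /andP[h1 h2]; rewrite addr_ge0//=; lra.
split=> [tau /sh|tau /sh|e e0]; [exact: mf|exact: Kf|].
have [d dgt0 hd] := cf e e0; exists d => // r tau /sh h1 /sh h2 h.
by apply: hd => //; rewrite opprD addrACA subrr addr0.
Qed.

Lemma source_path_le T T' K f : T' <= T -> source_path T K f -> source_path T' K f.
Proof.
move=> T'T [mf Kf cf].
have sh tau : 0 <= tau <= T' -> 0 <= tau <= T.
  by move=> /andP[-> h]; exact: le_trans T'T.
split=> [tau /sh|tau /sh|e e0]; [exact: mf|exact: Kf|].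
by have [d dgt0 hd] := cf e e0; exists d => // r tau /sh h1 /sh h2; exact: hd.
Qed.

Let mker_abs T K f t : source_path T K f -> t <= T ->
  ge0_mfun (fun z : V * MR => `|duh_ker f t z.2 z.1|%:E).
Proof.
move=> hf tT; split=> [|z]; last by rewrite lee_fin.
apply/measurable_EFinP; apply: measurableT_comp => //.
exact: measurable_duh_ker hf tT.
Qed.

Let mker_x T K f t x : source_path T K f -> t <= T ->
  measurable_fun [set: MR] (fun tau => duh_ker f t tau x).
Proof.
move=> hf tT.
apply: (measurableT_comp (f := fun z : V * MR => duh_ker f t z.2 z.1)
  (g := fun tau : MR => (x, tau))).
  exact: measurable_duh_ker hf tT.
by apply/measurable_fun_pairP; split; [exact: measurable_cst|exact: measurable_id].
Qed.

Let mker_tau T K f t tau : source_path T K f -> t <= T ->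
  measurable_fun [set: V] (duh_ker f t tau).
Proof.
move=> hf tT.
apply: (measurableT_comp (f := fun z : V * MR => duh_ker f t z.2 z.1)
  (g := fun x : V => (x, tau : MR))).
  exact: measurable_duh_ker hf tT.
by apply/measurable_fun_pairP; split; [exact: measurable_id|exact: measurable_cst].
Qed.

Lemma ge0_herz_duh_ker : exists2 C : R, 0 < C & forall T K f t, source_path T K f ->
  0 <= K -> 0 <= t <= T ->
  (ge0_herz al q (fun x => \int[leb]_tau `|duh_ker f t tau x|%:E) <=
    (C * K * t `^ (1 - th))%:E)%E.
Proof.
have [K0 K00 hK0] := ge0_herz_heat_smoothing n0 sg0 sg1 p1 g0 gn.
have [C0 C00 hC0] := integral_power_singularity th0 th1.
exists (K0 * C0); first exact: mulr_gt0.
move=> T K f t hf Kge0 /andP[t0 tT].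
have [mf Kf _] := hf.
have hF := mker_abs hf tT.
(* The standard normal density serves as the positive weight of mass 1 that Minkowski's inequality
   needs on the line. *)
have w0 (x : MR) : 0 < normal_pdf (0 : R) 1 x.
  by rewrite normal_pdfE ?oner_eq0// mulr_gt0 ?normal_peak_gt0 ?oner_eq0// expR_gt0.
have w1 : (\int[leb]_x (normal_pdf (0 : R) 1 x)%:E <= 1)%E.
  by rewrite integral_normal_pdf// oner_eq0.
apply: le_trans (@ge0_herz_minkowski R n _ MR leb (normal_pdf 0 1)
  (measurable_normal_pdf _ _) w0 w1 al q _ q1 hF) _.
apply: (@le_trans _ _ (\int[leb]_tau ((K0 * K)%:E *
    (\1_`[0, t[ tau * (t - tau) `^ (- th))%:E))%E).
  apply: ge0_le_integralT => tau /=; first exact: ge0_herz_ge0.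
  have mt := mker_tau tau hf tT.
  have -> : ge0_herz al q (fun x => `|duh_ker f t tau x|%:E)%E = H (duh_ker f t tau).
    by rewrite HerzE.
  rewrite /duh_ker indicE; have [|_] := boolP (tau \in _); last first.
    rewrite (_ : (fun x => _) = (fun x => 0 * duh_ker f t tau x)); last first.
      by apply/funext => x; rewrite !mul0r.
    by rewrite HerzZ// normr0 mul0e mul0r mule0.
  rewrite inE/= in_itv/= => /andP[tau0 taut].
  have s0 : 0 < t - tau by rewrite subr_gt0.
  have tauT : 0 <= tau <= T by rewrite tau0 (le_trans (ltW taut)).
  rewrite (_ : (fun x => _) = heat (t - tau) (f tau)); last first.
    by apply/funext => x; rewrite mul1r.
  have ha := ge0_mfun_absf (mf _ tauT).
  apply: (@le_trans _ _ (ge0_herz al q (ge0_heat (t - tau) (absf (f tau))))).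
    apply: Herz_le_ge0 => //; first by apply: measurable_heat; exact: mf.
      exact: ge0_mfun_heat.
    by apply: aeW => x; apply: absf_heat_le => //; exact: mf.
  apply: le_trans (hK0 _ _ s0 ha) _.
  rewrite -HerzE mul1r -EFinM mulrAC [leRHS]EFinM.
  apply: lee_wpmul2l; last exact: Kf.
  by rewrite lee_fin mulr_ge0 ?powR_ge0// ltW.
rewrite ge0_integralZl//; last 3 first.
- apply/measurable_EFinP; apply: measurable_funM.
    by apply: measurable_indic; exact: measurable_itv.
  by apply: (measurableT_comp (measurable_powR _)); exact: measurable_funB.
- by move=> x _; rewrite lee_fin mulr_ge0 ?powR_ge0.
- by rewrite lee_fin mulr_ge0// ltW.
rewrite (_ : K0 * C0 * K * t `^ (1 - th) = (K0 * K) * (C0 * t `^ (1 - th))); last by ring.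
rewrite [leRHS]EFinM; apply: lee_wpmul2l; last exact: hC0.
by rewrite lee_fin mulr_ge0// ltW.
Qed.

Lemma ge0_mfun_int_duh_ker T K f t : source_path T K f -> t <= T ->
  ge0_mfun (fun x => \int[leb]_tau `|duh_ker f t tau x|%:E)%E.
Proof.
move=> hf tT; have hF := mker_abs hf tT.
split=> [|x]; last by apply: integral_ge0 => tau _; rewrite lee_fin.
have [mF F0] := hF; exact: (measurable_fun_fubini_tonelli_F (m2 := leb)
  (fun z : V * MR => `|duh_ker f t z.2 z.1|%:E)).
Qed.

Lemma duh_ker_integrable T K f t x : source_path T K f -> t <= T ->
  (\int[leb]_tau `|duh_ker f t tau x|%:E < +oo)%E ->
  leb.-integrable setT (fun tau => (duh_ker f t tau x)%:E).
Proof.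
move=> hf tT fin; apply/integrableP; split=> //.
by apply/measurable_EFinP; exact: mker_x hf tT.
Qed.

Lemma duh_ker_integrable_ae T K f t : source_path T K f -> 0 <= K -> 0 <= t <= T ->
  \forall x \ae mu, (\int[leb]_tau `|duh_ker f t tau x|%:E < +oo)%E.
Proof.
move=> hf K0 tT; have [C C0 hC] := ge0_herz_duh_ker.
apply: (ge0_herz_lty_ae (al := al) n0 q0 (ge0_mfun_int_duh_ker hf (andP tT).2)).
by apply: le_lt_trans (hC _ _ _ _ hf K0 tT) _; exact: ltry.
Qed.

Lemma measurable_duhamel T K f t : source_path T K f -> t <= T ->
  measurable_fun setT (duhamel f t).
Proof.
move=> hf tT; apply: (@measurable_Rintegral_param _ _ R _ _ leb
  (fun z : V * MR => duh_ker f t z.2 z.1)).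
exact: measurable_duh_ker hf tT.
Qed.

Lemma absf_duhamel_le T K f t x : source_path T K f -> t <= T ->
  (absf (duhamel f t) x <= \int[leb]_tau `|duh_ker f t tau x|%:E)%E.
Proof.
move=> hf tT; rewrite /absf /duhamel; apply: normr_Rintegral_le => //.
exact: mker_x hf tT.
Qed.

Lemma Herz_duhamel : exists2 C : R, 0 < C & forall T K f t, source_path T K f ->
  0 <= K -> 0 <= t <= T -> (H (duhamel f t) <= (C * K * t `^ (1 - th))%:E)%E.
Proof.
have [C C0 hC] := ge0_herz_duh_ker; exists C => // T K f t hf K0 tT.
apply: le_trans (hC _ _ _ _ hf K0 tT); have /andP[_ tT'] := tT.
apply: Herz_le_ge0 => //.
- exact: measurable_duhamel hf tT'.
- exact: ge0_mfun_int_duh_ker hf tT'.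
by apply: aeW => x; exact: absf_duhamel_le hf tT'.
Qed.

Let heat_fin T K f tau s x : source_path T K f -> 0 <= tau <= T -> 0 < s ->
  (ge0_heat s (absf (f tau)) x < +oo)%E.
Proof.
move=> [mf Kf _] tT s0; apply: ge0_heat_source_lty => //; first exact: mf.
by apply: le_lt_trans (Kf _ tT) _; exact: ltry.
Qed.

Lemma duhamelB T K1 K2 f g t : source_path T K1 f -> source_path T K2 g ->
  0 <= K1 -> 0 <= K2 -> 0 <= t <= T ->
  \forall x \ae mu, duhamel (fun tau x => f tau x - g tau x) t x =
    duhamel f t x - duhamel g t x.
Proof.
move=> hf hg K10 K20 tT; have /andP[_ tT'] := tT.
apply: filterS2 (duh_ker_integrable_ae hf K10 tT) (duh_ker_integrable_ae hg K20 tT).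
move=> x fx gx; rewrite /duhamel -RintegralB//; last 2 first.
- exact: duh_ker_integrable hf tT' fx.
- exact: duh_ker_integrable hg tT' gx.
apply: eq_Rintegral => tau _; rewrite /duh_ker indicE.
have [|_] := boolP (tau \in _); last by rewrite !mul0r subr0.
rewrite inE/= in_itv/= => /andP[tau0 taut]; rewrite !mul1r.
have tauT : 0 <= tau <= T by rewrite tau0 (le_trans (ltW taut)).
have s0 : 0 < t - tau by rewrite subr_gt0.
have [mf _ _] := hf; have [mg _ _] := hg.
apply: heatB => //; [exact: mf|exact: mg|exact: heat_fin hf _ _|exact: heat_fin hg _ _].
Qed.

(** The integral is split at time s. Before s, the factor exp(t Laplacian) is pulled out of the
    semigroup and, by Fubini's theorem, out of the time integral; after s, a shift of time gives the
    second term. *)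
Lemma duhamel_restart T K f s t : source_path T K f -> 0 <= K ->
  0 < s -> 0 < t -> s + t <= T ->
  \forall x \ae mu, duhamel f (s + t) x =
    heat t (duhamel f s) x + duhamel (fun tau => f (tau + s)) t x.
Proof.
move=> hf K0 s0 t0 stT; have [mf Kf _] := hf.
have sT : s <= T by lra.
have sT' : 0 <= s <= T by rewrite sT ltW.
have stT' : 0 <= s + t <= T by rewrite stT addr_ge0// ltW.
have [C C0 hC] := ge0_herz_duh_ker.
have hG := ge0_mfun_int_duh_ker hf sT.
set G := (fun x => _) in hG.
(* The absolute convergence for Fubini's theorem, obtained for almost every x from the boundedness
   of the semigroup. *)
have Gfin : \forall x \ae mu, (ge0_heat t G x < +oo)%E.
  have [c c0 hc] := ge0_herz_heat_le n0 q1 d0 dn.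
  apply: (ge0_herz_lty_ae (al := al) n0 q0 (ge0_mfun_heat t hG)).
  apply: le_lt_trans (hc _ _ t0 hG) _.
  apply: (@le_lt_trans _ _ (c%:E * (C * K * s `^ (1 - th))%:E)%E); last by rewrite -EFinM ltry.
  by apply: lee_wpmul2l; [rewrite lee_fin ltW|exact: hC hf K0 sT'].
apply: filterS2 Gfin (duh_ker_integrable_ae hf K0 stT') => x Gx fx.
pose k1 tau : R := \1_`[0, s[ tau * heat (s + t - tau) (f tau) x.
pose k2 tau : R := \1_`[s, s + t[ tau * heat (s + t - tau) (f tau) x.
have mk := mker_x x hf stT.
have kE tau : duh_ker f (s + t) tau x = k1 tau + k2 tau.
  rewrite /duh_ker /k1 /k2 -mulrDl; congr (_ * _).
  rewrite !indicE !mem_setE !in_itv/=.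
  have [ts|ts] := ltP tau s; rewrite ?andbT ?andbF/= ?addr0 ?add0r.
    by rewrite (lt_trans ts) ?andbT// ltrDl.
  by rewrite (le_trans (ltW s0) ts).
have k1E tau : k1 tau = \1_`[0, s[ tau * duh_ker f (s + t) tau x.
  rewrite kE /k1 /k2 !indicE !mem_setE !in_itv/=.
  by have [ts|ts] := ltP tau s; rewrite ?andbT ?andbF/= ?mul0r ?addr0 ?mulrA -?natrM ?mulnb ?andbb.
have k2E tau : k2 tau = \1_`[s, s + t[ tau * duh_ker f (s + t) tau x.
  rewrite kE /k1 /k2 !indicE !mem_setE !in_itv/=.
  by have [ts|ts] := ltP tau s; rewrite ?andbT ?andbF/= ?mul0r ?add0r ?mulrA -?natrM ?mulnb ?andbb.
have int_ind (a b : R) : leb.-integrable setT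
    (fun tau => (\1_`[a, b[ tau * duh_ker f (s + t) tau x)%:E).
  have mi : measurable_fun [set: MR] (fun tau => \1_`[a, b[ tau * duh_ker f (s + t) tau x).
    exact: measurable_funM.
  apply: (le_integrable _ _ _ (duh_ker_integrable hf stT fx)) => //.
    exact/measurable_EFinP.
  move=> tau _; rewrite lee_fin normrM ler_piMl//.
  by rewrite indicE; case: (_ \in _); rewrite ?normr1 ?normr0.
have -> : duhamel f (s + t) x = \int[leb]_tau k1 tau + \int[leb]_tau k2 tau.
  rewrite /duhamel -RintegralD//.
  - by apply: eq_Rintegral => tau _; exact: kE.
  - by apply: eq_integrable (int_ind 0 s) => // tau _; rewrite /= k1E.
  - by apply: eq_integrable (int_ind s (s + t)) => // tau _; rewrite /= k2E.
congr (_ + _); last first.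
  rewrite -(Rintegral_lebesgue_shift s); last first.
    rewrite (_ : k2 = fun tau => \1_`[s, s + t[ tau * duh_ker f (s + t) tau x); last first.
      by apply/funext.
    exact: measurable_funM.
  apply: eq_Rintegral => tau _; rewrite /k2 /duh_ker.
  rewrite (_ : s + t - (tau + s) = t - tau); last by ring.
  congr (_ * _); rewrite !indicE !mem_setE !in_itv/=.
  by rewrite lerDr [s + t]addrC ltrD2r.
pose F (z : MR * V) : R := heat_kernel t (x - z.2) * duh_ker f s z.1 z.2.
have mF : measurable_fun setT F.
  apply: measurable_funM.
    apply: (measurableT_comp (measurable_heat_kernel t)).
    by apply: measurable_rV_sub; [exact: measurable_cst|exact: measurable_snd].
  apply: (measurableT_comp (measurable_duh_ker hf sT) (f := fun z : V * MR => duh_ker f s z.2 z.1)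
     (g := fun z : MR * V => (z.2, z.1))).
  by apply/measurable_fun_pairP; split; [exact: measurable_snd|exact: measurable_fst].
transitivity (\int[leb]_tau \int[mu]_y F (tau, y)).
  apply: eq_Rintegral => tau _; rewrite /k1 /F /= /duh_ker indicE.
  have [|_] := boolP (tau \in _); last first.
    rewrite mul0r; apply/esym.
    rewrite (_ : (fun y => _) = fun=> 0); last by apply/funext => y; rewrite mul0r mulr0.
    by rewrite /Rintegral integral0.
  rewrite inE/= in_itv/= => /andP[tau0 taus].
  have tauT : 0 <= tau <= T by rewrite tau0 (le_trans (ltW taus)).
  have st0 : 0 < s - tau by rewrite subr_gt0.
  rewrite mul1r (_ : s + t - tau = t + (s - tau)); last by ring.
  rewrite -heat_semigroup//; last 2 first.
  - exact: mf.
  - by apply: heat_fin hf tauT _; rewrite addr_gt0.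
  by rewrite heatE//; apply: eq_Rintegral => y _; rewrite mul1r.
rewrite Rintegral_exchange//; last first.
  have mF' : measurable_fun setT (fun z : MR * V => `|F z|%:E).
    by apply/measurable_EFinP; exact: measurableT_comp.
  rewrite (fubini_tonelli (m1 := leb) (m2 := mu) (fun z => `|F z|%:E))//.
  apply: le_lt_trans Gx; rewrite /ge0_heat le_eqVlt; apply/orP; left; apply/eqP.
  apply: eq_integral => y _ /=.
  have mky : measurable_fun [set: MR] (fun tau => `|duh_ker f s tau y|%:E).
    by apply/measurable_EFinP; apply: measurableT_comp => //; exact: mker_x hf sT.
  have hk0 : (0 <= (heat_kernel t (x - y))%:E)%E by rewrite lee_fin heat_kernel_ge0.
  have nn (tau : MR) : setT tau -> (0 <= `|duh_ker f s tau y|%:E)%E by rewrite lee_fin.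
  transitivity (\int[leb]_tau ((heat_kernel t (x - y))%:E * `|duh_ker f s tau y|%:E))%E.
    apply: eq_integral => tau _; rewrite /F /= normrM (ger0_norm (heat_kernel_ge0 _ _)).
    by rewrite EFinM.
  exact: (ge0_integralZl leb measurableT mky nn hk0).
rewrite heatE//; apply: ae_eq_Rintegral => //.
- apply: (@measurable_Rintegral_param _ _ R _ _ leb (fun z : V * MR => F (z.2, z.1))).
  apply: (measurableT_comp mF (g := fun z : V * MR => (z.2, z.1))).
  by apply/measurable_fun_pairP; split; [exact: measurable_snd|exact: measurable_fst].
- apply: measurable_funM; last exact: measurable_duhamel hf sT.
  by apply/measurable_EFinP; exact: measurable_heat_kernel_sub.
apply: filterS (duh_ker_integrable_ae hf K0 sT') => y fy _.
by rewrite /F /= RintegralZl//; exact: duh_ker_integrable hf sT fy.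
Qed.

End duhamel.

Lemma powR_small {R : realType} (r A e : R) : 0 < r -> 0 <= A -> 0 < e ->
  exists2 d : R, 0 < d & forall h, 0 < h < d -> A * h `^ r <= e.
Proof.
move=> r0 A0 egt0; have A1 : 0 < A + 1 by rewrite ltr_wpDl.
exists ((e / (A + 1)) `^ r^-1); first by rewrite powR_gt0// divr_gt0.
move=> h /andP[h0 hd].
apply: (@le_trans _ _ ((A + 1) * (e / (A + 1)))); last by rewrite mulrC divfK// gt_eqF.
apply: ler_pM => //; [exact: powR_ge0|by rewrite lerDl|].
have := ge0_ler_powR (ltW r0) (ltW h0) (powR_ge0 _ _) (ltW hd).
by rewrite -powRrM mulVf ?gt_eqF// powRr1// divr_ge0// ltW.
Qed.

(** * Picard iteration *)

Section picard.
Context {R : realType} {n : nat}.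
Local Notation V := 'rV[R]_n.
Local Notation mu := (@lebesgue_rV R n).
Variables (a q beta gamma : R).
Local Notation sg := (beta + 1)^-1.
Local Notation p := (q * sg).
Local Notation th := ((n%:R - (n%:R - gamma) * sg) / 2).
Local Notation al := ((n%:R - gamma) / (beta + 1) - n%:R / q).
Local Notation al' := (n%:R * (1 - p^-1)).
Local Notation H := (Herz al q).
Local Notation HY := (Herz al' p).
Local Notation F := (@hardy_henon_source R n gamma beta).
Hypotheses (n0 : (0 < n)%N) (b0 : 0 < beta) (g0 : 0 < gamma) (gn : gamma < n%:R).
Hypotheses (th1 : th < 1) (bq : beta + 1 <= q).
Implicit Types (f g u v : R -> V -> R) (x y : V) (t T tau : R).

Let b1 : 0 < beta + 1. Proof. by rewrite addr_gt0. Qed.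
Let sg0 : 0 < sg. Proof. by rewrite invr_gt0. Qed.
Let sg1 : sg < 1. Proof. by rewrite invf_lt1// ltrDr. Qed.
Let q0 : 0 < q. Proof. exact: lt_le_trans bq. Qed.
Let q1 : 1 <= q. Proof. by apply: le_trans bq; rewrite lerDr ltW. Qed.
Let p1 : 1 <= p. Proof. by rewrite ler_pdivlMr// mul1r. Qed.
Let p0 : 0 < p. Proof. exact: lt_le_trans p1. Qed.
Let d0 : 0 < al + n%:R / q. Proof. by rewrite subrK mulr_gt0// subr_gt0. Qed.
Let dn : al + n%:R / q < n%:R.
Proof.
rewrite subrK (@lt_trans _ _ (n%:R - gamma))//; last by rewrite gtrBl.
by rewrite gtr_pMr// subr_gt0.
Qed.
Let e0 : 0 < 1 - th. Proof. by rewrite subr_gt0. Qed.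
Let H_ge0 (f : V -> R) : (0 <= H f)%E. Proof. exact: Herz_ge0. Qed.

Let Herz0 : H (fun _ : V => 0) = 0%E.
Proof.
have : H (fun x : V => 0 * 0) = 0%E.
  by rewrite HerzZ ?normr0 ?mul0e//; exact: measurable_cst.
by rewrite mulr0.
Qed.

Let HerzD_le (f g : V -> R) (r s : R) : measurable_fun setT f -> measurable_fun setT g ->
  (H f <= r%:E)%E -> (H g <= s%:E)%E -> (H (fun x => f x + g x)%R <= (r + s)%:E)%E.
Proof.
move=> mf mg fr gs; apply: le_trans (HerzD al q1 mf mg) _.
by rewrite EFinD; exact: leeD.
Qed.

Let HerzZ_le (c : R) (f : V -> R) (r : R) : measurable_fun setT f ->
  (H f <= r%:E)%E -> (H (fun x => c * f x)%R <= (`|c| * r)%:E)%E.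
Proof. by move=> mf fr; rewrite HerzZ// EFinM lee_wpmul2l. Qed.

Lemma Herz_triangle (f g h : V -> R) (r s : R) : measurable_fun setT f ->
  measurable_fun setT g -> measurable_fun setT h ->
  (H (fun x => f x - g x)%R <= r%:E)%E -> (H (fun x => g x - h x)%R <= s%:E)%E ->
  (H (fun x => f x - h x)%R <= (r + s)%:E)%E.
Proof.
move=> mf mg mh h1 h2.
rewrite (_ : (fun x => _) = (fun x => (f x - g x) + (g x - h x))); last first.
  by apply/funext => x; ring.
by apply: HerzD_le => //; exact: measurable_funB.
Qed.

(** Continuity into the Herz space in uniform form, which passes directly to sources and Duhamel
    integrals; [herz_continuous_good] shows that on [0, T] it follows from continuity. *)
Definition good T u :=
  (forall t, 0 <= t <= T -> in_Herz al q (u t)) /\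
  forall e : R, 0 < e -> exists2 d : R, 0 < d &
    forall s t, 0 <= s <= T -> 0 <= t <= T -> `|s - t| < d ->
    (H (fun x => u s x - u t x)%R <= e%:E)%E.

Lemma good_wlog T u : (forall t, 0 <= t <= T -> in_Herz al q (u t)) ->
  (forall e : R, 0 < e -> exists2 d : R, 0 < d &
    forall s h, 0 <= s -> 0 < h < d -> s + h <= T ->
    (H (fun x => u (h + s) x - u s x)%R <= e%:E)%E) -> good T u.
Proof.
move=> hu h; split=> // e egt0; have [d dgt0 hd] := h e egt0; exists d => // s t.
wlog st : s t / s <= t.
  move=> hw sT tT; have [/hw|/ltW/hw] := leP s t; first exact.
  by move=> h' d'; rewrite HerzBC; apply: h' => //; rewrite distrC.
move=> /andP[s0 sT] /andP[t0 tT]; rewrite distrC ger0_norm ?subr_ge0// => ts.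
move: st; rewrite le_eqVlt => /predU1P[->|st].
  rewrite (_ : (fun x => _) = (fun x => 0 * u t x)); last first.
    by apply/funext => x; rewrite subrr mul0r.
  by rewrite HerzZ ?normr0 ?mul0e ?lee_fin ?(ltW egt0)//; apply: (hu t _).1; rewrite t0.
rewrite HerzBC; have := hd s (t - s) s0; rewrite subr_gt0 st ts => /(_ isT).
by rewrite [s + _]addrC !subrK => /(_ tT).
Qed.

Lemma good_le T T' u : T' <= T -> good T u -> good T' u.
Proof.
move=> T'T [hu cu].
have sh t : 0 <= t <= T' -> 0 <= t <= T by move=> /andP[-> h]; exact: le_trans T'T.
split=> [t /sh|e egt0]; first exact: hu.
by have [d dgt0 hd] := cu e egt0; exists d => // s t /sh h1 /sh h2; exact: hd.
Qed.

Lemma good_shift T u s : 0 <= s -> good T u -> good (T - s) (fun t => u (t + s)).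
Proof.
move=> s0 [hu cu].
have sh t : 0 <= t <= T - s -> 0 <= t + s <= T.
  by move=> /andP[h1 h2]; rewrite addr_ge0//=; lra.
split=> [t /sh|e egt0]; first exact: hu.
have [d dgt0 hd] := cu e egt0; exists d => // r t /sh h1 /sh h2 h.
by apply: hd => //; rewrite opprD addrACA subrr addr0.
Qed.

Lemma good_ae_eq T u v : good T u -> (forall t, 0 <= t <= T ->
    measurable_fun setT (v t) /\ \forall x \ae mu, v t x = u t x) -> good T v.
Proof.
move=> [hu cu] vu; split=> [t tT|e egt0].
  have [mv vE] := vu t tT; split => //.
  by rewrite (Herz_ae_eq al q0 mv (hu t tT).1 vE); exact: (hu t tT).2.
have [d dgt0 hd] := cu e egt0; exists d => // s t sT tT st.
have [mvs vsE] := vu s sT; have [mvt vtE] := vu t tT.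
have [mus _] := hu s sT; have [mut _] := hu t tT.
rewrite (Herz_ae_eq al q0 (measurable_funB mvs mvt) (measurable_funB mus mut)).
  exact: hd.
by apply: filterS2 vsE vtE => x /= -> ->.
Qed.

(** With d the modulus for e = 1, each step of length d/2 increases the norm by at most 1. *)
Lemma good_bounded T u : good T u -> exists2 M : R, 0 < M &
  forall t, 0 <= t <= T -> (H (u t) <= M%:E)%E.
Proof.
move=> [hu cu]; have [T0|T0] := leP 0 T; last first.
  by exists 1 => // t /andP[h1 h2]; have := le_lt_trans (le_trans h1 h2) T0; rewrite ltxx.
have [d dgt0 hd] := cu 1 ltr01.
have h0 : (0 : R) <= 0 <= T by apply/andP.
have [m0' f0] := hu 0 h0.
pose M0 := fine (H (u 0)).
have M0E : H (u 0) = M0%:E by rewrite fineK// ge0_fin_numE.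
have step (k : nat) t : 0 <= t <= T -> t <= k%:R * (d / 2) -> (H (u t) <= (M0 + k%:R)%:E)%E.
  elim: k t => [|k IH] t tT.
    rewrite mul0r addr0 -M0E => t0; rewrite (_ : t = 0)//.
    by apply/eqP; rewrite eq_le t0 (andP tT).1.
  rewrite -natr1 mulrDl mul1r => tk.
  have [tk'|tk'] := leP t (k%:R * (d / 2)).
    by apply: le_trans (IH _ tT tk') _; rewrite lee_fin; lra.
  pose s := Num.max 0 (t - d / 2).
  have s_le : s <= t by rewrite ge_max (andP tT).1 gerBl; lra.
  have sT : 0 <= s <= T by rewrite le_max lexx (le_trans s_le (andP tT).2).
  have sk : s <= k%:R * (d / 2) by rewrite ge_max mulr_ge0//; lra.
  have st : `|t - s| < d.
    rewrite ger0_norm ?subr_ge0//.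
    have : t - d / 2 <= s by rewrite le_max lexx orbT.
    lra.
  rewrite (_ : u t = fun x => (u t x - u s x) + u s x); last first.
    by apply/funext => x; rewrite subrK.
  rewrite (_ : M0 + _ = 1 + (M0 + k%:R)); last by ring.
  apply: HerzD_le; [|exact: (hu s sT).1|exact: hd|exact: IH].
  by apply: measurable_funB; [exact: (hu t tT).1|exact: (hu s sT).1].
have d2 : 0 < d / 2 by rewrite divr_gt0.
pose k := (Num.trunc (T / (d / 2))).+1.
have hk : T <= k%:R * (d / 2).
  by rewrite -ler_pdivrMr//; apply/ltW; exact: truncnS_gt.
exists (M0 + k%:R); first by rewrite ltr_wpDl// fine_ge0.
by move=> t tT; apply: step => //; apply: le_trans hk; exact: (andP tT).2.
Qed.

Lemma good_source_path : exists2 C : R, 0 < C & forall T u v (M D : R),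
  good T u -> good T v -> 0 <= M ->
  (forall t, 0 <= t <= T -> (H (u t) <= M%:E)%E) ->
  (forall t, 0 <= t <= T -> (H (v t) <= M%:E)%E) ->
  (forall t, 0 <= t <= T -> (H (fun x => u t x - v t x)%R <= D%:E)%E) ->
  source_path q sg T (C * M `^ beta * M) (fun t => F (u t)) /\
  source_path q sg T (C * M `^ beta * D) (fun t x => F (u t) x - F (v t) x).
Proof.
have [C C0 hC] := @herz_source_lip R n q beta gamma b0 bq g0.
exists C => // T u v M D [hu cu] [hv cv] M0 uM vM uvD.
have CM0 : 0 <= C * M `^ beta by rewrite mulr_ge0 ?powR_ge0// ltW.
have mF (w : R -> V -> R) t : (forall t, 0 <= t <= T -> in_Herz al q (w t)) ->
    0 <= t <= T -> measurable_fun setT (F (w t)).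
  by move=> hw tT; apply: measurable_source; exact: (hw t tT).1.
have cF (w : R -> V -> R) : good T w -> (forall t, 0 <= t <= T -> (H (w t) <= M%:E)%E) ->
    source_path q sg T (C * M `^ beta * M) (fun t => F (w t)).
  move=> [hw cw] wM; split=> [t tT|t tT|e egt0]; first exact: mF.
    (* Comparison with the zero function, which the nonlinearity sends to zero, turns the Lipschitz
       bound into a growth bound. *)
    have := hC (w t) (fun=> 0) M (hw t tT).1 (measurable_cst _) M0 (wM t tT).
    rewrite Herz0 lee_fin => /(_ M0).
    rewrite (_ : (fun x => _) = F (w t)); last by apply/funext => x; rewrite source0 subr0.
    move=> /le_trans; apply; rewrite [leRHS]EFinM; apply: lee_wpmul2l; first by rewrite lee_fin.
    by rewrite (_ : (fun x => _) = w t); [exact: wM|apply/funext => x; rewrite subr0].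
  have e'0 : 0 < e / (C * M `^ beta + 1) by rewrite divr_gt0// ltr_wpDl.
  have [d dgt0 hd] := cw _ e'0; exists d => // s t sT tT st.
  apply: le_trans (hC _ _ M (hw s sT).1 (hw t tT).1 M0 (wM s sT) (wM t tT)) _.
  apply: (@le_trans _ _ ((C * M `^ beta + 1)%:E * (e / (C * M `^ beta + 1))%:E)%E).
    apply: lee_pmul; rewrite ?lee_fin ?lerDl//; exact: hd.
  by rewrite -EFinM lee_fin mulrC divfK// gt_eqF// ltr_wpDl.
have hFu := cF u (conj hu cu) uM; have hFv := cF v (conj hv cv) vM.
split => //; have [m1 _ c1] := source_pathB p1 hFu hFv; split => // t tT.
apply: le_trans (hC _ _ M (hu t tT).1 (hv t tT).1 M0 (uM t tT) (vM t tT)) _.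
by rewrite [leRHS]EFinM; apply: lee_wpmul2l; [rewrite lee_fin|exact: uvD].
Qed.

(** The increment from time s to s + h is the semigroup at time s applied to the increment from 0 to
    h; uniform boundedness thus turns continuity at 0 into uniform continuity. The constant is
    raised to at least 1 to include t = 0. *)
Lemma good_heat : exists2 c : R, 1 <= c & forall u0 : V -> R, in_Herz al q u0 ->
  (forall T, good T (fun t => heat t u0)) /\
  forall t, 0 <= t -> (H (heat t u0) <= c%:E * H u0)%E.
Proof.
have [c c0 hc] := Herz_heat_le n0 q1 d0 dn.
have c1 : 1 <= c + 1 by rewrite lerDr ltW.
have c10 : 0 < c + 1 by rewrite addr_gt0.
exists (c + 1) => // u0 hu0.
have heat0 : heat 0 u0 = u0 by apply/funext => x; rewrite /heat eqxx.
have hH t : 0 <= t -> (H (heat t u0) <= (c + 1)%:E * H u0)%E.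
  rewrite le_eqVlt => /predU1P[<-|t0].
    by rewrite heat0 -[leLHS]mul1e; apply: lee_wpmul2r => //; rewrite lee_fin.
  apply: le_trans (hc t u0 t0 hu0.1).2 _.
  by apply: lee_wpmul2r => //; rewrite lee_fin lerDl.
have hin t : 0 <= t -> in_Herz al q (heat t u0).
  rewrite le_eqVlt => /predU1P[<-|t0]; first by rewrite heat0.
  exact: in_Herz_heat.
split=> // T; apply: good_wlog => [t /andP[t0 _]|e egt0]; first exact: hin.
have e'0 : 0 < e / (c + 1) by rewrite divr_gt0.
have [d dgt0 hd] := heat_strong_continuity n0 q1 d0 dn hu0 e'0.
exists d => // s h; rewrite le_eqVlt => /predU1P[<-|s0] hh _.
  rewrite addr0 heat0; apply: le_trans (hd h hh) _.
  by rewrite lee_fin ler_pdivrMr// ler_peMr// ltW.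
have h0 : 0 < h by have /andP[] := hh.
pose w x := heat h u0 x - u0 x.
have hw : in_Herz al q w by apply: in_HerzB => //; exact: in_Herz_heat.
have hs0 : 0 < h + s by exact: addr_gt0.
rewrite (Herz_ae_eq (g := heat s w) al q0); last 3 first.
- by apply: measurable_funB; apply: measurable_heat; exact: hu0.1.
- by apply: measurable_heat; exact: hw.1.
- have hhu := in_Herz_heat n0 q1 d0 dn h0 hu0.
  apply: filterS3 (ge0_heat_lty_ae n0 q1 d0 dn s0 hu0) (ge0_heat_lty_ae n0 q1 d0 dn s0 hhu)
    (ge0_heat_lty_ae n0 q1 d0 dn hs0 hu0) => x f1 f2 f3.
  rewrite /w heatB//; [|exact: hhu.1|exact: hu0.1].
  by rewrite heat_semigroup ?[s + h]addrC//; exact: hu0.1.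
apply: le_trans (hc s w s0 hw.1).2 _.
apply: (@le_trans _ _ ((c + 1)%:E * (e / (c + 1))%:E)%E).
  by apply: lee_pmul; rewrite ?lee_fin ?lerDl ?(ltW c0)//; exact: hd.
by rewrite -EFinM lee_fin mulrC divfK// gt_eqF.
Qed.

Lemma duhamel0 f x : duhamel f 0 x = 0.
Proof.
rewrite /duhamel (_ : (fun tau => _) = fun=> 0); first by rewrite /Rintegral integral0.
by apply/funext => tau; rewrite /duh_ker set_itvco0 indic0 mul0r.
Qed.

(** By [duhamel_restart], the increment from s to s + h is the semigroup at time s applied to the
    Duhamel integral up to h, plus the Duhamel integral of f(tau + h) - f(tau). The first is of
    order h^(1-th), the second is small by uniform continuity of [f]; differences of kernels are
    never estimated. *)
Lemma good_duhamel T K f : 0 <= K -> source_path q sg T K f -> good T (duhamel f).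
Proof.
move=> K0 hf.
have [C C0 hC] := Herz_duhamel n0 sg0 sg1 p1 g0 gn th1.
have [c c0 hc] := Herz_heat_le n0 q1 d0 dn.
have hin t : 0 <= t <= T -> in_Herz al q (duhamel f t).
  move=> tT; split; first by have /andP[_ tT2] := tT; exact: (measurable_duhamel n0 p1 hf tT2).
  by apply: le_lt_trans (hC _ _ _ _ hf K0 tT) _; exact: ltry.
apply: good_wlog => // e egt0.
have e2 : 0 < e / 2 by rewrite divr_gt0.
have A0 : 0 <= (c + 1) * C * K by rewrite !mulr_ge0// ?addr_ge0// ltW.
have [d1 d10 hd1] := powR_small e0 A0 e2.
pose e' := e / 2 / (C * T `^ (1 - th) + 1).
have CT0 : 0 < C * T `^ (1 - th) + 1.
  by rewrite ltr_wpDl// mulr_ge0 ?powR_ge0// ltW.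
have e'0 : 0 < e' by rewrite divr_gt0.
have [mf Kf cf] := hf; have [d2 d20 hd2] := cf e' e'0.
exists (Num.min d1 d2) => [|s h]; first by rewrite lt_min d10.
move=> s0 /andP[h0]; rewrite lt_min => /andP[hh1 hh2] shT.
have hT : 0 <= h <= T by rewrite (ltW h0)/=; lra.
have hsT : h + s <= T by rewrite addrC.
have CK0 : 0 <= C * K * h `^ (1 - th) by rewrite !mulr_ge0 ?powR_ge0// ltW.
have hh : (c + 1) * C * K * h `^ (1 - th) <= e / 2 by apply: hd1; rewrite h0.
move: s0; rewrite le_eqVlt => /predU1P[sE|s0].
  rewrite (_ : (fun x => _) = duhamel f h); last first.
    by apply/funext => x; rewrite -sE addr0 duhamel0 subr0.
  apply: le_trans (hC _ _ _ _ hf K0 hT) _; rewrite lee_fin.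
  have := ler_wpM2r CK0 (_ : 1 <= c + 1); rewrite lerDr (ltW c0) => /(_ isT).
  by rewrite mul1r -!mulrA in hh *; lra.
have sT : s <= T by lra.
have sT' : 0 <= s <= T by rewrite (ltW s0).
have hfs := source_path_le sT hf.
have hsh : source_path q sg s K (fun tau => f (tau + h)).
  by apply: source_path_le (source_path_shift (ltW h0) hf); lra.
have [m1 _ c1] := source_pathB p1 hsh hfs.
have hdiff : source_path q sg s e' (fun tau x => f (tau + h) x - f tau x).
  split=> // tau /andP[tau0 taus]; apply: hd2.
  - by rewrite addr_ge0 ?(ltW h0)//=; lra.
  - by rewrite tau0/=; lra.
  - by rewrite addrAC subrr add0r gtr0_norm.
have ss : 0 <= s <= s by rewrite lexx (ltW s0).
have hdh := hin h hT; have := measurable_heat s hdh.1 => mhd.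
have mdd := measurable_duhamel n0 p1 hdiff (lexx s).
rewrite (Herz_ae_eq (g := fun x => heat s (duhamel f h) x +
    duhamel (fun tau x => f (tau + h) x - f tau x) s x) al q0); last 3 first.
- apply: measurable_funB; last exact: (hin s sT').1.
  by apply: (hin _ _).1; rewrite hsT addr_ge0// ltW.
- exact: measurable_funD.
- have hB := duhamelB n0 sg0 sg1 p1 g0 gn th1 hsh hfs K0 K0 ss.
  have hR := duhamel_restart n0 sg0 sg1 p1 g0 gn th1 hf K0 h0 s0 hsT.
  by apply: filterS2 hB hR => x -> ->; rewrite addrA.
rewrite [e]splitr; apply: HerzD_le => //.
  apply: le_trans (hc s _ s0 hdh.1).2 _.
  apply: (@le_trans _ _ (c%:E * (C * K * h `^ (1 - th))%:E)%E).
    by apply: lee_wpmul2l; [rewrite lee_fin ltW|exact: hC hf K0 hT].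
  rewrite -EFinM lee_fin; have := ler_wpM2r CK0 (_ : c <= c + 1).
  by rewrite lerDl => /(_ ler01); rewrite -!mulrA in hh *; lra.
apply: le_trans (hC _ _ _ _ hdiff (ltW e'0) ss) _; rewrite lee_fin.
apply: (@le_trans _ _ ((C * T `^ (1 - th) + 1) * e')); last by rewrite mulrC divfK// gt_eqF.
rewrite mulrAC ler_wpM2r ?(ltW e'0)//.
have : s `^ (1 - th) <= T `^ (1 - th).
  by apply: ge0_ler_powR; rewrite ?nnegrE ?(ltW e0) ?(ltW s0)// (le_trans (ltW s0)).
by move=> /(ler_wpM2l (ltW C0)); lra.
Qed.

Lemma good_addZ T u v (c : R) : good T u -> good T v ->
  good T (fun t x => u t x + c * v t x).
Proof.
move=> [hu cu] [hv cv]; split=> [t tT|e egt0].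
  by apply: in_HerzD => //; [exact: hu|apply: in_HerzZ => //; exact: hv].
have e2 : 0 < e / 2 by rewrite divr_gt0.
have c1 : 0 < `|c| + 1 by rewrite ltr_wpDl.
have [d1 d10 h1] := cu _ e2.
have [d2 d20 h2] := cv _ (divr_gt0 e2 c1).
exists (Num.min d1 d2) => [|s t sT tT]; first by rewrite lt_min d10.
rewrite lt_min => /andP[s1 s2].
rewrite (_ : (fun x => _) =
    (fun x => (u s x - u t x) + c * (v s x - v t x))); last first.
  by apply/funext => x; ring.
have mu' := measurable_funB (hu s sT).1 (hu t tT).1.
have mv' := measurable_funB (hv s sT).1 (hv t tT).1.
rewrite [e]splitr; apply: HerzD_le; [by []| |exact: h1|].
  by apply: measurable_funM => //; exact: measurable_cst.
have := HerzZ_le c mv' (h2 s t sT tT s2).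
move=> /le_trans; apply; rewrite lee_fin.
apply: (@le_trans _ _ ((`|c| + 1) * (e / 2 / (`|c| + 1)))).
  by rewrite ler_wpM2r ?lerDl// divr_ge0// ltW.
by rewrite mulrC divfK// gt_eqF.
Qed.

Lemma good0 T : good T (fun _ _ => 0).
Proof.
split=> [t _|e egt0]; first by split; [exact: measurable_cst|rewrite Herz0].
exists 1 => // s t _ _ _; rewrite (_ : (fun x : V => _) = fun=> 0) ?Herz0 ?lee_fin ?ltW//.
by apply/funext => x; rewrite subrr.
Qed.

Definition mild_map (u0 : V -> R) u t x : R :=
  heat t u0 x + a * duhamel (fun tau => F (u tau)) t x.

Lemma good_mild_map T (u0 : V -> R) u : in_Herz al q u0 -> good T u -> good T (mild_map u0 u).
Proof.
move=> hu0 hu; have [c _ hc] := good_heat; have [C C0 hC] := good_source_path.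
have [M M0 uM] := good_bounded hu.
have diff t : 0 <= t <= T -> (H (fun x => u t x - u t x)%R <= 0%:E)%E.
  by move=> _; rewrite (_ : (fun x => _) = fun=> 0) ?Herz0//; apply/funext => x; rewrite subrr.
have [hF _] := hC T u u M 0 hu hu (ltW M0) uM uM diff.
apply: good_addZ; first exact: (hc u0 hu0).1.
by apply: good_duhamel hF; rewrite !mulr_ge0 ?powR_ge0// ltW.
Qed.

Lemma mild_map_lip : exists2 A : R, 0 < A & forall T (u0 : V -> R) u v (B D t : R),
  good T u -> good T v -> 0 <= B -> 0 <= D -> 0 <= t <= T ->
  (forall t, 0 <= t <= T -> (H (u t) <= B%:E)%E) ->
  (forall t, 0 <= t <= T -> (H (v t) <= B%:E)%E) ->
  (forall t, 0 <= t <= T -> (H (fun x => u t x - v t x)%R <= D%:E)%E) ->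
  in_Herz al q u0 ->
  (H (fun x => mild_map u0 u t x - mild_map u0 v t x)%R <=
    (A * B `^ beta * t `^ (1 - th) * D)%:E)%E.
Proof.
have [C C0 hC] := good_source_path.
have [C' C'0 hC'] := Herz_duhamel n0 sg0 sg1 p1 g0 gn th1.
exists ((`|a| + 1) * (C' * C)); first by rewrite !mulr_gt0// ltr_wpDl.
move=> T u0 u v B D t hu hv B0 D0 tT uB vB uvD hu0; have /andP[t0 tT'] := tT.
have vuD s : 0 <= s <= T -> (H (fun x => v s x - u s x)%R <= D%:E)%E.
  by move=> sT; rewrite HerzBC; exact: uvD.
have [hFu hFd] := hC T u v B D hu hv B0 uB vB uvD.
have [hFv _] := hC T v u B D hv hu B0 vB uB vuD.
have K0 : 0 <= C * B `^ beta * B by rewrite !mulr_ge0 ?powR_ge0// ltW.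
have K1 : 0 <= C * B `^ beta * D by rewrite !mulr_ge0 ?powR_ge0// ltW.
pose w := duhamel (fun tau x => F (u tau) x - F (v tau) x) t.
have mw : measurable_fun setT w by exact: (measurable_duhamel n0 p1 hFd tT').
have gu := good_mild_map hu0 hu; have gv := good_mild_map hu0 hv.
rewrite (Herz_ae_eq (g := fun x => a * w x) al q0); last 3 first.
- by apply: measurable_funB; [exact: (gu.1 t tT).1|exact: (gv.1 t tT).1].
- by apply: measurable_funM => //; exact: measurable_cst.
- have := duhamelB n0 sg0 sg1 p1 g0 gn th1 hFu hFv K0 K0 tT.
  apply: filterS => x xE; rewrite /mild_map /w xE mulrBr opprD addrACA subrr add0r.
  by [].
apply: le_trans (HerzZ_le a mw (hC' _ _ _ _ hFd K1 tT)) _.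
rewrite lee_fin (_ : _ * t `^ _ * D = (`|a| + 1) * (C' * (C * B `^ beta * D) * t `^ (1 - th))); last by ring.
by rewrite ler_wpM2r ?lerDl// !mulr_ge0 ?powR_ge0// ltW.
Qed.

Lemma halving_lt (B e : R) : 0 <= B -> 0 < e -> exists m : nat, B * 2^-1 ^+ m < e.
Proof.
move=> B0 egt0; pose m := (Num.trunc (B / e)).+1; exists m.
have h : B < e * m%:R by rewrite mulrC -ltr_pdivrMr//; exact: truncnS_gt.
rewrite exprVn ltr_pdivrMr ?exprn_gt0//; apply: lt_trans h _.
by rewrite ltr_pM2l// -natrX ltr_nat ltn_expl.
Qed.

Let nneseries_halving (z : R) : 0 <= z ->
  (\sum_(j <oo) (z * 2^-1 ^+ j.+1)%:E <= z%:E)%E.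
Proof.
move=> z0; apply: lime_le.
  by apply: is_cvg_nneseries => j _ _; rewrite lee_fin mulr_ge0// exprn_ge0.
apply: nearW => N; rewrite sumEFin lee_fin.
suff -> : \sum_(0 <= j < N) z * 2^-1 ^+ j.+1 = z * (1 - 2^-1 ^+ N).
  by rewrite ler_piMr// gerBl exprn_ge0.
elim: N => [|N IH]; first by rewrite big_geq// expr0 subrr mulr0.
by rewrite big_nat_recr//= IH exprS; field.
Qed.

(** The Riesz-Fischer argument: the series [S 0] of the absolute increments has finite seminorm,
    hence is finite almost everywhere, and there the sequence converges. The tail [S m] majorises
    the distance from the limit to [w m]. *)
Lemma Herz_complete (w : nat -> V -> R) (C : R) : 0 <= C ->
  (forall m, in_Herz al q (w m)) ->
  (forall m, (H (fun x => w m.+1 x - w m x)%R <= (C * 2^-1 ^+ m.+1)%:E)%E) ->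
  exists2 g, in_Herz al q g &
    forall m, (H (fun x => g x - w m x)%R <= (C * 2^-1 ^+ m)%:E)%E.
Proof.
move=> C0 hw hd.
pose dw m := absf (fun x => w m.+1 x - w m x).
have hdw m : ge0_mfun (dw m).
  by apply: ge0_mfun_absf; apply: measurable_funB; [exact: (hw _).1|exact: (hw _).1].
pose S m x : \bar R := (\sum_(j <oo) dw (m + j)%N x)%E.
have hS m : ge0_mfun (S m) by exact: ge0_mfun_nneseries.
have HS m : (ge0_herz al q (S m) <= (C * 2^-1 ^+ m)%:E)%E.
  apply: le_trans (ge0_herz_nneseries al q1 (fun j => hdw (m + j)%N)) _.
  have z0 : 0 <= C * 2^-1 ^+ m by rewrite mulr_ge0// exprn_ge0.
  apply: le_trans (nneseries_halving z0); apply: lee_nneseries => j *.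
    exact: ge0_herz_ge0.
  rewrite /dw -HerzE; apply: le_trans (hd _) _.
  by rewrite lee_fin -mulrA -exprD addnS.
(* The upper limit is measurable as a function of x and equals the limit wherever the sequence
   converges. *)
pose g x := fine (limn_esup (fun m => (w m x)%:E)).
have mg : measurable_fun setT g.
  apply: (measurableT_comp (fine_measurable _)) => //.
  apply: measurable_fun_limn_esup => m; apply/measurable_EFinP; exact: (hw m).1.
have S0fin : \forall x \ae mu, (S 0%N x < +oo)%E.
  by apply: (ge0_herz_lty_ae (al := al) n0 q0 (hS 0%N)); apply: le_lt_trans (HS 0%N) _; exact: ltry.
have conv x : (S 0%N x < +oo)%E -> w m x @[m --> \oo] --> g x.
  move=> Sx; have : cvgn (fun m => w m x).
    pose tw := telescope (fun m => w m x).
    have nE m : [normed series tw] m = \sum_(0 <= j < m) `|tw j| by [].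
    have : cvgn [normed series tw].
      apply: nondecreasing_is_cvgn.
        by apply/nondecreasing_seqP => m; rewrite !nE big_nat_recr//= lerDl.
      exists (fine (S 0%N x)) => _ [m _ <-]; rewrite nE.
      rewrite -lee_fin fineK; last by rewrite ge0_fin_numE// (hS 0%N).2.
      rewrite -sumEFin; apply: nneseries_lim_ge => j _ _; exact: (hdw _).2.
    move=> /normed_cvg; rewrite telescopeK => /= h.
    rewrite (_ : (fun m => w m x) = (fun m => (w m x - w 0%N x) + w 0%N x)); last first.
      by apply/funext => m; rewrite subrK.
    by apply: is_cvgD => //; exact: is_cvg_cst.
  move=> /cvg_ex[l wl]; rewrite /g (is_cvg_limn_esupE (u := fun m => (w m x)%:E)).
    rewrite (_ : fine _ = l)//; rewrite (@cvg_lim _ _ _ _ _ _ l%:E)//.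
    by apply: cvg_EFin => //; exact: nearW.
  by apply/cvg_ex; exists l%:E; apply: cvg_EFin => //; exact: nearW.
have gS m : \forall x \ae mu, (absf (fun x => g x - w m x)%R x <= S m x)%E.
  apply: filterS S0fin => x /conv wg.
  have part N : (`|w (m + N)%N x - w m x|%R%:E <= S m x)%E.
    apply: (@le_trans _ _ (\sum_(0 <= j < N) dw (m + j)%N x)%E); last first.
      by apply: nneseries_lim_ge => j _ _; exact: (hdw _).2.
    elim: N => [|N IH]; first by rewrite addn0 subrr normr0 sume_ge0// => j _; exact: (hdw _).2.
    rewrite big_nat_recr//=; apply: le_trans (leeD IH (lexx _)).
    rewrite /dw /absf -EFinD lee_fin addnS.
    rewrite (_ : w (m + N).+1 x - w m x = (w (m + N)%N x - w m x) +
      (w (m + N).+1 x - w (m + N)%N x)); last by ring.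
    exact: ler_normD.
  have wg' : w (m + N)%N x @[N --> \oo] --> g x.
    have := wg; rewrite -(cvg_shiftn m (fun k => w k x)).
    by under eq_fun do rewrite addnC.
  have : `|w (m + N)%N x - w m x|%:E @[N --> \oo] --> `|g x - w m x|%:E.
    apply: cvg_EFin; first exact: nearW.
    apply: cvg_norm; apply: cvgB wg' _; exact: cvg_cst.
  by move=> h; apply: cvge_le h; apply: nearW.
have gw m : (H (fun x => g x - w m x)%R <= (C * 2^-1 ^+ m)%:E)%E.
  apply: le_trans (HS m); apply: Herz_le_ge0 => //.
  by apply: measurable_funB => //; exact: (hw m).1.
exists g => //; split => //.
rewrite (_ : g = fun x => (g x - w 0%N x) + w 0%N x); last by apply/funext => x; rewrite subrK.
have mgw : measurable_fun setT (fun x => g x - w 0%N x).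
  by apply: measurable_funB => //; exact: (hw _).1.
apply: le_lt_trans (HerzD al q1 mgw (hw 0%N).1) _.
apply: lte_add_pinfty; last exact: (hw 0%N).2.
by apply: le_lt_trans (gw 0%N) _; exact: ltry.
Qed.

End picard.

(** * Local solutions, restarting and gluing *)

Section solution.
Context {R : realType} {n : nat}.
Local Notation V := 'rV[R]_n.
Local Notation mu := (@lebesgue_rV R n).
Variables (a q beta gamma : R).
Local Notation sg := (beta + 1)^-1.
Local Notation p := (q * sg).
Local Notation th := ((n%:R - (n%:R - gamma) * sg) / 2).
Local Notation al := ((n%:R - gamma) / (beta + 1) - n%:R / q).
Local Notation al' := (n%:R * (1 - p^-1)).
Local Notation H := (Herz al q).
Local Notation HY := (Herz al' p).
Local Notation F := (@hardy_henon_source R n gamma beta).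
Hypotheses (n0 : (0 < n)%N) (b0 : 0 < beta) (g0 : 0 < gamma) (gn : gamma < n%:R).
Hypotheses (th1 : th < 1) (bq : beta + 1 <= q).
Implicit Types (f g u v : R -> V -> R) (x y : V) (t T tau : R).

Let b1 : 0 < beta + 1. Proof. by rewrite addr_gt0. Qed.
Let sg0 : 0 < sg. Proof. by rewrite invr_gt0. Qed.
Let sg1 : sg < 1. Proof. by rewrite invf_lt1// ltrDr. Qed.
Let q0 : 0 < q. Proof. exact: lt_le_trans bq. Qed.
Let q1 : 1 <= q. Proof. by apply: le_trans bq; rewrite lerDr ltW. Qed.
Let p1 : 1 <= p. Proof. by rewrite ler_pdivlMr// mul1r. Qed.
Let p0 : 0 < p. Proof. exact: lt_le_trans p1. Qed.
Let d0 : 0 < al + n%:R / q. Proof. by rewrite subrK mulr_gt0// subr_gt0. Qed.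
Let dn : al + n%:R / q < n%:R.
Proof.
rewrite subrK (@lt_trans _ _ (n%:R - gamma))//; last by rewrite gtrBl.
by rewrite gtr_pMr// subr_gt0.
Qed.
Let e0 : 0 < 1 - th. Proof. by rewrite subr_gt0. Qed.
Let Herz0 : H (fun _ : V => 0) = 0%E.
Proof.
have : H (fun x : V => 0 * 0) = 0%E.
  by rewrite HerzZ ?normr0 ?mul0e//; exact: measurable_cst.
by rewrite mulr0.
Qed.

(** The kernel at positive time does not see null sets, so the integrands agree at every x and tau.
    Hence equality almost everywhere at each single time is enough, with null sets that may vary
    with the time. *)
Lemma duhamel_ae_eq f g t x : (forall tau, 0 <= tau < t ->
    [/\ measurable_fun setT (f tau), measurable_fun setT (g tau) &
      \forall y \ae mu, f tau y = g tau y]) ->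
  duhamel f t x = duhamel g t x.
Proof.
move=> fg; apply: eq_Rintegral => tau _; rewrite /duh_ker indicE.
have [|_] := boolP (tau \in _); last by rewrite !mul0r.
rewrite inE/= in_itv/= => tt; have [mf mg fE] := fg tau tt.
by congr (_ * _); apply: heat_ae_eq => //; rewrite subr_gt0; have /andP[] := tt.
Qed.

(** The fixed point equation for [good] paths, without the convergence conditions of [mild_at];
    [mild_at_iff] supplies these. *)
Definition solves (u0 : V -> R) T u := good q beta gamma T u /\
  forall t, 0 <= t <= T -> \forall x \ae mu, u t x = mild_map a beta gamma u0 u t x.

Local Notation good := (good q beta gamma).
Local Notation mm := (mild_map a beta gamma).

Let source_ae_eq (f g : V -> R) : (\forall x \ae mu, f x = g x) ->
  \forall x \ae mu, F f x = F g x.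
Proof. by apply: filterS => x; rewrite /hardy_henon_source => ->. Qed.

Let mF (f : V -> R) : measurable_fun setT f -> measurable_fun setT (F f).
Proof. exact: measurable_source. Qed.

Lemma mild_map0 (u0 : V -> R) u : mm u0 u 0 = u0.
Proof. by apply/funext => x; rewrite /mild_map duhamel0 mulr0 addr0 /heat eqxx. Qed.

Lemma mild_map_data_ae_eq (u0 v0 : V -> R) u t : 0 <= t ->
  measurable_fun setT u0 -> measurable_fun setT v0 ->
  (\forall x \ae mu, u0 x = v0 x) -> \forall x \ae mu, mm u0 u t x = mm v0 u t x.
Proof.
rewrite le_eqVlt => /predU1P[<-|t0] mu0 mv0 uv; first by rewrite !mild_map0.
by apply: aeW => x; rewrite /mild_map (heat_ae_eq x t0 mu0 mv0 uv).
Qed.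

Lemma mild_map_ae_eq (u0 : V -> R) u v t x : (forall tau, 0 <= tau < t ->
    [/\ measurable_fun setT (u tau), measurable_fun setT (v tau) &
      \forall y \ae mu, u tau y = v tau y]) ->
  mm u0 u t x = mm u0 v t x.
Proof.
move=> uv; rewrite /mild_map; congr (_ + _ * _); apply: duhamel_ae_eq => tau /uv[h1 h2 h3].
by split; [exact: mF|exact: mF|exact: source_ae_eq].
Qed.

Lemma solves_ae_eq (u0 : V -> R) T u v : solves u0 T u -> (forall t, 0 <= t <= T ->
    measurable_fun setT (v t) /\ \forall x \ae mu, v t x = u t x) -> solves u0 T v.
Proof.
move=> [hu eu] vu; split; first exact: (good_ae_eq b0 bq hu vu).
move=> t tT; have [_ vt] := vu t tT; apply: filterS2 vt (eu t tT) => x -> ->.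
apply: mild_map_ae_eq => tau /andP[tau0 taut].
have tauT : 0 <= tau <= T by rewrite tau0 (le_trans (ltW taut))//; case/andP: tT.
have [mv vE] := vu tau tauT; split => //; first exact: (hu.1 tau tauT).1.
by apply: filterS vE => y ->.
Qed.

Lemma solves_le (u0 : V -> R) T T' u : T' <= T -> solves u0 T u -> solves u0 T' u.
Proof.
move=> T'T [hu eu]; split; first exact: good_le T'T hu.
by move=> t /andP[t0 tT']; apply: eu; rewrite t0 (le_trans tT').
Qed.

Lemma solves_data (u0 : V -> R) T u : 0 <= T -> solves u0 T u ->
  \forall x \ae mu, u 0 x = u0 x.
Proof.
by move=> T0 [_ /(_ 0)]; rewrite lexx T0 mild_map0; apply.
Qed.

Let small_contraction (A B : R) : 0 < A -> 0 <= B -> exists2 h : R, 0 < h &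
  forall t, 0 <= t <= h -> A * B `^ beta * t `^ (1 - th) <= 2^-1.
Proof.
move=> A0 B0; have AB0 : 0 <= A * B `^ beta by rewrite mulr_ge0 ?powR_ge0// ltW.
have i2 : (0 : R) < 2^-1 by rewrite invr_gt0.
have [d dgt0 hd] := powR_small e0 AB0 i2.
have d2 : 0 < d / 2 by rewrite divr_gt0.
exists (d / 2) => // t /andP[t0 td].
have h2 : 0 < d / 2 < d by rewrite d2/=; lra.
have := hd _ h2; apply: le_trans; rewrite ler_wpM2l//.
by apply: ge0_ler_powR; rewrite ?nnegrE ?(ltW e0) ?(ltW d2).
Qed.

Lemma local_existence (M : R) : 0 < M -> exists2 h : R, 0 < h &
  forall u0 : V -> R, in_Herz al q u0 -> (H u0 <= M%:E)%E -> exists u, solves u0 h u.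
Proof.
move=> M0; have [c c1 hc] := good_heat n0 b0 g0 gn bq.
have [A A0 hA] := mild_map_lip a n0 b0 g0 gn th1 bq.
have c0 : 0 < c by exact: lt_le_trans c1.
(* [B] bounds the free evolution; the iterates are kept in the ball of radius [2 * B], and h is
   chosen so that the map halves distances there. *)
pose B := c * M; have B0 : 0 < B by exact: mulr_gt0.
have B20 : 0 <= 2 * B by rewrite mulr_ge0// ltW.
have [h h0 hh] := small_contraction A0 B20.
exists h => // u0 hu0 u0M; have [gh hh0] := hc u0 hu0.
have heatB t : 0 <= t <= h -> (H (heat t u0) <= B%:E)%E.
  move=> /andP[t0 _]; apply: le_trans (hh0 t t0) _.
  by rewrite /B EFinM; apply: lee_wpmul2l => //; rewrite lee_fin ltW.
have lip u v (D t : R) : good h u -> good h v -> 0 <= D -> 0 <= t <= h ->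
    (forall t, 0 <= t <= h -> (H (u t) <= (2 * B)%:E)%E) ->
    (forall t, 0 <= t <= h -> (H (v t) <= (2 * B)%:E)%E) ->
    (forall t, 0 <= t <= h -> (H (fun x => u t x - v t x)%R <= D%:E)%E) ->
    (H (fun x => mm u0 u t x - mm u0 v t x)%R <= (2^-1 * D)%:E)%E.
  move=> hu hv D0 tT uB vB uvD.
  apply: le_trans (hA h u0 u v (2 * B) D t hu hv B20 D0 tT uB vB uvD hu0) _.
  by rewrite lee_fin ler_wpM2r// hh.
(* The zero path is mapped to the free evolution; comparison with it shows both that the ball is
   preserved and that the first increment is at most B/2. *)
have g00 := good0 gamma b0 bq h : good h (fun _ (_ : V) => 0).
have F00 : F (fun _ : V => 0) = (fun _ => 0).
  by apply/funext => x; rewrite source0.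
have mm0 t : mm u0 (fun _ _ => 0) t = heat t u0.
  apply/funext => x; rewrite /mild_map F00.
  rewrite (_ : duhamel _ t x = 0) ?mulr0 ?addr0// /duhamel.
  rewrite (_ : (fun tau => _) = fun=> 0); first by rewrite /Rintegral integral0.
  apply/funext => tau; rewrite /duh_ker /heat; case: ifP => _; first by rewrite mulr0.
  rewrite (_ : (fun y => _) = fun=> 0); first by rewrite /Rintegral integral0 mulr0.
  by apply/funext => y; rewrite mulr0.
have zB t : 0 <= t <= h -> (H (fun _ : V => 0%R) <= (2 * B)%:E)%E.
  by move=> _; rewrite Herz0 lee_fin.
have sub0 (f : V -> R) : (fun x => f x - 0) = f by apply/funext => x; rewrite subr0.
pose w m := iter m (mm u0) (fun t => heat t u0).
have gw m : good h (w m).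
  by elim: m => [|m IH] /=; [exact: gh|exact: good_mild_map].
have wB m t : 0 <= t <= h -> (H (w m t) <= (2 * B)%:E)%E.
  elim: m t => [|m IH] t tT /=.
    by apply: le_trans (heatB t tT) _; rewrite lee_fin; lra.
  have := lip (w m) (fun _ _ => 0) (2 * B) t (gw m) g00 B20 tT IH zB.
  move=> /(_ ltac:(by move=> s sT; rewrite sub0; exact: IH)) h1.
  have mw : measurable_fun setT (mm u0 (w m) t) by exact: ((gw m.+1).1 t tT).1.
  have mh : measurable_fun setT (heat t u0) by exact: ((gh h).1 t tT).1.
  rewrite (_ : mm u0 (w m) t = fun x => (mm u0 (w m) t x - heat t u0 x) + heat t u0 x); last first.
    by apply/funext => x; rewrite subrK.
  apply: le_trans (HerzD al q1 (measurable_funB mw mh) mh) _.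
  rewrite (_ : 2 * B = 2^-1 * (2 * B) + B); last by field.
  by rewrite EFinD; apply: leeD; [rewrite -mm0|exact: heatB].
have wd m t : 0 <= t <= h ->
    (H (fun x => w m.+1 t x - w m t x)%R <= (B * 2^-1 ^+ m.+1)%:E)%E.
  elim: m t => [|m IH] t tT.
    have := lip (w 0%N) (fun _ _ => 0) B t (gw 0%N) g00 (ltW B0) tT (wB 0%N) zB.
    rewrite mm0 expr1 [B * _]mulrC; apply=> s sT; rewrite sub0; exact: heatB.
  have Bm0 : 0 <= B * 2^-1 ^+ m.+1 by rewrite mulr_ge0 ?exprn_ge0// ltW.
  have := lip (w m.+1) (w m) _ t (gw m.+1) (gw m) Bm0 tT (wB m.+1) (wB m) IH.
  by rewrite mulrCA -exprS.
(* The limit is taken at each time separately and a representative chosen; uniformity of the rate in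
   t gives continuity in time afterwards. *)
have /choice[u hu] : forall t, exists ut : V -> R, 0 <= t <= h ->
    in_Herz al q ut /\ forall m, (H (fun x => ut x - w m t x)%R <= (B * 2^-1 ^+ m)%:E)%E.
  move=> t; have [tT|tT] := boolP (0 <= t <= h); last by exists (fun=> 0).
  have [g hg gE] := Herz_complete n0 b0 bq (ltW B0) (fun m => (gw m).1 t tT) (fun m => wd m t tT).
  by exists g.
have gu : good h u.
  split=> [t tT|e egt0]; first by have [] := hu t tT.
  have e3 : 0 < e / 3 by rewrite divr_gt0.
  have [m hm] := halving_lt (ltW B0) e3.
  have [d dgt0 hd] := (gw m).2 _ e3; exists d => // s t sT tT st.
  have [is_ us] := hu s sT; have [it ut] := hu t tT.
  have ms := ((gw m).1 s sT).1; have mt := ((gw m).1 t tT).1.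
  rewrite (_ : e = e / 3 + (e / 3 + e / 3)); last by field.
  have h1 : (H (fun x => u s x - w m s x)%R <= (e / 3)%:E)%E.
    by apply: le_trans (us m) _; rewrite lee_fin ltW.
  have h2 : (H (fun x => w m t x - u t x)%R <= (e / 3)%:E)%E.
    by rewrite HerzBC; apply: le_trans (ut m) _; rewrite lee_fin ltW.
  apply: (Herz_triangle b0 bq is_.1 ms it.1 h1).
  by apply: (Herz_triangle b0 bq ms mt it.1 _ h2); exact: hd.
have uB t : 0 <= t <= h -> (H (u t) <= (2 * B)%:E)%E.
  move=> tT; have [it ut] := hu t tT; have mw := ((gw 0%N).1 t tT).1.
  rewrite (_ : u t = fun x => (u t x - w 0%N t x) + w 0%N t x); last first.
    by apply/funext => x; rewrite subrK.
  apply: le_trans (HerzD al q1 (measurable_funB it.1 mw) mw) _.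
  rewrite (_ : 2 * B = B * 2^-1 ^+ 0 + B); last by rewrite expr0; ring.
  by rewrite EFinD; apply: leeD; [exact: ut|exact: heatB].
exists u; split => // t tT; have [it ut] := hu t tT.
have mm_in : in_Herz al q (mm u0 u t) by exact: ((good_mild_map a n0 b0 g0 gn th1 bq hu0 gu).1 t tT).
have small m : (H (fun x => u t x - mm u0 u t x)%R <= (B * 2^-1 ^+ m)%:E)%E.
  have Bm0 : 0 <= B * 2^-1 ^+ m by rewrite mulr_ge0 ?exprn_ge0// ltW.
  have wu s : 0 <= s <= h -> (H (fun x => w m s x - u s x)%R <= (B * 2^-1 ^+ m)%:E)%E.
    by move=> sT; rewrite HerzBC; exact: (hu s sT).2.
  have h1 := lip (w m) u _ t (gw m) gu Bm0 tT (wB m) uB wu.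
  rewrite (_ : B * 2^-1 ^+ m = B * 2^-1 ^+ m.+1 + 2^-1 * (B * 2^-1 ^+ m)); last first.
    by rewrite exprS; field.
  exact: (Herz_triangle b0 bq it.1 ((gw m.+1).1 t tT).1 mm_in.1 (ut m.+1) h1).
have : H (fun x => u t x - mm u0 u t x) = 0%E.
  apply/eqP; rewrite eq_le Herz_ge0 andbT; apply/lee_addgt0Pr => e egt0; rewrite add0e.
  have [m hm] := halving_lt (ltW B0) egt0.
  by apply: le_trans (small m) _; rewrite lee_fin ltW.
move=> /(Herz_eq0 n0 q0 (measurable_funB it.1 mm_in.1)); apply: filterS => x /eqP.
by rewrite subr_eq0 => /eqP.
Qed.

(** Two solutions differ by the difference of their images, so each application of the contraction
    halves the bound 2M on their distance. The length h depends only on M, which allows the argument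
    to be repeated from later times. *)
Lemma local_uniqueness (M : R) : 0 < M -> exists2 h : R, 0 < h &
  forall T (u0 : V -> R) u v, in_Herz al q u0 -> solves u0 T u -> solves u0 T v ->
  (forall t, 0 <= t <= T -> (H (u t) <= M%:E)%E) ->
  (forall t, 0 <= t <= T -> (H (v t) <= M%:E)%E) ->
  forall t, 0 <= t <= T -> t <= h -> \forall x \ae mu, u t x = v t x.
Proof.
move=> M0; have [A A0 hA] := mild_map_lip a n0 b0 g0 gn th1 bq.
have [h h0 hh] := small_contraction A0 (ltW M0).
exists h => // T u0 u v hu0 su sv uM vM t tT th'.
pose S := Num.min T h.
have ST : S <= T by rewrite ge_min lexx.
have Sh : S <= h by rewrite ge_min lexx orbT.
have sh s : 0 <= s <= S -> 0 <= s <= T by move=> /andP[-> /le_trans]; apply.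
have [gu eu] := solves_le ST su; have [gv ev] := solves_le ST sv.
have D0 k : 0 <= 2 * M * 2^-1 ^+ k by rewrite !mulr_ge0 ?exprn_ge0// ltW.
have small k s : 0 <= s <= S -> (H (fun x => u s x - v s x)%R <= (2 * M * 2^-1 ^+ k)%:E)%E.
  elim: k s => [|k IH] s sS.
    apply: le_trans (HerzB al q1 (gu.1 s sS).1 (gv.1 s sS).1) _.
    rewrite (_ : _ * _ = M + M) ?EFinD; last by rewrite expr0; ring.
    by apply: leeD; [exact/uM/sh|exact/vM/sh].
  have := hA S u0 u v M _ s gu gv (ltW M0) (D0 k) sS (fun r rS => uM r (sh r rS))
    (fun r rS => vM r (sh r rS)) IH hu0.
  have gmu := good_mild_map a n0 b0 g0 gn th1 bq hu0 gu.
  have gmv := good_mild_map a n0 b0 g0 gn th1 bq hu0 gv.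
  rewrite (Herz_ae_eq (g := fun x => u s x - v s x) al q0); last 3 first.
  - by apply: measurable_funB; [exact: (gmu.1 s sS).1|exact: (gmv.1 s sS).1].
  - by apply: measurable_funB; [exact: (gu.1 s sS).1|exact: (gv.1 s sS).1].
  - by apply: filterS2 (eu s sS) (ev s sS) => x <- <-.
  move=> /le_trans; apply; rewrite lee_fin exprS [leRHS]mulrCA ler_wpM2r// hh//.
  by have /andP[-> /le_trans] := sS; apply.
have tS : 0 <= t <= S by rewrite le_min th' andbT.
have : H (fun x => u t x - v t x) = 0%E.
  apply/eqP; rewrite eq_le Herz_ge0 andbT; apply/lee_addgt0Pr => e egt0; rewrite add0e.
  have M20 : 0 <= 2 * M by rewrite mulr_ge0// ltW.
  have [m hm] := halving_lt M20 egt0.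
  by apply: le_trans (small m t tS) _; rewrite lee_fin ltW.
have muv := measurable_funB (gu.1 t tS).1 (gv.1 t tS).1.
move=> /(Herz_eq0 n0 q0 muv); apply: filterS => x /eqP.
by rewrite subr_eq0 => /eqP.
Qed.

(** The semigroup law for the data and [duhamel_restart] for the integral. The equation is needed at
    the time s alone, in order to recognise [u s] in the result; s = 0 and t = 0 are separate
    because [heat 0] is the identity by convention. *)
Lemma mild_map_restart (u0 : V -> R) T u s t : in_Herz al q u0 -> good T u ->
  0 <= s -> 0 <= t -> s + t <= T -> (\forall x \ae mu, u s x = mm u0 u s x) ->
  \forall x \ae mu, mm u0 u (s + t) x = mm (u s) (fun tau => u (tau + s)) t x.
Proof.
move=> hu0 gu s0 t0 stT us.
have sT : 0 <= s <= T by rewrite s0; lra.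
move: s0; rewrite le_eqVlt => /predU1P[sE|s0].
  move: us; rewrite -sE mild_map0 add0r => us.
  rewrite (_ : (fun tau => u (tau + 0)) = u); last by apply/funext => tau; rewrite addr0.
  apply: mild_map_data_ae_eq => //; first exact: hu0.1.
    by rewrite sE; exact: (gu.1 s sT).1.
  by apply: filterS us => x ->.
move: t0; rewrite le_eqVlt => /predU1P[<-|t0].
  by rewrite addr0 mild_map0; apply: filterS us => x ->.
have [C C0 hC] := good_source_path (n := n) b0 g0 bq.
have [M M0 uM] := good_bounded b0 bq gu.
have diff r : 0 <= r <= T -> (H (fun x => u r x - u r x)%R <= 0%:E)%E.
  by move=> _; rewrite (_ : (fun x => _) = fun=> 0) ?Herz0//; apply/funext => x; rewrite subrr.
have [hF _] := hC T u u M 0 gu gu (ltW M0) uM uM diff.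
have K0 : 0 <= C * M `^ beta * M by rewrite !mulr_ge0 ?powR_ge0// ltW.
pose f tau := F (u tau); pose w := duhamel f s.
have hw : in_Herz al q w := (good_duhamel n0 b0 g0 gn th1 bq K0 hF).1 s sT.
have haw := in_HerzZ q1 a hw.
have hh := in_Herz_heat n0 q1 d0 dn s0 hu0.
have st0 : 0 < t + s by exact: addr_gt0.
have hR := duhamel_restart n0 sg0 sg1 p1 g0 gn th1 hF K0 s0 t0 stT.
have fin1 := ge0_heat_lty_ae n0 q1 d0 dn t0 hh.
have fin2 := ge0_heat_lty_ae n0 q1 d0 dn t0 hw.
have fin3 := ge0_heat_lty_ae n0 q1 d0 dn st0 hu0.
have fin4 := ge0_heat_lty_ae n0 q1 d0 dn t0 haw.
apply: filterS2 hR (filterI fin1 (filterI fin2 (filterI fin3 fin4))) => x rE [f1 [f2 [f3 f4]]].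
rewrite /mild_map.
have -> : heat t (u s) x = heat (s + t) u0 x + a * heat t w x.
  rewrite (heat_ae_eq (g := fun y => heat s u0 y + a * w y) x t0); last 3 first.
  - exact: (gu.1 s sT).1.
  - by apply: measurable_funD; [exact: hh.1|exact: haw.1].
  - by apply: filterS us => y ->.
  rewrite heatD//; [|exact: hh.1|exact: haw.1].
  rewrite heatZ//; last exact: hw.1.
  by rewrite (heat_semigroup t0 s0 hu0.1 f3) [s + t]addrC.
by rewrite rE mulrDr addrA.
Qed.

Lemma solves_restart (u0 : V -> R) T u s : in_Herz al q u0 -> solves u0 T u ->
  0 <= s <= T -> solves (u s) (T - s) (fun tau => u (tau + s)).
Proof.
move=> hu0 [gu eu] sT; have /andP[s0 sT'] := sT; split; first exact: good_shift.
move=> t /andP[t0 tT]; have stT : s + t <= T by lra.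
have tsT : 0 <= t + s <= T by rewrite addr_ge0//= addrC.
apply: filterS2 (eu _ tsT) (mild_map_restart hu0 gu s0 t0 stT (eu s sT)) => x.
by rewrite [t + s]addrC => -> ->.
Qed.

Lemma solves_glue (u0 : V -> R) s r u w : in_Herz al q u0 -> 0 <= s -> 0 <= r ->
  solves u0 s u -> solves (u s) r w ->
  solves u0 (s + r) (fun tau => if tau <= s then u tau else w (tau - s)).
Proof.
move=> hu0 s0 r0 su sw; have [gu eu] := su; have [gw ew] := sw.
set U := fun tau => _.
have ss : 0 <= s <= s by rewrite s0 lexx.
have rr : (0 : R) <= 0 <= r by rewrite lexx.
have w0 := solves_data r0 sw.
have Ul t : t <= s -> U t = u t by rewrite /U => ->.
have Ur t : 0 < t -> U (t + s) = w t.
  by move=> t0; rewrite /U leNgt ltrDr t0/= addrK.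
have gU : good (s + r) U.
  apply: (good_wlog b0 bq) => [t /andP[t0 tT]|e egt0].
    have [ts|ts] := leP t s; first by rewrite Ul//; apply: gu.1; rewrite t0.
    by rewrite -[t](subrK s) Ur ?subr_gt0//; apply: gw.1; rewrite subr_ge0 (ltW ts)/=; lra.
  have e2 : 0 < e / 2 by rewrite divr_gt0.
  have [d1 d10 h1] := gu.2 _ e2; have [d2 d20 h2] := gw.2 _ e2.
  exists (Num.min d1 d2) => [|t h]; first by rewrite lt_min d10.
  move=> t0 /andP[h0]; rewrite lt_min => /andP[hd1 hd2] thT.
  have [th_s|th_s] := leP (h + t) s.
    rewrite !Ul//; last by lra.
    apply: le_trans (h1 _ _ _ _ _) _; rewrite ?lee_fin; try lra.
    by rewrite addrK gtr0_norm.
  have [ts|ts] := leP t s; last first.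
    have hE : U (h + t) = w (h + t - s).
      by rewrite -[h + t in LHS](subrK s) Ur ?subr_gt0//; lra.
    have tE : U t = w (t - s) by rewrite -[t in LHS](subrK s) Ur ?subr_gt0.
    rewrite hE tE.
    apply: le_trans (h2 _ _ _ _ _) _; rewrite ?lee_fin; try lra.
    by rewrite (_ : _ - _ = h) ?gtr0_norm//; ring.
  rewrite (Ul t)// -[h + t](subrK s) Ur ?subr_gt0//.
  have hts : 0 <= h + t - s <= r by apply/andP; split; lra.
  have ts' : 0 <= t <= s by rewrite t0.
  have m1 := (gw.1 _ hts).1; have m2 := (gw.1 _ rr).1.
  have m3 := (gu.1 _ ss).1; have m4 := (gu.1 _ ts').1.
  (* An increment across the junction is split at s. The two pieces match there only almost
     everywhere, since [w 0] and [u s] are two representatives. *)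
  rewrite (Herz_ae_eq (g := fun x => (w (h + t - s) x - w 0 x) + (u s x - u t x)) al q0); last 3 first.
  - exact: measurable_funB.
  - by apply: measurable_funD; exact: measurable_funB.
  - by apply: filterS w0 => x ->; ring.
  apply: le_trans (HerzD al q1 (measurable_funB m1 m2) (measurable_funB m3 m4)) _.
  rewrite [e]splitr EFinD; apply: leeD.
    by apply: h2 => //; rewrite subr0 ger0_norm; lra.
  by apply: h1 => //; rewrite ger0_norm; lra.
split=> // t /andP[t0 tT].
have mU tau : 0 <= tau <= s + r -> measurable_fun setT (U tau).
  by move=> tauT; exact: (gU.1 tau tauT).1.
have [ts|ts] := leP t s.
  have ts' : 0 <= t <= s by rewrite t0.
  rewrite Ul//; apply: filterS (eu t ts') => x ->; apply: mild_map_ae_eq => tau /andP[tau0 taut].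
  have taus : tau <= s by lra.
  rewrite Ul//; have m := (gu.1 tau ltac:(by rewrite tau0)).1.
  by split=> //; exact: aeW.
have tsr : 0 <= t - s <= r by rewrite subr_ge0 (ltW ts)/=; lra.
have eUs : \forall x \ae mu, U s x = mm u0 U s x.
  rewrite Ul//; apply: filterS (eu s ss) => x ->; apply: mild_map_ae_eq => tau /andP[tau0 taut].
  have taus : tau <= s by lra.
  rewrite Ul//; have m := (gu.1 tau ltac:(by rewrite tau0)).1.
  by split=> //; exact: aeW.
have stT : s + (t - s) <= s + r by lra.
have := mild_map_restart hu0 gU s0 (andP tsr).1 stT eUs.
rewrite addrC subrK => hR.
have tE : U t = w (t - s) by rewrite -[t in LHS](subrK s) Ur ?subr_gt0.
rewrite tE.
apply: filterS2 (ew _ tsr) hR => x -> ->; rewrite (Ul s (lexx s)).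
apply: mild_map_ae_eq => tau /andP[tau0 taut].
have taur : 0 <= tau <= r by rewrite tau0; lra.
have mw := (gw.1 tau taur).1.
split=> //; first by apply: mU; apply/andP; split; lra.
move: tau0; rewrite le_eqVlt => /predU1P[<-|tau0]; last by rewrite Ur//; exact: aeW.
by rewrite add0r Ul.
Qed.

(** Both solutions are bounded on [0, T], so local uniqueness applies with one step length h
    throughout; finitely many restarts cover the interval. *)
Lemma solves_unique (u0 : V -> R) T u v : in_Herz al q u0 -> solves u0 T u -> solves u0 T v ->
  forall t, 0 <= t <= T -> \forall x \ae mu, u t x = v t x.
Proof.
move=> hu0 su sv.
have [M1 M10 uM] := good_bounded b0 bq su.1.
have [M2 M20 vM] := good_bounded b0 bq sv.1.
pose M := Num.max M1 M2.
have M0 : 0 < M by rewrite lt_max M10.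
have [h h0 hh] := local_uniqueness M0.
have bM (w : R -> V -> R) (N : R) t : N <= M -> (H (w t) <= N%:E)%E -> (H (w t) <= M%:E)%E.
  by move=> NM /le_trans; apply; rewrite lee_fin.
have M1M : M1 <= M by rewrite le_max lexx.
have M2M : M2 <= M by rewrite le_max lexx orbT.
have step (k : nat) t : 0 <= t <= T -> t <= k%:R * h -> \forall x \ae mu, u t x = v t x.
  elim: k t => [|k IH] t tT.
    rewrite mul0r => t0; have {t0} -> : t = 0.
      by apply/eqP; rewrite eq_le t0 (andP tT).1.
    have T0 : 0 <= T by case/andP: tT => ?; exact: le_trans.
    by apply: filterS2 (solves_data T0 su) (solves_data T0 sv) => x -> ->.
  rewrite -natr1 mulrDl mul1r => tk.
  have [tk'|tk'] := leP t (k%:R * h); first exact: IH.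
  pose s := k%:R * h.
  have s0 : 0 <= s by rewrite mulr_ge0// ltW.
  have sT : 0 <= s <= T by rewrite s0 (le_trans (ltW tk'))//; case/andP: tT.
  have uvs := IH s sT (lexx _).
  have hus := su.1.1 s sT; have hvs := sv.1.1 s sT.
  have ru := solves_restart hu0 su sT.
  have rv := solves_restart hu0 sv sT.
  (* The restarted [v] has data [v s], which equals [u s] almost everywhere; exchanging the data
     puts both solutions in the same problem. *)
  have rv' : solves (u s) (T - s) (fun tau => v (tau + s)).
    split; first exact: rv.1.
    move=> r /[dup] rT /andP[r0 _]; apply: filterS2 (rv.2 r rT)
      (mild_map_data_ae_eq (fun tau => v (tau + s)) r0 hvs.1 hus.1 _) => [x -> ->//|].
    by apply: filterS uvs => x ->.
  have sh r : 0 <= r <= T - s -> 0 <= r + s <= T.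
    by move=> /andP[h1 h2]; rewrite addr_ge0//=; lra.
  have tsT : 0 <= t - s <= T - s by rewrite subr_ge0 (ltW tk')/= lerB//; case/andP: tT.
  have := hh _ _ _ _ hus ru rv' (fun r rT => bM u M1 _ M1M (uM _ (sh r rT)))
    (fun r rT => bM v M2 _ M2M (vM _ (sh r rT))) (t - s) tsT.
  by rewrite subrK; apply; rewrite /s; lra.
pose k := (Num.trunc (T / h)).+1.
have hk : T <= k%:R * h.
  by rewrite -ler_pdivrMr//; apply/ltW; exact: truncnS_gt.
by move=> t tT; apply: (step k) => //; apply: le_trans hk; case/andP: tT.
Qed.

End solution.

(** * Maximal solutions *)

Section mild_solutions.
Context {R : realType} {n : nat}.
Local Notation V := 'rV[R]_n.
Local Notation mu := (@lebesgue_rV R n).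
Variables (a q beta gamma : R).
Local Notation sg := (beta + 1)^-1.
Local Notation p := (q * sg).
Local Notation th := ((n%:R - (n%:R - gamma) * sg) / 2).
Local Notation al := ((n%:R - gamma) / (beta + 1) - n%:R / q).
Local Notation al' := (n%:R * (1 - p^-1)).
Local Notation H := (Herz al q).
Local Notation HY := (Herz al' p).
Local Notation F := (@hardy_henon_source R n gamma beta).
Hypotheses (n0 : (0 < n)%N) (b0 : 0 < beta) (g0 : 0 < gamma) (gn : gamma < n%:R).
Hypotheses (th1 : th < 1) (bq : beta + 1 <= q).
Implicit Types (f g u v : R -> V -> R) (x y : V) (t T tau : R).

Let b1 : 0 < beta + 1. Proof. by rewrite addr_gt0. Qed.
Let sg0 : 0 < sg. Proof. by rewrite invr_gt0. Qed.
Let sg1 : sg < 1. Proof. by rewrite invf_lt1// ltrDr. Qed.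
Let q0 : 0 < q. Proof. exact: lt_le_trans bq. Qed.
Let q1 : 1 <= q. Proof. by apply: le_trans bq; rewrite lerDr ltW. Qed.
Let p1 : 1 <= p. Proof. by rewrite ler_pdivlMr// mul1r. Qed.
Let p0 : 0 < p. Proof. exact: lt_le_trans p1. Qed.
Let d0 : 0 < al + n%:R / q. Proof. by rewrite subrK mulr_gt0// subr_gt0. Qed.
Let dn : al + n%:R / q < n%:R.
Proof.
rewrite subrK (@lt_trans _ _ (n%:R - gamma))//; last by rewrite gtrBl.
by rewrite gtr_pMr// subr_gt0.
Qed.
Let e0 : 0 < 1 - th. Proof. by rewrite subr_gt0. Qed.

Local Notation good := (good q beta gamma).
Local Notation mm := (mild_map a beta gamma).
Local Notation solves := (solves a q beta gamma).
Local Notation leb := (@lebesgue_measure R).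

(** The equation integrates over [0, t], the operator over [0, t[; the two integrands agree for tau
    < t, and the endpoint is a null set. *)
Lemma duhamel_itv T K f t : source_path q sg T K f -> 0 <= K -> 0 <= t <= T ->
  \forall x \ae mu,
    leb.-integrable `[0, t] (fun tau => (heat (t - tau) (f tau) x)%:E) /\
    \int[leb]_(tau in `[0, t]) heat (t - tau) (f tau) x = duhamel f t x.
Proof.
move=> hf K0 tT; have /andP[t0 tT'] := tT.
have := duh_ker_integrable_ae n0 sg0 sg1 p1 g0 gn th1 hf K0 tT; apply: filterS => x fx.
have hint := duh_ker_integrable n0 p1 hf tT' fx.
pose k tau := heat (t - tau) (f tau) x.
have kE tau : tau \in `[0, t[%classic -> duh_ker f t tau x = k tau.
  by move=> tt; rewrite /duh_ker indicE tt mul1r.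
have kR : k \_ `[0, t[ = fun tau => duh_ker f t tau x.
  apply/funext => tau; rewrite patchE; case: ifPn => [/kE//|tt].
  by rewrite /duh_ker indicE (negbTE tt) mul0r.
have mco : measurable (`[0, t[%classic : set (measurableTypeR R)) by exact: measurable_itv.
have mcc : measurable (`[0, t]%classic : set (measurableTypeR R)) by exact: measurable_itv.
have hco : leb.-integrable `[0, t[ (EFin \o k).
  have hs := integrableS measurableT mco (@subsetT _ _) hint.
  by apply: eq_integrable hs => // tau tt /=; rewrite kE.
have mk : measurable_fun `[0, t[ k.
  by apply/measurable_EFinP; exact: measurable_int hco.
have mk' : measurable_fun `[0, t] k.
  rewrite -(@setUitv1 _ _ _ t true) ?bnd_simp//.
  have m1 : measurable ([set t] : set (measurableTypeR R)) by exact: measurable_set1.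
  by apply/(measurable_funU _ mco m1); split => //; exact: measurable_fun_set1.
split; last first.
  rewrite -Rintegral_itv_bndo_bndc// Rintegral_mkcond /duhamel.
  by apply: eq_Rintegral => tau _; rewrite kR.
apply/integrableP; split; first exact/measurable_EFinP.
rewrite -(@integral_itv_bndo_bndc _ (BLeft 0) t (fun tau => `|(k tau)%:E|%E)).
  by have /integrableP[_] := hco.
by apply: measurableT_comp => //; exact/measurable_EFinP.
Qed.

(** For a [good] path the convergence conditions hold for almost every x, so the equation reduces to
    its identity. This is the bridge between the formulation of the theorem and [solves]. *)
Lemma mild_at_iff T (u0 : V -> R) u t : in_Herz al q u0 -> good T u -> 0 <= t <= T ->
  \forall x \ae mu, mild_at a gamma beta u0 u t x <-> u t x = mm u0 u t x.
Proof.
move=> hu0 gu tT; have /andP[t0 tT'] := tT.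
have [C C0 hC] := good_source_path (n := n) b0 g0 bq.
have [M M0 uM] := good_bounded b0 bq gu.
have diff r : 0 <= r <= T -> (H (fun x => u r x - u r x)%R <= 0%:E)%E.
  move=> rT; rewrite (_ : (fun x => _) = (fun x => 0 * u r x)).
    by rewrite HerzZ ?normr0 ?mul0e//; exact: (gu.1 r rT).1.
  by apply/funext => x; rewrite subrr mul0r.
have [hF _] := hC T u u M 0 gu gu (ltW M0) uM uM diff.
have K0 : 0 <= C * M `^ beta * M by rewrite !mulr_ge0 ?powR_ge0// ltW.
have def0 : \forall x \ae mu, heat_defined t u0 x.
  move: t0; rewrite le_eqVlt => /predU1P[<-|t0]; first by apply: aeW => x; rewrite /heat_defined eqxx.
  apply: filterS (ge0_heat_lty_ae n0 q1 d0 dn t0 hu0) => x fx _.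
  by apply: heat_integrable => //; exact: hu0.1.
have defF x tau : 0 <= tau < t -> heat_defined (t - tau) (F (u tau)) x.
  move=> /andP[tau0 taut] _; have [mf Kf _] := hF.
  have tauT : 0 <= tau <= T by rewrite tau0 (le_trans (ltW taut)).
  apply: heat_integrable; first exact: mf.
  apply: (ge0_heat_source_lty n0 p1); rewrite ?subr_gt0//; first exact: mf.
  by apply: le_lt_trans (Kf tau tauT) _; exact: ltry.
apply: filterS2 def0 (duhamel_itv hF K0 tT) => x dx [ix iE]; split=> [[_ _ _]|uE].
  by rewrite iE.
by split => //; [exact: defF|rewrite uE /mild_map iE].
Qed.

(** The Heine-Cantor argument: half the radius of continuity at t serves for all nearby times, and
    compactness of [0, T] makes the choice uniform. *)
Lemma herz_continuous_good T u :
  herz_continuous al q%:E 1%:E `[0, T] u -> good T u.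
Proof.
move=> [hin hc].
have inI t : 0 <= t <= T -> `[0, T]%classic t by rewrite /= in_itv.
have mu_ t : 0 <= t <= T -> in_Herz al q (u t) by move=> /inI /hin /(herzP al _ q1).
split=> // e egt0; have e2 : 0 < e / 2 by rewrite divr_gt0.
have loc t : 0 <= t <= T -> exists2 d : R, 0 < d & forall s, 0 <= s <= T ->
    `|s - t| < d -> (H (fun x => u s x - u t x)%R <= (e / 2)%:E)%E.
  move=> tT; have := hc t (inI t tT); under eq_fun do rewrite herz_normE.
  move=> /cvge0P => /(_ (fun s => Herz_ge0 _ _ _) _ e2).
  move=> /nbhs_ballP[d /= dgt0 hd]; exists d => // s sT st.
  by apply: (hd s _ (inI s sT)); rewrite /ball/= distrC.
have := @segment_compact R 0 T => /compact_near_coveringP.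
move=> /(_ R (0^'+) (fun d t => forall s, 0 <= s <= T -> 0 <= t <= T -> `|s - t| < d ->
  (H (fun x => u s x - u t x)%R <= e%:E)%E)) cov.
have : \forall d \near 0^'+, `[0, T] `<=` (fun t => forall s, 0 <= s <= T ->
    0 <= t <= T -> `|s - t| < d -> (H (fun x => u s x - u t x)%R <= e%:E)%E).
  apply: cov => t /=; rewrite in_itv/= => tT.
  have [d dgt0 hd] := loc t tT; have d2 : 0 < d / 2 by rewrite divr_gt0.
  near=> t' d' => s sT t'T st'.
  have tt' : `|t - t'| < d / 2.
    by near: t'; apply/nbhs_ballP; exists (d / 2).
  have d'2 : d' < d / 2 by near: d'; exact: nbhs_right_lt.
  have st : `|s - t| < d.
    rewrite (_ : s - t = (s - t') + (t' - t)); last by ring.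
    rewrite (le_lt_trans (ler_normD _ _))// [`|t' - t|]distrC [d]splitr.
    by rewrite ltrD// (lt_trans st').
  rewrite [e]splitr.
  apply: (Herz_triangle b0 bq (mu_ s sT).1 (mu_ t tT).1 (mu_ t' t'T).1); first exact: hd.
  by rewrite HerzBC; apply: hd => //; rewrite distrC (lt_trans tt')// [ltRHS]splitr ltrDl.
move=> /nbhs_ballP[d /= dgt0 hd].
have d2 : 0 < d / 2 by rewrite divr_gt0.
exists (d / 2) => // s t sT tT st.
apply: (hd (d / 2) _ _ t (inI t tT) s sT tT st) => //.
rewrite /ball/= sub0r normrN gtr0_norm// [ltRHS]splitr ltrDl//.
Unshelve. all: by end_near. Qed.

(** The hypothesis asks that near each of its times [I] be contained in an interval [0, T] on which
    the path is [good]; this covers closed and half-open intervals alike. *)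
Lemma good_herz_continuous (I : set R) u :
  (forall t, I t -> exists T, [/\ 0 <= t <= T, good T u & exists2 r : R, 0 < r &
     forall s, I s -> `|s - t| < r -> 0 <= s <= T]) ->
  herz_continuous al q%:E 1%:E I u.
Proof.
move=> hI; split=> [t /hI[T [tT gu _]]|t /hI[T [tT gu [r r0 hr]]]].
  by apply/(herzP al _ q1); exact: (gu.1 t tT).
under eq_fun do rewrite herz_normE.
apply/cvge0P => [s|e egt0]; first exact: Herz_ge0.
have [d dgt0 hd] := gu.2 e egt0.
apply/nbhs_ballP; exists (Num.min d r) => /=; first by rewrite lt_min dgt0.
move=> s; rewrite /ball/= lt_min distrC => /andP[sd sr] Is.
exact: hd (hr s Is sr) tT sd.
Qed.

Lemma mild_solution_solves (u0 : V -> R) T u : in_Herz al q u0 ->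
  mild_solution a gamma beta al q%:E 1%:E u0 `[0, T] u -> solves u0 T u.
Proof.
move=> hu0 [hc hm]; have gu := herz_continuous_good hc; split=> // t tT.
have It : `[0, T]%classic t by rewrite /= in_itv.
by apply: filterS2 (hm t It) (mild_at_iff hu0 gu tT) => x h [h1 _]; exact: h1.
Qed.

Lemma solves_mild_solution (u0 : V -> R) (I : set R) u : in_Herz al q u0 ->
  (forall t, I t -> exists T, [/\ 0 <= t <= T, solves u0 T u & exists2 r : R, 0 < r &
     forall s, I s -> `|s - t| < r -> 0 <= s <= T]) ->
  mild_solution a gamma beta al q%:E 1%:E u0 I u.
Proof.
move=> hu0 hI; split.
  by apply: good_herz_continuous => t /hI[T [tT [gu _] hr]]; exists T.
move=> t /hI[T [tT [gu eu] _]].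
by apply: filterS2 (eu t tT) (mild_at_iff hu0 gu tT) => x h [_ h1]; exact: h1.
Qed.

(** Restart from [u s] and glue; the gain h in the length of the interval depends only on the bound
    M. *)
Lemma solves_extend (M : R) : 0 < M -> exists2 h : R, 0 < h &
  forall (u0 : V -> R) s u, in_Herz al q u0 -> 0 <= s -> solves u0 s u ->
  (H (u s) <= M%:E)%E -> exists v, solves u0 (s + h) v.
Proof.
move=> M0; have [h h0 hh] := local_existence a n0 b0 g0 gn th1 bq M0.
exists h => // u0 s u hu0 s0 su uM.
have ss : 0 <= s <= s by rewrite s0 lexx.
have [w sw] := hh (u s) (su.1.1 s ss) uM.
by eexists; exact: (solves_glue n0 b0 g0 gn th1 bq hu0 s0 (ltW h0) su sw).
Qed.

Lemma maximal_solution (u0 : V -> R) : in_Herz al q u0 ->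
  exists (T : R) (u : R -> V -> R),
    [/\ 0 < T, solves u0 T u &
        exists (Tmax : \bar R) (U : R -> V -> R),
          [/\ (T%:E < Tmax)%E,
              (forall t, 0 <= t -> (t%:E < Tmax)%E -> solves u0 t U),
              (forall (T' : R) v, (Tmax <= T'%:E)%E -> ~ solves u0 T' v) &
              Tmax = +oo%E \/
              ((Tmax < +oo)%E /\
               H (U t) @[t --> (fine Tmax)^'-] --> +oo%E)]].
Proof.
move=> hu0.
pose E := [set T : R | 0 < T /\ exists u, solves u0 T u].
pose Tmax := ereal_sup (EFin @` E).
have Tmax_ge T u : 0 < T -> solves u0 T u -> (T%:E <= Tmax)%E.
  by move=> T0 su; apply: ereal_sup_ubound; exists T => //; split=> //; exists u.
have bound (f : V -> R) : in_Herz al q f -> exists2 M : R, 0 < M & (H f <= M%:E)%E.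
  move=> [_ ff]; exists (fine (H f) + 1).
    by rewrite ltr_wpDl// fine_ge0// Herz_ge0.
  by rewrite EFinD fineK ?leeDl// ge0_fin_numE// Herz_ge0.
have [M M0 u0M] := bound u0 hu0.
have [h h0 hh] := local_existence a n0 b0 g0 gn th1 bq M0.
have [u su] := hh u0 hu0 u0M.
have h2 : 0 < h / 2 by rewrite divr_gt0.
have hh2 : h / 2 < h by rewrite [ltRHS]splitr ltrDl.
exists (h / 2), u; split => //; first exact: solves_le (ltW hh2) su.
have /choice[w hw] : forall t, exists w, 0 <= t -> (t%:E < Tmax)%E ->
    exists2 T', t < T' & solves u0 T' w.
  move=> t; have [tT|tT] := boolP (t%:E < Tmax)%E; last by exists u.
  have [_ [T' [T'0 [w sw]] <-]] := ereal_sup_gt tT.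
  by rewrite lte_fin => tT'; exists w => _ _; exists T'.
(* A diagonal choice: for each t a solution living beyond t is selected and evaluated at t. By
   uniqueness it agrees almost everywhere with any other solution defined there. *)
pose U t := w t t.
have sU t : 0 <= t -> (t%:E < Tmax)%E -> solves u0 t U.
  move=> t0 tT; have [T' tT' sw] := hw t t0 tT.
  apply: (solves_ae_eq b0 bq (solves_le (ltW tT') sw)) => s /andP[s0 st].
  have sT : (s%:E < Tmax)%E by apply: le_lt_trans tT; rewrite lee_fin.
  have [T2 sT2 sw2] := hw s s0 sT.
  have ss2 : 0 <= s <= T2 by rewrite s0 ltW.
  split; first exact: (sw2.1.1 s ss2).1.
  have sm : 0 <= s <= Num.min T' T2.
    by rewrite s0 le_min (ltW sT2) (le_trans st)// ltW.
  have m1 : Num.min T' T2 <= T' by rewrite ge_min lexx.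
  have m2 : Num.min T' T2 <= T2 by rewrite ge_min lexx orbT.
  exact: (solves_unique n0 b0 g0 gn th1 bq hu0 (solves_le m2 sw2) (solves_le m1 sw) sm).
(* A solution on a closed interval can always be continued, so the supremum [Tmax] is not
   attained. *)
have no_ext s v : 0 <= s -> solves u0 s v -> forall N : R, 0 < N -> (H (v s) <= N%:E)%E ->
    exists2 d : R, 0 < d & ((s + d)%:E <= Tmax)%E.
  move=> s0 sv N N0 vN; have [d dgt0 hd] := solves_extend N0.
  have [v' sv'] := hd u0 s v hu0 s0 sv vN.
  by exists d => //; apply: Tmax_ge sv'; rewrite ltr_wpDl.
have hT : ((h / 2)%:E < Tmax)%E.
  by apply: lt_le_trans (Tmax_ge h u h0 su); rewrite lte_fin.
exists Tmax, U; split => //.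
  move=> T' v TT' sv.
  have T'0 : 0 <= T' by rewrite -lee_fin ltW// (lt_le_trans _ TT')// (lt_trans _ hT)// lte_fin.
  have TT0 : 0 <= T' <= T' by rewrite T'0 lexx.
  have [N N0 vN] := bound _ (sv.1.1 T' TT0).
  have [d dgt0 hd] := no_ext T' v T'0 sv N N0 vN.
  by have := le_trans hd TT'; rewrite lee_fin gerDl leNgt dgt0.
case TE : Tmax hT => [r| |] hT; [right|by left|by rewrite ltNge leNye in hT].
split; first exact: ltry.
(* The gain d depends only on N. A norm below [A] at any time t > r - d would give a solution on
   [0, t + d], beyond the supremum r; since this excludes every such t, the norm has limit +oo and
   not merely an infinite upper limit. *)
apply/cvgeyPge => A; pose N := Num.max A 1.
have N0 : 0 < N by rewrite lt_max ltr01 orbT.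
have [d dgt0 hd] := solves_extend N0.
have r0 : 0 < r by move: hT; rewrite lte_fin; exact: lt_trans.
near=> t.
have tr : t < r by near: t; exact: nbhs_left_lt.
have t0 : 0 < t by near: t; exact: nbhs_left_gt.
have tdr : r - d < t by near: t; apply: nbhs_left_gt; rewrite gtrBl.
rewrite leNgt; apply/negP => HA.
have st : solves u0 t U by apply: sU; rewrite ?ltW// TE lte_fin.
have UN : (H (U t) <= N%:E)%E.
  by apply: le_trans (ltW HA) _; rewrite lee_fin le_max lexx.
have [v sv] := hd u0 t U hu0 (ltW t0) st UN.
have := Tmax_ge (t + d) v (addr_gt0 t0 dgt0) sv.
by rewrite TE lee_fin; lra.
Unshelve. all: by end_near. Qed.

End mild_solutions.

Theorem theorem3p6 (R : realType) (n : nat) (a q beta gamma : R)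
    (hn : (1 <= n)%N) (hq : 1 <= q) (hbeta : 0 < beta)
    (hgamma0 : 0 < gamma)
    (hgamma : gamma < Num.min n%:R (2 - (n%:R - 2) * beta))
    (hqbeta : beta + 1 <= q) :
  let alpha := (n%:R - gamma) / (beta + 1) - n%:R / q in
  forall u0 : 'rV[R]_n -> R, herz alpha q%:E 1%:E u0 ->
  exists (T : R) (u : R -> 'rV[R]_n -> R),
    [/\ 0 < T,
        mild_solution a gamma beta alpha q%:E 1%:E u0 `[0, T] u,
        (forall v : R -> 'rV[R]_n -> R,
           mild_solution a gamma beta alpha q%:E 1%:E u0 `[0, T] v ->
           forall t, 0 <= t <= T -> v t = u t %[ae lebesgue_rV n]) &
        exists (Tmax : \bar R) (U : R -> 'rV[R]_n -> R),
          [/\ (T%:E < Tmax)%E,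
              mild_solution a gamma beta alpha q%:E 1%:E u0
                [set t | 0 <= t /\ (t%:E < Tmax)%E] U,
              (forall t, 0 <= t <= T -> U t = u t %[ae lebesgue_rV n]),
              (forall (T' : R) (v : R -> 'rV[R]_n -> R),
                 (Tmax <= T'%:E)%E ->
                 mild_solution a gamma beta alpha q%:E 1%:E u0 `[0, T'] v ->
                 ~ (forall t, 0 <= t -> (t%:E < Tmax)%E ->
                      v t = U t %[ae lebesgue_rV n])) &
              Tmax = +oo%E \/
              ((Tmax < +oo)%E /\
               herz_norm alpha q%:E 1%:E (U t) @[t --> (fine Tmax)^'-]
                 --> +oo%E)]].
Proof.
move=> alpha u0 /(herzP alpha u0 hq) hu0; rewrite /alpha in hu0 *.
move: hgamma; rewrite lt_min => /andP[gn g2].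
have b1 : 0 < beta + 1 by rewrite addr_gt0.
have th1 : (n%:R - (n%:R - gamma) / (beta + 1)) / 2 < 1.
  rewrite ltr_pdivrMr// mul1r ltrBlDl -ltrBlDr ltr_pdivlMr//; lra.
have [T [u [T0 su [Tmax [U [TT sU noext blowup]]]]]] :=
  maximal_solution a hn hbeta hgamma0 gn th1 hqbeta hu0.
have solution T' v : solves a q beta gamma u0 T' v ->
    mild_solution a gamma beta alpha q%:E 1%:E u0 `[0, T'] v.
  move=> sv; apply: (solves_mild_solution hn hbeta hgamma0 gn th1 hqbeta hu0) => t /=.
  rewrite in_itv/= => tT; exists T'; split=> //; exists 1 => [//|s Is _].
  by move: Is; rewrite /= in_itv.
have unique T' v w : solves a q beta gamma u0 T' v -> solves a q beta gamma u0 T' w ->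
    forall t, 0 <= t <= T' -> v t = w t %[ae lebesgue_rV n].
  move=> sv sw t tT.
  have := solves_unique hn hbeta hgamma0 gn th1 hqbeta hu0 sv sw tT.
  by apply: filterS.
have back T' v : mild_solution a gamma beta alpha q%:E 1%:E u0 `[0, T'] v ->
    solves a q beta gamma u0 T' v.
  exact: mild_solution_solves.
exists T, u; split => //; [exact: solution|by move=> v /back sv; exact: unique|].
exists Tmax, U; split => //.
- apply: (solves_mild_solution hn hbeta hgamma0 gn th1 hqbeta hu0) => t [t0 tT].
  (* A time strictly between t and [Tmax], so that a whole neighbourhood of t in the maximal
     interval lies in [0, T']. *)
  have [T' tT' T'T] : exists2 T', t < T' & (T'%:E < Tmax)%E.
    case: Tmax tT {TT sU noext blowup} => [r| |]//.
    + rewrite lte_fin => tr; exists ((t + r) / 2); first by lra.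
      by rewrite lte_fin; lra.
    + by move=> _; exists (t + 1); [rewrite ltrDl|exact: ltry].
  exists T'; split; first by rewrite t0 ltW.
    by apply: sU => //; rewrite (le_trans t0)// ltW.
  exists (T' - t) => [|s [s0 _] st]; first by rewrite subr_gt0.
  by rewrite s0/=; have := ler_norm (s - t); lra.
- by apply: unique su; apply: sU => //; exact: ltW.
- by move=> T' v TT' /back sv _; exact: noext TT' sv.
case: blowup => [->|[h1 h2]]; [by left|right; split => //].
by under eq_fun do rewrite herz_normE.
Qed.
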